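(* Let $(X,d,\mu,\mathcal{E},\mathcal{F})$ be a Dirichlet space satisfying the standing assumptions (A1)–(A3), (HK), (BE) stated in the context, and let $0<\delta<1$. Assume $\alpha_1^{\#}<1$. Then there exists a constant $C>0$ such that for every $f\in\mathbf{B}^{1,\alpha_1^{\#}}(X)$ and every $t>0$, $$\|P^{(\delta)}_tf-f\|_{L^1(X,\mu)}\le C\,t^{\alpha_1^{\#}}\,\mathbf{Var}(f).$$
   Context: Setting. $(X,d,\mu)$ is a locally compact metric measure space, $\mu$ a Radon measure supported on $X$, and $(\mathcal{E},\mathcal{F})$ is a Dirichlet form on $L^2(X,\mu)$ with heat semigroup $\{P_t\}_{t>0}$ and generator $L$. Write $B(x,r)=\{y: d(x,y)<r\}$. For $\lambda>0$, $1\le p<\infty$, $KS^{\lambda,p}(X)$ is the set of $f\in L^p(X,\mu)$ with $\limsup_{r\to0^+}\int_X\int_{B(x,r)}\frac{|f(x)-f(y)|^p}{r^{\lambda p}\mu(B(x,r))}d\mu(y)d\mu(x)<\infty$. Standing assumptions. (A1) Every ball $B(x,r)$ has compact closure. (A2) There are $c_1,c_2,d_H>0$ with $c_1r^{d_H}\le\mu(B(x,r))\le c_2r^{d_H}$ for all $x\in X$, $r\ge0$. (A3) $(\mathcal{E},\mathcal{F})$ is regular and strongly local. (HK) $\{P_t\}$ has a continuous heat kernel $p_t(x,y)$ and there are $c_3,c_4,c_5,c_6\in(0,\infty)$, $d_W\in[2,\infty)$ with $c_5t^{-d_H/d_W}\exp(-c_6(d(x,y)^{d_W}/t)^{1/(d_W-1)})\le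 p_t(x,y)\le c_3t^{-d_H/d_W}\exp(-c_4(d(x,y)^{d_W}/t)^{1/(d_W-1)})$ for $\mu\times\mu$-a.e. $(x,y)$ and every $t>0$. (BE) There is $C>0$ such that $|P_tg(x)-P_tg(y)|\le C\frac{d(x,y)^\kappa}{t^{\kappa/d_W}}\|g\|_{L^\infty(X,\mu)}$ for all $t>0$, $g\in L^\infty(X,\mu)$, $x,y\in X$, where $0<\kappa<d_W$ is defined by $d_W-\kappa=\sup\{\lambda>0: KS^{\lambda,1}(X)\text{ contains non-constant functions}\}$. Subordinated semigroup. For fixed $0<\delta<1$ let $\eta^{(\delta)}_t\ge0$ be the continuous function with $\int_0^\infty\eta^{(\delta)}_t(s)e^{-s\lambda}ds=e^{-t\lambda^\delta}$ for $\lambda>0$. The semigroup with generator given by the fractional Laplacian $(-L)^\delta$ is $P^{(\delta)}_tf=\int_0^\infty\eta^{(\delta)}_t(s)P_sf\,ds$, with heat kernel $p^{(\delta)}_t(x,y)=\int_0^\infty\eta^{(\delta)}_t(s)p_s(x,y)ds$. Besov classes. For $p\ge1$, $\alpha\ge0$: $\|f\|_{p,\alpha}=\sup_{t>0}t^{-\alpha}\left(\int_X\int_X|f(x)-f(y)|^pp^{(\delta)}_t(x,y)d\mu(x)d\mu(y)\right)^{1/p}$ and $\mathbf{B}^{p,\alpha}(X)=\{f\in L^p(X,\mu):\|f\|_{p,\alpha}<\infty\}$. The $L^1$ critical exponent is $\alpha_1^{\#}=\sup\{\alpha>0:\mathbf{B}^{1,\alpha}(X)\text{ contains non-constant functions}\}$;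 the condition $\alpha_1^{\#}<1$ is equivalent to $\delta>1-\frac{\kappa}{d_W}$. Variation. $\mathbf{Var}(f)=\liminf_{r\to0^+}\int_X\int_{B(x,r)}\frac{|f(y)-f(x)|}{r^{d_W-\kappa}\mu(B(x,r))}d\mu(y)d\mu(x)$. *)

(* Defs.v *)
From HB Require Import structures.
From mathcomp Require Import all_boot all_order all_algebra.
From mathcomp Require Import all_classical all_reals all_analysis.

Set Implicit Arguments.
Unset Strict Implicit.
Unset Printing Implicit Defensive.

Import Order.TTheory GRing.Theory Num.Theory.
Import numFieldNormedType.Exports.

Local Open Scope classical_set_scope.
Local Open Scope ring_scope.

(* A metric space that also carries a sigma-algebra; [is_borel] relates the two. *)
#[short(type="metricMeasurableType")]
HB.structure Definition MetricMeasurable d (R : realType) :=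
  {X of Measurable d X & Metric R X}.

Section metric_measure_space.
Context {d : measure_display} {R : realType} {X : metricMeasurableType d R}.

Definition is_borel : Prop :=
  @measurable d X = <<s [set U : set X | open U] >>.

Variable mu : {measure set X -> \bar R}.

Definition radon_measure : Prop :=
  [/\ forall K : set X, compact K -> (mu K < +oo)%E,
      forall A : set X, measurable A ->
        mu A = ereal_inf [set mu U | U in [set U | open U /\ A `<=` U]]
    & forall U : set X, open U ->
        mu U = ereal_sup [set mu K | K in [set K | compact K /\ K `<=` U]]].

Definition full_support : Prop :=
  forall U : set X, open U -> U !=set0 -> (0 < mu U)%E.

Definition proper_balls : Prop :=
  forall (x : X) (r : R), compact (closure (ball x r)).

Definition ahlfors_regular (dH : R) : Prop :=
  0 < dH /\
  exists c1 c2 : R, [/\ 0 < c1, 0 < c2 & forall (x : X) (r : R), 0 <= r ->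
    ((c1 * r `^ dH)%:E <= mu (ball x r))%E /\
    (mu (ball x r) <= (c2 * r `^ dH)%:E)%E].

Definition nonconstant (f : X -> R) : Prop :=
  ~ exists c : R, \forall x \ae mu, f x = c.

(* Integral at scale [r] entering both the Korevaar-Schoen spaces and the
   variation. *)
Definition KS_energy (lambda p : R) (f : X -> R) (r : R) : \bar R :=
  (\int[mu]_x \int[mu]_(y in ball x r)
    (`|f x - f y| `^ p / (r `^ (lambda * p) * fine (mu (ball x r))))%:E)%E.

Definition KS (lambda p : R) : set (X -> R) :=
  [set f | f \in Lfun mu p%:E /\
           (limf_esup (KS_energy lambda p f) 0^'+ < +oo)%E].

Definition KS_critical : \bar R :=
  ereal_sup [set lambda%:E | lambda in
    [set lambda : R | 0 < lambda /\ exists2 f, KS lambda 1 f & nonconstant f]].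

Definition Var (dW kappa : R) (f : X -> R) : \bar R :=
  limf_einf (KS_energy (dW - kappa) 1 f) 0^'+.

(* Elements of L^2 are handled through representatives: [F] is a set of
   functions saturated for almost-everywhere equality, and [E] is invariant
   under it. The values of [E] outside [F] are irrelevant. *)

Definition L2norm (f : X -> R) : \bar R := 'N[mu]_2%:E[EFin \o f].

Definition inner (f g : X -> R) : R := \int[mu]_x (f x * g x).

Section dirichlet_form.
Variables (F : set (X -> R)) (E : (X -> R) -> (X -> R) -> R).

Definition E1 (f : X -> R) : R := E f f + inner f f.

Record dirichlet_form : Prop := {
  form_L2 : forall f, F f -> f \in Lfun mu 2%:E ;
  form_ae : forall f g, F f -> g \in Lfun mu 2%:E ->
    (\forall x \ae mu, f x = g x) -> F g ;
  form_linear : forall (a : R) f g, F f -> F g ->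
    F (fun x => a * f x + g x) ;
  form_dense : forall f, f \in Lfun mu 2%:E -> forall e : R, 0 < e ->
    exists2 g, F g & (L2norm (fun x => (f x - g x)%R) < e%:E)%E ;
  form_E_ae : forall f f' g, F f -> F f' -> F g ->
    (\forall x \ae mu, f x = f' x) -> E f g = E f' g ;
  form_E_linear : forall (a : R) f g h, F f -> F g -> F h ->
    E (fun x => a * f x + g x) h = a * E f h + E g h ;
  form_E_sym : forall f g, F f -> F g -> E f g = E g f ;
  form_E_ge0 : forall f, F f -> 0 <= E f f ;
  form_closed : forall u : nat -> X -> R, (forall n, F (u n)) ->
    (forall e : R, 0 < e -> exists N : nat, forall m n : nat,
      (N <= m)%N -> (N <= n)%N -> E1 (fun x => u m x - u n x) < e) ->
    exists2 f, F f & E1 (fun x => u n x - f x) @[n --> \oo] --> (0 : R) ;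
  form_markov : forall f, F f ->
    let f1 := fun x => Num.min (Num.max (f x) 0) 1 in
    F f1 /\ E f1 f1 <= E f f
}.

Definition Cc : set (X -> R) :=
  [set f | continuous f /\ compact (closure [set x | f x != 0])].

Definition regular_form : Prop :=
  (forall f, F f -> forall e : R, 0 < e ->
    exists2 g, (F `&` Cc) g & E1 (fun x => f x - g x) < e) /\
  (forall f, Cc f -> forall e : R, 0 < e ->
    exists2 g, (F `&` Cc) g & forall x, `|f x - g x| <= e).

(* Support of the signed measure f mu; unlike the closure of {f <> 0}, it
   does not depend on the representative. *)
Definition msupport (f : X -> R) : set X :=
  [set x | forall U : set X, open U -> U x ->
     ~ (\forall y \ae mu, U y -> f y = 0)].

Definition strongly_local_form : Prop :=
  forall f g, F f -> F g -> compact (msupport f) -> compact (msupport g) ->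
    (exists (U : set X) (c : R),
      [/\ open U, msupport f `<=` U & \forall x \ae mu, U x -> g x = c]) ->
    E f g = 0.

End dirichlet_form.

Section semigroup.
Variable P : R -> (X -> R) -> (X -> R).

Record symmetric_markov_semigroup : Prop := {
  sgr_L2 : forall t f, 0 < t -> f \in Lfun mu 2%:E -> P t f \in Lfun mu 2%:E ;
  sgr_ae : forall t f g, 0 < t ->
    f \in Lfun mu 2%:E -> g \in Lfun mu 2%:E ->
    (\forall x \ae mu, f x = g x) -> \forall x \ae mu, P t f x = P t g x ;
  sgr_linear : forall t (a : R) f g, 0 < t ->
    f \in Lfun mu 2%:E -> g \in Lfun mu 2%:E ->
    \forall x \ae mu, P t (fun y => a * f y + g y) x = a * P t f x + P t g x ;
  sgr_sym : forall t f g, 0 < t ->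
    f \in Lfun mu 2%:E -> g \in Lfun mu 2%:E ->
    inner (P t f) g = inner f (P t g) ;
  sgr_contraction : forall t f, 0 < t -> f \in Lfun mu 2%:E ->
    (L2norm (P t f) <= L2norm f)%E ;
  sgr_markov : forall t f, 0 < t -> f \in Lfun mu 2%:E ->
    (\forall x \ae mu, 0 <= f x <= 1) -> \forall x \ae mu, 0 <= P t f x <= 1 ;
  sgr_add : forall s t f, 0 < s -> 0 < t -> f \in Lfun mu 2%:E ->
    \forall x \ae mu, P (s + t) f x = P s (P t f) x ;
  sgr_continuous : forall f, f \in Lfun mu 2%:E ->
    L2norm (fun x => P t f x - f x) @[t --> 0^'+] --> (0 : \bar R)
}.

(* [f] is in the domain of the infinitesimal generator L of [P], and L f = h. *)
Definition generator (f h : X -> R) : Prop :=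
  [/\ f \in Lfun mu 2%:E, h \in Lfun mu 2%:E &
      L2norm (fun x => (P t f x - f x) / t - h x) @[t --> 0^'+]
        --> (0 : \bar R)].

(* [P] is the semigroup whose generator L is the operator of the form:
   f in dom L and L f = h iff f in F and E(f, g) = - <h, g> for all g in F. *)
Definition heat_semigroup (F : set (X -> R)) (E : (X -> R) -> (X -> R) -> R) :
    Prop :=
  symmetric_markov_semigroup /\
  forall f h, f \in Lfun mu 2%:E -> h \in Lfun mu 2%:E ->
    (generator f h <-> F f /\ forall g, F g -> E f g = - inner h g).

End semigroup.

Section kernel.
Variable p : R -> X -> X -> R.

(* Extension of the semigroup to L^1 and L^infty, defined at every point. *)
Definition heat (t : R) (f : X -> R) (x : X) : R :=
  \int[mu]_y (p t x y * f y).

Definition continuous_heat_kernel (P : R -> (X -> R) -> (X -> R)) : Prop :=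
  (forall t x y, 0 < t ->
    {for (t, x, y), continuous (fun z : R * X * X => p z.1.1 z.1.2 z.2)}) /\
  (forall t f, 0 < t -> f \in Lfun mu 2%:E ->
    \forall x \ae mu, P t f x = heat t f x).

Definition sub_gaussian (dH dW c c' t r : R) : R :=
  c * t `^ (- (dH / dW)) * expR (- (c' * (r `^ dW / t) `^ (dW - 1)^-1)).

Definition heat_kernel_estimates (dH dW : R) : Prop :=
  2 <= dW /\
  exists c3 c4 c5 c6 : R,
    [/\ 0 < c3, 0 < c4, 0 < c5 & 0 < c6] /\
    forall t : R, 0 < t -> \forall z \ae (mu \x mu)%E,
      sub_gaussian dH dW c5 c6 t (mdist z.1 z.2) <= p t z.1 z.2
        <= sub_gaussian dH dW c3 c4 t (mdist z.1 z.2).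

Definition bakry_emery (dW kappa : R) : Prop :=
  [/\ 0 < kappa, kappa < dW, KS_critical = (dW - kappa)%:E &
  exists2 C : R, 0 < C &
    forall (t : R) (g : X -> R), 0 < t -> g \in Lfun mu +oo%E ->
    forall x y : X,
      (`|heat t g x - heat t g y|%:E <=
       (C * (mdist x y `^ kappa / t `^ (kappa / dW)))%:E *
         'N[mu]_+oo[EFin \o g])%E].

(* [eta t] is the density of the delta-stable subordinator at time [t]; only
   its values on ]0, +oo[ matter. *)
Definition subordinator (delta : R) (eta : R -> R -> R) : Prop :=
  forall t : R, 0 < t ->
  [/\ {in `]0, +oo[, continuous (eta t)},
      forall s : R, 0 < s -> 0 <= eta t s &
      forall lambda : R, 0 < lambda ->
        (\int[lebesgue_measure]_(s in `]0%R, +oo[)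
            (eta t s * expR (- (s * lambda)))%:E)%E
        = (expR (- (t * lambda `^ delta)))%:E].

Variable eta : R -> R -> R.

Definition sub_semigroup (t : R) (f : X -> R) (x : X) : R :=
  \int[lebesgue_measure]_(s in `]0, +oo[) (eta t s * heat s f x).

Definition sub_kernel (t : R) (x y : X) : \bar R :=
  (\int[lebesgue_measure]_(s in `]0%R, +oo[) (eta t s * p s x y)%:E)%E.

Definition besov_seminorm (q alpha : R) (f : X -> R) : \bar R :=
  ereal_sup [set ((t `^ (- alpha))%:E *
      (\int[mu]_y \int[mu]_x ((`|f x - f y| `^ q)%:E * sub_kernel t x y))
        `^ q^-1)%E | t in [set t : R | 0 < t]].

Definition besov (q alpha : R) : set (X -> R) :=
  [set f | f \in Lfun mu q%:E /\ (besov_seminorm q alpha f < +oo)%E].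

Definition alpha1 : \bar R :=
  ereal_sup [set alpha%:E | alpha in
    [set alpha : R | 0 < alpha /\ exists2 f, besov 1 alpha f & nonconstant f]].

End kernel.

End metric_measure_space.

Arguments is_borel {d R} X.
Arguments proper_balls {d R} X.

(* Main.v *)
Require Import Defs.
From HB Require Import structures.
From mathcomp Require Import all_boot all_order all_algebra finmap.
From mathcomp Require Import ring lra.
From mathcomp Require Import all_classical all_reals all_analysis measurable_realfun ess_sup_inf.
Import Order.TTheory GRing.Theory Num.Theory.
Import numFieldNormedType.Exports.
Local Open Scope classical_set_scope.
Local Open Scope ring_scope.

(** Write theta = 1 - kappa / dW, and call heat energy at time s the double
    integral of p_s(x,y) |f x - f y|.

    The subordinated semigroup is the average of the heat semigroup against the
    density eta_t, whose total mass is one, and p_s(x,.) has mass one as well.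
    Hence the L1 norm of P^(delta)_t f - f is at most the eta_t-average of the
    heat energies of f ([sub_semigroup_L1_le]). Since eta_t has moments of order
    t^(b / delta) for b < delta ([average_powR]), the theorem follows from two
    facts: the heat energy at time s is at most C s^theta Var f, and the critical
    exponent is theta / delta with theta < delta.

    The first fact is [heat_energy_le_Var]. For a set A of finite measure, the heat
    that has stayed in A drops between the times s and t + s by at most
    C s^(-kappa / dW) times the flux out of A of the kernel p_t(x,y) d(x,y)^kappa:
    the symmetry of p_t removes the pairs inside A, and the Bakry-Emery estimate
    compares P_s 1_A at the two ends of the other pairs ([stay_step]). Summing over
    s = t, 2t, ..., nt and integrating over the superlevel sets of f ([coarea])
    bounds the heat energy at a large time by the one at a small time t plus a
    weighted energy at time t ([energy_iterate]). The small time is tied to a scale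
    r by t ~ r^dW. Near the diagonal the weighted energy is the Korevaar-Schoen
    energy at scale r; far from it the kernel decays so fast that the weighted
    energy is a small multiple of a heat energy. If K is any constant such that the
    heat energies are at most K s^theta, the small multiple costs at most K / 2
    ([absorption]), and K is halved again and again until only the
    Korevaar-Schoen term remains. As r only has to be small, it can run along a
    sequence that realises the lower limit defining Var f. The finite K needed at
    the start is provided by the Besov condition.

    The second fact is [critical_exponent]. Power bounds t^b on heat energies
    correspond to Besov bounds, because p_t is dominated by the subordinated kernel
    at a time of order t^delta ([kernel_le_sub_kernel]), and to Korevaar-Schoen
    bounds, by a dyadic decomposition of the kernel
    ([heat_energy_le_oscillation]). The definition of kappa through the
    Korevaar-Schoen spaces then identifies the critical exponent, and theta >= delta
    is excluded because it would make it at least 1.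

    That p_s(x,.) has mass one is itself a consequence of the hypotheses
    ([mass_eq1]): by the Bakry-Emery estimate P_t 1 becomes flat for large t, the
    heat kernel lower bound keeps it away from 0, and the semigroup law then forces
    P_s 1 = 1. *)

(** * Integrals over products and the coarea formula *)

(** The integral of a nonnegative function is a supremum over the simple
    functions below it, hence monotone without measurability. This spares
    measurability proofs for the iterated integrals below. *)
Lemma ge0_le_integralW {d} {T : measurableType d} {R : realType}
  (mu : {measure set T -> \bar R}) (D : set T) (f g : T -> \bar R) :
  (forall x, D x -> 0 <= f x)%E -> (forall x, D x -> f x <= g x)%E ->
  (\int[mu]_(x in D) f x <= \int[mu]_(x in D) g x)%E.
Proof.
move=> f0 fg.
have g0 x : D x -> (0 <= g x)%E by move=> Dx; exact: le_trans (f0 _ Dx) (fg _ Dx).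
rewrite !ge0_integralE//; apply: le_ereal_sup => _ [h /= hf <-].
exists h => //= x; apply: le_trans (hf x) _.
by rewrite /patch; case: ifPn => //; rewrite inE => Dx; exact: fg.
Qed.

Lemma integral_swap {d} {T : measurableType d} {R : realType}
  (mu : {sigma_finite_measure set T -> \bar R}) (f : T * T -> \bar R) :
  measurable_fun setT f -> (forall z, 0 <= f z)%E ->
  (\int[mu \x mu]_z f (z.2, z.1) = \int[mu \x mu]_z f z)%E.
Proof.
move=> mf f0.
rewrite (fubini_tonelli1 (fun z => f (z.2, z.1)))//; last first.
  exact: (measurableT_comp mf (@measurable_swap _ _ T T)).
by rewrite (fubini_tonelli2 f).
Qed.

Section tonelli_parameter.
Context {d d'} {T : measurableType d} {S : measurableType d'} {R : realType}.
Context (mu : {sigma_finite_measure set T -> \bar R}).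
Context (nu : {sigma_finite_measure set S -> \bar R}).
Context (F : (T * T) * S -> \bar R).
Hypotheses (mF : measurable_fun setT F) (F0 : forall q, (0 <= F q)%E).

Let G (q : T * S) : \bar R := (\int[mu]_y F ((q.1, y), q.2))%E.

Let G0 q : (0 <= G q)%E.
Proof. exact: integral_ge0. Qed.

Let mG : measurable_fun setT G.
Proof.
pose H (r : (T * S) * T) : \bar R := F ((r.1.1, r.2), r.1.2).
suff mH : measurable_fun setT H by apply: (measurable_fun_fubini_tonelli_F H) => // r; exact: F0.
apply: (measurableT_comp mF).
apply: measurable_fun_pair => /=; last first.
  exact: (measurableT_comp measurable_snd measurable_fst).
apply: measurable_fun_pair => /=; last exact: measurable_snd.
exact: (measurableT_comp measurable_fst measurable_fst).
Qed.

Let integral_slice s : (\int[mu \x mu]_z F (z, s) = \int[mu]_x G (x, s))%E.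
Proof.
rewrite (fubini_tonelli1 (fun z => F (z, s)))//.
apply: (measurableT_comp mF); exact: measurable_pair2.
Qed.

Lemma measurable_tonelli_parameter :
  measurable_fun setT (fun s => \int[mu \x mu]_z F (z, s))%E.
Proof.
rewrite (_ : (fun _ => _) = fun s => (\int[mu]_x G (x, s))%E); last first.
  exact/funext/integral_slice.
exact: (measurable_fun_fubini_tonelli_G G).
Qed.

(** One variable is integrated at a time, so that Tonelli is applied only to
    mu and nu, whose sigma-finiteness is given, and not to the product
    measure. *)
Lemma tonelli_parameter :
  (\int[mu \x mu]_z \int[nu]_s F (z, s) =
   \int[nu]_s \int[mu \x mu]_z F (z, s))%E.
Proof.
rewrite (fubini_tonelli1 (fun z => \int[nu]_s F (z, s))%E); first last.
- by move=> z; exact: integral_ge0.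
- exact: (measurable_fun_fubini_tonelli_F F).
rewrite (eq_integral _ _ (fun s _ => integral_slice s)) -(fubini_tonelli G)//.
apply: eq_integral => x _.
rewrite /fubini_F/= /G/=.
rewrite (fubini_tonelli (fun q : T * S => F ((x, q.1), q.2)))//.
apply: (measurableT_comp mF); apply: measurable_fun_pair => //=.
apply: measurable_fun_pair => //=; exact: measurable_fst.
Qed.

End tonelli_parameter.

Lemma integral_layer_cake_maxr {R : realType} (a b : R) :
  (\int[@lebesgue_measure R]_u ((b <= u < a)%R%:R)%:E = (Num.max (a - b) 0)%:E)%E.
Proof.
transitivity (\int[@lebesgue_measure R]_u (\1_`[b, a[ u)%:E)%E.
  by apply: eq_integral => u _; rewrite indicE mem_setE in_itv/=.
rewrite integral_indic// setIT.
apply: (etrans (lebesgue_measure_itv `[b, a[)); rewrite /= lte_fin.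
case: ltP => ba; first by rewrite -EFinB max_l// subr_ge0 ltW.
by rewrite max_r// subr_le0.
Qed.

Definition positive_energy {d} {T : measurableType d} {R : realType}
    (mu : {measure set T -> \bar R}) (w : T * T -> R) (f : T -> R) : \bar R :=
  (\int[mu \x mu]_z (w z * Num.max (f z.1 - f z.2) 0)%:E)%E.

(** For w the kernel of a symmetric semigroup this is the amount of heat that
    leaves A, a nonlocal perimeter of A. *)
Definition flux {d} {T : measurableType d} {R : realType}
    (mu : {measure set T -> \bar R}) (w : T * T -> R) (A : set T) : \bar R :=
  (\int[mu \x mu]_z (w z * \1_A z.1 * \1_(~` A) z.2)%:E)%E.

(** The positive part of f x - f y is the length of the set of levels u that
    separate f y from f x, so the energy of f is the integral of the fluxes of
    its superlevel sets. *)
Lemma coarea {d} {T : measurableType d} {R : realType}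
  (mu : {sigma_finite_measure set T -> \bar R}) (w : T * T -> R) (f : T -> R) :
  measurable_fun setT w -> (forall z, 0 <= w z) -> measurable_fun setT f ->
  measurable_fun setT (fun u : R => flux mu w [set x | u < f x]) /\
  positive_energy mu w f =
    (\int[@lebesgue_measure R]_u flux mu w [set x | (u < f x)%R])%E.
Proof.
move=> mw w0 mf.
pose F (q : (T * T) * R) : \bar R :=
  (w q.1 * (f q.1.2 <= q.2 < f q.1.1)%R%:R)%:E.
have mF : measurable_fun setT F.
  apply/measurable_EFinP; apply: measurable_funM.
    exact: (measurableT_comp mw measurable_fst).
  have mf2 : measurable_fun setT (fun q : (T * T) * R => f q.1.2).
    apply: (measurableT_comp mf).
    exact: (measurableT_comp measurable_snd measurable_fst).
  have mf1 : measurable_fun setT (fun q : (T * T) * R => f q.1.1).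
    apply: (measurableT_comp mf).
    exact: (measurableT_comp measurable_fst measurable_fst).
  pose b (q : (T * T) * R) : bool := (f q.1.2 <= q.2) && (q.2 < f q.1.1).
  have mb : measurable_fun setT b.
    apply: measurable_and.
      by apply: measurable_fun_ler => //; exact: measurable_snd.
    by apply: measurable_fun_ltr => //; exact: measurable_snd.
  rewrite (_ : (fun _ => _) = fun q => if b q then 1 else 0 : R); last first.
    by apply/funext => q; rewrite /b; case: andP.
  exact: measurable_fun_ifT.
have F0 q : (0 <= F q)%E by rewrite lee_fin mulr_ge0.
have HE u : flux mu w [set x | u < f x] = (\int[mu \x mu]_z F (z, u))%E.
  apply: eq_integral => z _; rewrite /F/=; congr (_%:E).
  rewrite -mulrA; congr (_ * _).
  rewrite !indicE in_setC !mem_setE/= -leNgt.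
  by rewrite -natrM mulnb andbC.
split.
  rewrite (_ : (fun _ => _) = fun u => (\int[mu \x mu]_z F (z, u))%E); last exact/funext.
  exact: measurable_tonelli_parameter.
transitivity (\int[@lebesgue_measure R]_u \int[mu \x mu]_z F (z, u))%E; last first.
  by apply: eq_integral => u _; rewrite -HE.
rewrite -tonelli_parameter//.
apply: eq_integral => z _.
rewrite EFinM -integral_layer_cake_maxr -ge0_integralZl_EFin//.
apply/measurable_EFinP.
rewrite (_ : (fun _ => _) = \1_`[f z.2, f z.1[ :> (R -> R)) //.
by apply/funext => u; rewrite indicE mem_setE in_itv/=.
Qed.

(** * Measurability of continuous functions *)

(** A countable measurable base for the filters N x. Such bases pass to
    products, which makes continuous functions on a product measurable for the
    product sigma-algebra. *)
Definition measurable_base {d} {T : measurableType d}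
    (N : T -> set_system T) : Prop :=
  exists2 B : nat -> set T, forall n, measurable (B n) &
    forall x U, N x U -> exists2 n, B n x & B n `<=` U.

Lemma measurable_base_prod {d1 d2} {T1 : measurableType d1}
  {T2 : measurableType d2} (N1 : T1 -> set_system T1) (N2 : T2 -> set_system T2) :
  measurable_base N1 -> measurable_base N2 ->
  measurable_base (fun z : T1 * T2 => filter_prod (N1 z.1) (N2 z.2)).
Proof.
move=> [B1 mB1 hB1] [B2 mB2 hB2].
exists (fun n => if @choice.unpickle (nat * nat)%type n is Some (i, j)
                 then (B1 i `*` B2 j)%classic else set0).
  by move=> n; case: choice.unpickle => [[i j]|] //; exact: measurableX.
move=> [x y] U [[P Q] /= [NP NQ] PQU].
have [i Bix BiP] := hB1 _ _ NP; have [j Bjy BjQ] := hB2 _ _ NQ.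
exists (choice.pickle (i, j)); first by rewrite choice.pickleK.
by rewrite choice.pickleK => -[u v] [/= /BiP Pu /BjQ Qv]; apply: PQU.
Qed.

Lemma measurable_base_real (R : realType) :
  measurable_base (fun x : R => nbhs x).
Proof.
exists (fun n => if @choice.unpickle (rat * rat)%type n is Some (a, b)
                 then `](ratr a : R), (ratr b : R)[%classic else set0).
  by move=> n; case: choice.unpickle => [[i j]|].
move=> x U /nbhs_ballP[e /= e0 xU].
have [a] : exists a : rat, x - e < ratr a < x.
  by have [a ha] := @rat_in_itvoo R (x - e) x ltac:(by rewrite ltrBlDr ltrDl);
     exists a.
have [b] : exists b : rat, x < ratr b < x + e.
  by have [b hb] := @rat_in_itvoo R x (x + e) ltac:(by rewrite ltrDl); exists b.
move=> /andP[xb be] /andP[ea ax].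
exists (choice.pickle (a, b)); rewrite choice.pickleK /=; first by rewrite in_itv/= ax.
move=> y /=; rewrite in_itv/= => /andP[ay yb]; apply: xU.
by rewrite /ball/= ltr_norml; apply/andP; split; lra.
Qed.

Lemma measurable_fun_base {d} {T : measurableType d} {R : realType}
  (N : T -> set_system T) (D : set T) (g : T -> R) :
  measurable_base N -> (forall x U V, N x U -> N x V -> N x (U `&` V)) ->
  (forall x, D x -> N x D) ->
  (forall x U, D x -> nbhs (g x) U -> N x (g @^-1` U)) ->
  measurable_fun D g.
Proof.
move=> [B mB hB] NI ND Ng mD.
apply: (measurability _ (RGenOInfty.measurableE R)) => // _ [_ [a ->] <-].
pose S := D `&` g @^-1` `]a, +oo[%classic.
rewrite (_ : _ `&` _ = \bigcup_(n in [set n | B n `<=` S]) B n).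
  exact: bigcup_measurable.
apply/seteqP; split => [x [Dx gx]|x [n /= BS /BS//]].
have [n Bx BS] : exists2 n, B n x & B n `<=` S.
  apply: hB; apply: NI; first exact: ND.
  by apply: Ng => //; apply: open_nbhs_nbhs; split => //; exact: interval_open.
by exists n.
Qed.

Section space.
Context {d : measure_display} {R : realType} {X : metricMeasurableType d R}.
Hypothesis hborel : is_borel X.

Lemma borel_open (U : set X) : open U -> measurable U.
Proof. by move=> oU; rewrite hborel; exact: sub_sigma_algebra. Qed.

Lemma ball_openX (x : X) (r : R) : open (ball x r).
Proof.
rewrite openE => y; rewrite ballEmdist/= => xy; apply/nbhs_ballP.
exists (r - mdist x y) => /=; first by rewrite subr_gt0.
move=> z; rewrite !ballEmdist/= => yz.
by rewrite (le_lt_trans (metric_triangle _ y _))// -ltrBrDl.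
Qed.

Lemma measurable_ballX (x : X) (r : R) : measurable (ball x r).
Proof. exact/borel_open/ball_openX. Qed.

Hypothesis hA1 : proper_balls X.
Context (x0 : X).

Lemma ball_cover : [set: X] = \bigcup_n ball x0 n%:R.
Proof.
apply/seteqP; split => // x _.
exists (Num.bound (mdist x0 x)) => //.
by rewrite ballEmdist/= archi_boundP// mdist_ge0.
Qed.

(** A ball has compact closure, so finitely many balls of radius 1 / (k + 1)
    cover it, and countably many balls cover the space. *)
Lemma separableX : exists c : nat -> X,
  forall x (e : R), 0 < e -> exists n, mdist x (c n) < e.
Proof.
have fin n k : exists2 A : set X, finite_set A &
    ball x0 n%:R `<=` \bigcup_(c in A) ball c k.+1%:R^-1.
  have := hA1 x0 n%:R; rewrite compact_cover => /(_ X setT (fun c => ball c k.+1%:R^-1)).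
  case=> [c _||D' _ sub]; first exact: ball_openX.
    move=> x _; exists x => //.
    by apply: ballxx; rewrite invr_gt0.
  exists [set` D']; first exact: finite_fset.
  by apply: subset_trans sub; exact: subset_closure.
have /choice[A /all_and2[fA cA]] (q : nat * nat) : exists A : set X,
    finite_set A /\
    ball x0 q.1%:R `<=` \bigcup_(c in A) ball c q.2.+1%:R^-1.
  by have [A ? ?] := fin q.1 q.2; exists A.
pose C := \bigcup_q A q.
have /countable_injP[f finj] : countable C.
  by apply: bigcup_countable => // q _; exact: finite_set_countable.
exists (fun n => xget x0 [set x | C x /\ f x = n]) => x e e0.
have [n _ xn] : (\bigcup_n ball x0 n%:R) x by rewrite -ball_cover.
have [k ke] : exists k : nat, k.+1%:R^-1 < e.
  exists (Num.bound e^-1); rewrite invf_plt ?posrE//.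
  by rewrite (lt_trans (archi_boundP _)) ?invr_ge0 ?ltW// ltr_nat.
have [c Ac] := cA (n, k) x xn.
rewrite ballEmdist/= => cx.
have Cc : C c by exists (n, k).
exists (f c).
case: xgetP => [y -> [Cy fy]|/(_ c)/=]; last by move=> /not_andP[]//.
rewrite (finj _ _ _ _ fy) ?inE// metric_sym.
exact: lt_trans ke.
Qed.

Lemma measurable_baseX : measurable_base (fun x : X => nbhs x).
Proof.
have [c hc] := separableX.
exists (fun n => if @choice.unpickle (nat * nat)%type n is Some (i, k)
                 then ball (c i) k.+1%:R^-1 else set0).
  by move=> n; case: choice.unpickle => [[i k]|] //; exact: measurable_ballX.
move=> x U /nbhs_ballP[e /= e0 xU].
have [k ke] : exists k : nat, k.+1%:R^-1 < e / 2.
  exists (Num.bound (e / 2)^-1); rewrite invf_plt ?posrE ?divr_gt0//.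
  by rewrite (lt_trans (archi_boundP _)) ?invr_ge0 ?divr_ge0 ?(ltW e0)// ltr_nat.
have k0 : 0 < k.+1%:R^-1 :> R by rewrite invr_gt0.
have [i xi] := hc x _ k0.
exists (choice.pickle (i, k)); rewrite choice.pickleK; first by rewrite ballEmdist/= metric_sym.
move=> y; rewrite ballEmdist/= => iy; apply: xU; rewrite ballEmdist/=.
rewrite (le_lt_trans (metric_triangle _ (c i) _))// (splitr e) ltrD//; exact: lt_trans ke.
Qed.

Lemma continuous_measurableX (g : X -> R) : continuous g -> measurable_fun setT g.
Proof.
move=> cg; apply: (@measurable_fun_base _ _ _ (fun x : X => nbhs x)).
- exact: measurable_baseX.
- by move=> *; exact: filterI.
- by move=> *; exact: filterT.
- by move=> x U _ /cg.
Qed.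

Lemma continuous_measurableXX (g : X * X -> R) :
  continuous g -> measurable_fun setT g.
Proof.
move=> cg; apply: (@measurable_fun_base _ _ _ (fun z : X * X => nbhs z)).
- by apply: measurable_base_prod; exact: measurable_baseX.
- by move=> *; exact: filterI.
- by move=> *; exact: filterT.
- by move=> x U _ /cg.
Qed.

(** Restricted to an open set of times because a heat kernel is singular at
    time 0. *)
Lemma continuous_measurableRXX (D : set R) (g : R * X * X -> R) : open D ->
  (forall t x y, D t -> {for (t, x, y), continuous g}) ->
  measurable_fun [set z : R * X * X | D z.1.1] g.
Proof.
move=> oD cg; apply: (@measurable_fun_base _ _ _ (fun z : R * X * X => nbhs z)).
- apply: measurable_base_prod; last exact: measurable_baseX.
  by apply: measurable_base_prod; [exact: measurable_base_real|exact: measurable_baseX].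
- by move=> *; exact: filterI.
- move=> [[t x] y]/= Dt.
  exists ([set u : R * X | D u.1], setT) => /=; last by move=> [[? ?] ?] [].
  split; last exact: filterT.
  exists (D, setT) => /=; last by move=> [? ?] [].
  by split; [exact: open_nbhs_nbhs|exact: filterT].
- by move=> [[t x] y] U /= Dt gU; exact: (cg t x y Dt U gU).
Qed.

Lemma continuous_mdist : continuous (fun z : X * X => mdist z.1 z.2).
Proof.
move=> [x y] U /nbhs_ballP[e /= e0 xyU].
have e20 : 0 < e / 2 by rewrite divr_gt0.
exists (ball x (e / 2), ball y (e / 2)) => /=.
  by split; exact: nbhsx_ballx.
move=> [u v] []; rewrite !ballEmdist/= => xu yv; apply: xyU.
rewrite /ball/= ltr_norml.
have h1 := metric_triangle u x v; have h2 := metric_triangle x y v.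
have h3 := metric_triangle x u y; have h4 := metric_triangle u v y.
rewrite (metric_sym u x) in h1; rewrite (metric_sym v y) in h4.
by apply/andP; split; lra.
Qed.

Lemma measurable_mdist : measurable_fun setT (fun z : X * X => mdist z.1 z.2).
Proof. apply: continuous_measurableXX. exact: continuous_mdist. Qed.

End space.

(** * Real powers and geometric series *)

Section power_lemmas.
Context {R : realType}.
Implicit Types a b r s e : R.

Lemma powR_powRV a r : 0 <= r -> 0 < a -> (r `^ a) `^ a^-1 = r.
Proof. by move=> r0 a0; rewrite -powRrM divff ?gt_eqF// powRr1. Qed.

Lemma powRV_powR a r : 0 <= r -> 0 < a -> (r `^ a^-1) `^ a = r.
Proof. by move=> r0 a0; rewrite -powRrM mulVf ?gt_eqF// powRr1. Qed.

Lemma ltr_powR2 a r s : 0 < a -> 0 <= r -> r < s -> r `^ a < s `^ a.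
Proof.
by move=> a0 r0 rs; apply: gt0_ltr_powR; rewrite ?nnegrE// (le_trans r0)// ltW.
Qed.

Lemma ler_powR2 a r s : 0 <= a -> 0 <= r -> r <= s -> r `^ a <= s `^ a.
Proof.
by move=> a0 r0 rs; apply: ge0_ler_powR; rewrite ?nnegrE// (le_trans r0)// ltW.
Qed.

Lemma powR_near a r e : 0 < a -> 0 <= r -> 0 < e ->
  exists2 c, 0 < c &
    forall s, 0 <= s -> `|s - r| < c -> `|s `^ a - r `^ a| < e.
Proof.
move=> a0 r0 e0.
have ra0 : 0 <= r `^ a by exact: powR_ge0.
have ia0 : 0 < a^-1 by rewrite invr_gt0.
pose r1 := (r `^ a + e) `^ a^-1.
have rr1 : r < r1 by rewrite -{1}(powR_powRV a r r0 a0) ltr_powR2// ltrDl.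
have r1E : r1 `^ a = r `^ a + e by rewrite powRV_powR// addr_ge0// ltW.
have [r_eq0|rneq0] := eqVneq r 0.
  exists r1; first by rewrite (le_lt_trans r0).
  move=> s s0; rewrite r_eq0 powR0 ?gt_eqF// !subr0 !ger0_norm ?powR_ge0// => sr.
  have := ltr_powR2 _ _ _ a0 s0 sr; rewrite r1E.
  by rewrite r_eq0 powR0 ?gt_eqF// add0r.
have rgt0 : 0 < r by rewrite lt_neqAle eq_sym rneq0.
pose m := Num.max (r `^ a - e) 0.
have m0 : 0 <= m by rewrite le_max lexx orbT.
have mr : m < r `^ a by rewrite gt_max powR_gt0// gtrDl oppr_lt0 e0.
pose r2 := m `^ a^-1.
have r2r : r2 < r by rewrite -(powR_powRV a r r0 a0) ltr_powR2.
have r2E : r2 `^ a = m by rewrite powRV_powR.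
have r20 : 0 <= r2 by exact: powR_ge0.
exists (Num.min (r1 - r) (r - r2)).
  by rewrite lt_min !subr_gt0 rr1 r2r.
move=> s s0; rewrite lt_min !ltr_norml => /andP[/andP[_ sr1] /andP[sr2 _]].
have h1 : s `^ a < r `^ a + e by rewrite -r1E ltr_powR2//; rewrite ltrD2r in sr1.
have h2 : m < s `^ a by rewrite -r2E ltr_powR2//; rewrite opprB ltrD2r in sr2.
have h3 : r `^ a - e <= m by rewrite le_max lexx.
by rewrite ltrBlDl h1 andbT ltrBrDl (le_lt_trans h3 h2).
Qed.

(** This is u <= exp u at u = c r / a, raised to the power a. *)
Lemma powR_le_expR a c r : 0 < a -> 0 < c -> 0 <= r ->
  r `^ a <= (a / c) `^ a * expR (c * r).
Proof.
move=> a0 c0 r0.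
have ac0 : 0 < a / c by rewrite divr_gt0.
have -> : c * r = (c / a * r) * a by field; rewrite gt_eqF.
have {1}-> : r = (a / c) * (c / a * r) by field; rewrite !gt_eqF.
have car : 0 <= c / a * r by rewrite mulr_ge0// divr_ge0 ?ltW.
rewrite expRM powRM// ?(ltW ac0)// ler_wpM2l ?powR_ge0// ler_powR2 ?(ltW a0)//.
by rewrite (le_trans _ (expR_ge1Dx _))// lerDr.
Qed.

(** The tangent line at 1 of a concave power, as an instance of the Young
    inequality. *)
Lemma powR_le_tangent a r : 0 < a < 1 -> 0 <= r -> r `^ a <= a * r + (1 - a).
Proof.
move=> /andP[a0 a1] r0.
have ia0 : 0 < 1 - a by rewrite subr_gt0.
have := @conjugate_powR R (r `^ a) 1 a^-1 (1 - a)^-1 (powR_ge0 _ _) ler01.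
rewrite !invr_gt0 !invrK => /(_ a0 ia0) h.
by have := h ltac:(ring); rewrite mulr1 powR_powRV// powR1 mul1r mulrC.
Qed.

(** A discrete comparison with the integral of s^(-c): each increment of n^(1
    - c) / (1 - c) is at least the next term of the sum, by [powR_le_tangent]
    at n / (n + 1). *)
Lemma sum_powRN_le c (n : nat) : 0 < c < 1 ->
  \sum_(k < n) k.+1%:R `^ (- c) <= n%:R `^ (1 - c) / (1 - c) :> R.
Proof.
move=> /andP[c0 c1]; have t0 : 0 < 1 - c by rewrite subr_gt0.
elim: n => [|n ih]; first by rewrite big_ord0 divr_ge0 ?powR_ge0 ?ltW.
rewrite big_ord_recr/= (le_trans (lerD ih (lexx _)))//.
have n0 : 0 < n.+1%:R :> R by rewrite ltr0n.
have -> : n%:R = n.+1%:R * (n%:R / n.+1%:R) :> R by rewrite mulrC divfK// gt_eqF.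
rewrite powRM ?divr_ge0 ?ler0n//.
have := @powR_le_tangent (1 - c) (n%:R / n.+1%:R) ltac:(by apply/andP; split; lra)
  ltac:(by rewrite divr_ge0 ?ler0n).
set y := (_ / _) `^ _ => hy.
have -> : n.+1%:R `^ (- c) = n.+1%:R `^ (1 - c) / n.+1%:R :> R.
  rewrite [in LHS](_ : - c = (1 - c) - 1); last by ring.
  by rewrite powRB ?(gt_eqF n0) ?implybT ?powRr1.
set z := n.+1%:R `^ (1 - c).
have z0 : 0 <= z by exact: powR_ge0.
have -> : z * y / (1 - c) + z / n.+1%:R = z * (y / (1 - c) + n.+1%:R^-1) by ring.
rewrite ler_wpM2l// -lerBrDr ler_pdivrMr// (le_trans hy)//.
rewrite le_eqVlt; apply/orP; left; apply/eqP.
by rewrite -natr1 in n0 *; field; rewrite !gt_eqF.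
Qed.

Lemma harmonic_powR_cvg0 a : 0 < a -> n.+1%:R^-1 `^ a @[n --> \oo] --> (0 : R).
Proof.
move=> a0; apply/cvgrPdist_lt => e e0.
have [b b0 hb] := powR_near a 0 e a0 (lexx 0) e0.
have /cvgrPdist_lt/(_ b b0) := @cvg_harmonic R.
apply: filterS => n; rewrite /harmonic distrC => /hb -/(_ ltac:(by rewrite invr_ge0)).
by rewrite powR0 ?gt_eqF// distrC.
Qed.

Lemma dyadic_bracket r : 1 <= r ->
  exists k : nat, 2 ^+ k <= r < 2 ^+ k.+1.
Proof.
move=> r1.
have ex : exists k : nat, r < 2 ^+ k.
  exists (Num.bound r); rewrite (lt_le_trans (archi_boundP _))// ?(le_trans _ r1)//.
  by rewrite -natrX ler_nat ltnW// ltn_expl.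
case: (ex_minnP ex) => -[|k]; first by rewrite expr0 ltNge r1.
move=> rk min; exists k; rewrite rk andbT leNgt; apply/negP => /min.
by rewrite ltnn.
Qed.

Lemma nneseries_ge_term (u : nat -> \bar R) k : (forall n, 0 <= u n)%E ->
  (u k <= \sum_(n <oo) u n)%E.
Proof.
move=> u0; apply: (@le_trans _ _ (\sum_(0 <= i < k.+1) u i)%E).
  by rewrite big_nat_recr//= leeDr// sume_ge0.
exact: nneseries_lim_ge.
Qed.

Lemma geometric_nneseries_le (c q : R) : 0 <= c -> 0 <= q -> q < 1 ->
  (\sum_(n <oo) (c * q ^+ n)%:E <= (c / (1 - q))%:E)%E.
Proof.
move=> c0 q0 q1; have q10 : 0 < 1 - q by rewrite subr_gt0.
apply: lime_le.
  by apply: is_cvg_nneseries => n _ _; rewrite lee_fin mulr_ge0// exprn_ge0.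
apply: nearW => n; rewrite sumEFin lee_fin -mulr_sumr ler_wpM2l//.
rewrite -[leRHS]mul1r ler_pdivlMr// big_mkord mulrC -opprB mulNr -subrX1 opprB.
by rewrite gerBl exprn_ge0.
Qed.

Lemma ereal_ge_of_lt (x : R) (A : \bar R) : 0 < x ->
  (forall c, 0 < c < x -> (c%:E <= A)%E) -> (x%:E <= A)%E.
Proof.
move=> x00 hA; have hx : ((x / 2)%:E <= A)%E by apply: hA; apply/andP; split; lra.
rewrite leNgt; apply/negP; case: A hA hx => [a||] hA //; rewrite lee_fin lte_fin => hx ax.
by have := hA ((a + x) / 2) ltac:(apply/andP; split; lra); rewrite lee_fin => ?; lra.
Qed.

End power_lemmas.

(** * Sets of full measure *)

Lemma ae_meets {d} {T : measurableType d} {R : realType}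
  (m : {measure set T -> \bar R}) (A : set T) (Q : T -> Prop) :
  measurable A -> (0 < m A)%E -> (\forall z \ae m, Q z) ->
  exists2 z, A z & Q z.
Proof.
move=> mA mA0 [N [mN N0 QN]]; apply: contrapT => noz.
have AN : A `<=` N by move=> z Az; apply: QN => /= Qz; apply: noz; exists z.
have : (m A <= m N)%E by rewrite le_measure// inE.
by rewrite N0 leNgt mA0.
Qed.

Section space_measure.
Context {d : measure_display} {R : realType} {X : metricMeasurableType d R}.
Context (mu : {sigma_finite_measure set X -> \bar R}) (dH : R).
Hypotheses (hborel : is_borel X) (hA2 : ahlfors_regular mu dH).

Lemma ball_measure_gt0 (x : X) (r : R) : 0 < r -> (0 < mu (ball x r))%E.
Proof.
move=> r0; have [dH0 [c1 [c2 [c10 c20 /(_ x r (ltW r0))[h _]]]]] := hA2.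
by rewrite (lt_le_trans _ h)// lte_fin mulr_gt0// powR_gt0.
Qed.

Lemma ball_measure_lty (x : X) (r : R) : 0 <= r -> (mu (ball x r) < +oo)%E.
Proof.
move=> r0; have [dH0 [c1 [c2 [c10 c20 /(_ x r r0)[_ h]]]]] := hA2.
by rewrite (le_lt_trans h)// ltry.
Qed.

(** Balls have positive measure, so a set of full measure is dense. *)
Lemma ae_meets_near (x : X) (Q P : X -> Prop) : nbhs x Q ->
  (\forall y \ae mu, P y) -> exists2 y, Q y & P y.
Proof.
move=> /nbhs_ballP[e /= e0 eQ] aeP.
have [y xy Py] := ae_meets _ _ _ (measurable_ballX hborel x e)
  (ball_measure_gt0 x e e0) aeP.
by exists y => //; exact: eQ.
Qed.

Lemma ae_meets_near2 (x y : X) (Q P : X * X -> Prop) : nbhs (x, y) Q ->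
  (\forall z \ae (mu \x mu)%E, P z) -> exists2 z, Q z & P z.
Proof.
move=> [[U V] /= [/nbhs_ballP[e /= e0 eU] /nbhs_ballP[e' /= e'0 eV]] UVQ] aeP.
have [|| z [zx zy] Pz] := ae_meets _ (ball x e `*` ball y e')%classic _ _ _ aeP.
- by apply: measurableX; exact: measurable_ballX.
- apply: (@lt_le_trans _ _ (mu (ball x e) * mu (ball y e'))%E).
    by rewrite mule_gt0// ball_measure_gt0.
  have mB z r := measurable_ballX hborel z r.
  by have /esym := product_measure1E mu mu (mB x e) (mB y e') => ->.
by exists z => //; apply: UVQ; split; [exact: eU|exact: eV].
Qed.

Lemma holder_near (g : X -> R) (M k e : R) (x : X) : 0 < k -> 0 < e ->
  (forall x y, `|g x - g y| <= M * mdist x y `^ k) ->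
  nbhs x (fun y => `|g x - g y| < e).
Proof.
move=> k0 e0 gH.
have [c c0 hc] := powR_near k 0 (e / (`|M| + 1)) k0 (lexx _)
  ltac:(by rewrite divr_gt0// ltr_wpDl).
apply/nbhs_ballP; exists c => // y; rewrite ballEmdist/= => xy.
rewrite (le_lt_trans (gH _ _))//.
have := hc _ (mdist_ge0 x y); rewrite subr0 ger0_norm ?mdist_ge0// => /(_ xy).
rewrite powR0 ?gt_eqF// subr0 ger0_norm ?powR_ge0// ltr_pdivlMr ?ltr_wpDl// => h.
have M1 := ler_norm M.
have d0 := powR_ge0 (mdist x y) k.
nra.
Qed.

Lemma holder_continuous (g : X -> R) (M k : R) : 0 < k ->
  (forall x y, `|g x - g y| <= M * mdist x y `^ k) -> continuous g.
Proof.
move=> k0 gH x; apply/cvgrPdist_lt => e e0; exact: holder_near gH.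
Qed.

Lemma continuous_ae_le (g : X -> R) (c : R) : continuous g ->
  (\forall y \ae mu, g y <= c) -> forall x, g x <= c.
Proof.
move=> cg ae x; rewrite leNgt; apply/negP => gx.
have [y] := ae_meets_near x _ _ (cvgr_gt _ (cg x) c gx) ae.
by rewrite leNgt => /= ->.
Qed.

Lemma integral_balls_cvg (x0 : X) (f : X -> R) : measurable_fun setT f ->
  (forall x, 0 <= f x) ->
  (\int[mu]_y (f y * \1_(ball x0 n%:R) y)%:E @[n --> \oo] -->
   \int[mu]_y (f y)%:E)%E.
Proof.
move=> mf f0.
have -> : (\int[mu]_y (f y)%:E = \int[mu]_(y in \bigcup_n ball x0 n%:R) (f y)%:E)%E.
  by rewrite -ball_cover.
under eq_fun => n.
  rewrite (_ : (\int[mu]_y _ = \int[mu]_(y in ball x0 n%:R) (f y)%:E)%E); last first.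
    rewrite [RHS]integral_mkcond; apply: eq_integral => y _.
    by rewrite patchE indicE; case: ifPn => _; rewrite ?mulr1 ?mulr0.
  over.
apply: ge0_nondecreasing_set_cvg_integral.
- move=> m n mn; apply/subsetPset; apply: le_ball; by rewrite ler_nat.
- by move=> n; exact: measurable_ballX.
- by move=> n; apply: measurable_funTS; exact/measurable_EFinP.
- by move=> n y _; rewrite lee_fin.
Qed.

End space_measure.

(** At distances of order t^(1 / dW) the exponential factor is bounded
    below. *)
Lemma sub_gaussian_near_diagonal {R : realType} (dH dW c c' t r a : R) :
  1 < dW -> 0 <= c -> 0 <= c' -> 0 < t -> 0 <= r -> 0 <= a -> r <= a * t `^ dW^-1 ->
  c * t `^ (- (dH / dW)) * expR (- (c' * (a `^ dW) `^ (dW - 1)^-1)) <=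
    sub_gaussian dH dW c c' t r.
Proof.
move=> dW1 c0 c'0 t0 r0 a0 ra; have dW0 : 0 < dW by rewrite (lt_trans ltr01).
rewrite /sub_gaussian ler_wpM2l ?mulr_ge0 ?powR_ge0// ler_expR lerN2.
rewrite ler_wpM2l// ler_powR2 ?divr_ge0 ?powR_ge0 ?invr_ge0 ?(ltW t0)//.
  by rewrite subr_ge0 ltW.
rewrite ler_pdivrMr// (le_trans (ler_powR2 _ _ _ (ltW dW0) r0 ra))//.
by rewrite powRM ?powR_ge0// powRV_powR ?(ltW t0).
Qed.

(** * Symmetry and unit mass of the heat kernel *)

Section heat_kernel.
Context {d : measure_display} {R : realType} {X : metricMeasurableType d R}.
Context (mu : {sigma_finite_measure set X -> \bar R}) (x0 : X).
Context (P : R -> (X -> R) -> (X -> R)) (p : R -> X -> X -> R).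
Context (dH dW kappa : R).
Hypotheses (hborel : is_borel X) (hA1 : proper_balls X).
Hypotheses (hA2 : ahlfors_regular mu dH).
Hypotheses (hP : symmetric_markov_semigroup mu P).
Hypotheses (hp : continuous_heat_kernel mu p P).

Implicit Types (t r : R) (x y : X) (A B : set X).

Lemma kernel_continuous2 t : 0 < t -> continuous (fun z : X * X => p t z.1 z.2).
Proof.
move=> t0 [x y]; have h := hp.1 t x y t0.
have hc : (fun z : X * X => (t, z.1, z.2)) z @[z --> (x, y)] --> (t, x, y).
  move=> U [[A B] /= [[[A1 A2] /= [A1t A2x] AA] By] ABU].
  exists (A2, B) => // -[u v] [/= A2u Bv]; apply: ABU; split => //.
  by apply: AA; split => //; exact: nbhs_singleton.
exact: (cvg_comp _ _ hc h).
Qed.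

Lemma measurable_kernel t : 0 < t ->
  measurable_fun setT (fun z : X * X => p t z.1 z.2).
Proof.
by move=> t0; apply: (continuous_measurableXX hborel hA1 x0); exact: kernel_continuous2.
Qed.

Lemma measurable_kernelr t x : 0 < t -> measurable_fun setT (p t x).
Proof.
by move=> t0; exact: (measurableT_comp (measurable_kernel t t0) (measurable_pair1 x)).
Qed.

Lemma continuous_mdist_powR (a : R) : 0 < a ->
  continuous (fun z : X * X => mdist z.1 z.2 `^ a).
Proof.
move=> a0 z; apply/cvgrPdist_lt => e e0.
have [c c0 hc] := powR_near a _ e a0 (mdist_ge0 z.1 z.2) e0.
have := continuous_mdist z; move/cvgrPdist_lt => /(_ c c0).
apply: filterS => u; rewrite distrC => /hc -/(_ (mdist_ge0 _ _)).
by rewrite distrC.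
Qed.

Hypothesis dW2 : 2 <= dW.

(** Time and distance are separated to make the continuity in the distance
    visible. *)
Lemma sub_gaussianE (c c' t r : R) : 0 < t -> 0 <= r ->
  sub_gaussian dH dW c c' t r = c * t `^ (- (dH / dW)) *
    expR (- (c' * t `^ (- (dW - 1)^-1) * r `^ (dW / (dW - 1)))).
Proof.
move=> t0 r0; rewrite /sub_gaussian; congr (_ * expR (- _)).
rewrite powRM ?powR_ge0 ?invr_ge0 ?(ltW t0)// -powRrM -mulrA; congr (_ * _).
rewrite mulrC; congr (_ * _).
by rewrite -powR_inv1 ?(ltW t0)// -powRrM mulN1r.
Qed.

Lemma sub_gaussian_continuous (c c' t : R) : 0 < t ->
  continuous (fun z : X * X => sub_gaussian dH dW c c' t (mdist z.1 z.2)).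
Proof.
move=> t0.
have -> : (fun z : X * X => sub_gaussian dH dW c c' t (mdist z.1 z.2)) =
  fun z => c * t `^ (- (dH / dW)) *
    expR (- (c' * t `^ (- (dW - 1)^-1) * mdist z.1 z.2 `^ (dW / (dW - 1)))).
  by apply/funext => z; rewrite sub_gaussianE// mdist_ge0.
move=> z.
have b0 : 0 < dW / (dW - 1) by have := dW2; move=> ?; rewrite divr_gt0//; lra.
set k := c' * _.
have FF : Filter (nbhs z) by exact: (@nbhs_filter (X * X)%type).
have h1 := cvgN (cvgM (cvg_cst k) (continuous_mdist_powR _ b0 z)).
have h2 := cvg_comp _ _ (h1 FF FF FF) (@continuous_expR R _).
exact: (cvgM (cvg_cst (c * t `^ (- (dH / dW)))) h2).
Qed.

Context (c3 c4 c5 c6 : R).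
Hypotheses (c30 : 0 < c3) (c40 : 0 < c4) (c50 : 0 < c5) (c60 : 0 < c6).
Hypothesis hHK : forall t : R, 0 < t -> \forall z \ae (mu \x mu)%E,
      sub_gaussian dH dW c5 c6 t (mdist z.1 z.2) <= p t z.1 z.2
        <= sub_gaussian dH dW c3 c4 t (mdist z.1 z.2).

(** The almost everywhere estimates hold at every point, because both sides
    are continuous and sets of full measure are dense. *)
Lemma kernel_bounds t x y : 0 < t ->
  sub_gaussian dH dW c5 c6 t (mdist x y) <= p t x y
    <= sub_gaussian dH dW c3 c4 t (mdist x y).
Proof.
move=> t0; have cp := kernel_continuous2 t t0 (x, y).
have key (f : X * X -> R) : continuous f ->
    (\forall z \ae (mu \x mu)%E, 0 <= f z) -> 0 <= f (x, y).
  move=> cf ae; rewrite leNgt; apply/negP => f0.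
  have [z] := ae_meets_near2 mu dH hborel hA2 x y _ _ (cvgr_lt _ (cf (x, y)) 0 f0) ae.
  by rewrite leNgt => /= ->.
apply/andP; split; rewrite -subr_ge0.
- apply: (key (fun z => p t z.1 z.2 - sub_gaussian dH dW c5 c6 t (mdist z.1 z.2))).
    move=> z; have FF : Filter (nbhs z) by exact: (@nbhs_filter (X * X)%type).
    by apply: cvgB; [exact: kernel_continuous2|exact: sub_gaussian_continuous].
  by apply: filterS (hHK t t0) => z /andP[? _]; rewrite subr_ge0.
- apply: (key (fun z => sub_gaussian dH dW c3 c4 t (mdist z.1 z.2) - p t z.1 z.2)).
    move=> z; have FF : Filter (nbhs z) by exact: (@nbhs_filter (X * X)%type).
    by apply: cvgB; [exact: sub_gaussian_continuous|exact: kernel_continuous2].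
  by apply: filterS (hHK t t0) => z /andP[_ ?]; rewrite subr_ge0.
Qed.

Lemma sub_gaussian_ge0 c c' t r : 0 <= c -> 0 <= sub_gaussian dH dW c c' t r.
Proof. by move=> c0; rewrite !mulr_ge0// ?powR_ge0// expR_ge0. Qed.

Lemma kernel_ge0 t x y : 0 < t -> 0 <= p t x y.
Proof.
move=> t0; have /andP[h _] := kernel_bounds t x y t0.
by apply: le_trans h; rewrite sub_gaussian_ge0// ltW.
Qed.

Lemma kernel_bounded t x y : 0 < t -> p t x y <= c3 * t `^ (- (dH / dW)).
Proof.
move=> t0; have /andP[_ h] := kernel_bounds t x y t0.
apply: (le_trans h); rewrite -[leRHS]mulr1 ler_wpM2l//.
  by rewrite mulr_ge0 ?powR_ge0// ltW.
by rewrite -expR0 ler_expR oppr_le0 mulr_ge0 ?powR_ge0// ltW.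
Qed.

Lemma heat_integrable t x (f : X -> R) : 0 < t ->
  mu.-integrable setT (EFin \o f) ->
  mu.-integrable setT (fun y => (p t x y * f y)%:E).
Proof.
move=> t0 fi; have Z := integrableZl measurableT (c3 * t `^ (- (dH / dW))) fi.
apply: le_integrable Z => //.
  apply/measurable_EFinP; apply: measurable_funM; first exact: measurable_kernelr.
  exact/measurable_EFinP/(measurable_int _ fi).
move=> y _ /=; rewrite lee_fin !normrM ler_wpM2r//.
rewrite (ger0_norm (kernel_ge0 t x y t0)) -normrM.
exact: le_trans (kernel_bounded t x y t0) (ler_norm _).
Qed.

Lemma heatE t x (f : X -> R) : 0 < t -> mu.-integrable setT (EFin \o f) ->
  (heat mu p t f x)%:E = (\int[mu]_y (p t x y * f y)%:E)%E.
Proof.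
move=> t0 fi; rewrite /heat /Rintegral fineK//.
by apply: integrable_fin_num => //; exact: heat_integrable.
Qed.

Lemma indic_integrable (A : set X) : measurable A -> (mu A < +oo)%E ->
  mu.-integrable setT (EFin \o (\1_A : X -> R)).
Proof.
move=> mA A_oo; apply/integrableP; split; first exact/measurable_EFinP/measurable_indic.
under eq_integral do rewrite gee0_abs ?lee_fin//.
by rewrite integral_indic// setIT.
Qed.

Lemma indic_Lfun2 (A : set X) : measurable A -> (mu A < +oo)%E ->
  (\1_A : X -> R) \in Lfun mu 2%:E.
Proof.
move=> mA A_oo; rewrite inE; apply/andP; split; rewrite inE/=.
  exact: measurable_indic.
rewrite /finite_norm unlock; apply: poweR_lty.
rewrite (_ : (\int[mu]_x _ = \int[mu]_x (\1_A x)%:E)%E).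
  by rewrite integral_indic// setIT.
apply: eq_integral => x _ /=; rewrite indicE; case: (x \in A).
  by rewrite normr1 powR1.
by rewrite normr0 powR0// pnatr_eq0.
Qed.

Lemma indic_Lfunoo (A : set X) : measurable A -> (\1_A : X -> R) \in Lfun mu +oo%E.
Proof.
move=> mA; rewrite inE; apply/andP; split; rewrite inE/=.
  exact: measurable_indic.
rewrite /finite_norm unlock; case: ifP => // _.
apply: (@le_lt_trans _ _ 1%E); last by rewrite ltry.
by apply/ess_supP; apply: nearW => x /=; rewrite lee_fin indicE; case: (x \in A);
  rewrite ?normr1 ?normr0.
Qed.

Lemma indic_Loo_le1 (A : set X) : ('N[mu]_+oo[EFin \o (\1_A : X -> R)] <= 1)%E.
Proof.
rewrite unlock; case: ifP => // _.
by apply/ess_supP; apply: nearW => x /=; rewrite lee_fin indicE; case: (x \in A);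
  rewrite ?normr1 ?normr0.
Qed.

(** An extended real, so that it makes sense for sets of infinite measure
    before finiteness is known. *)
Definition mass t (A : set X) (x : X) : \bar R :=
  (\int[mu]_y (p t x y * \1_A y)%:E)%E.

Lemma mass_ge0 t A x : 0 < t -> (0 <= mass t A x)%E.
Proof.
move=> t0; apply: integral_ge0 => y _.
by rewrite lee_fin mulr_ge0// kernel_ge0.
Qed.

Let indicE_ge0 (A : set X) x : (0 <= (\1_A x : R)%:E)%E.
Proof. by rewrite lee_fin. Qed.

Let mass_indic_ge0 t A B x : 0 < t -> (0 <= mass t A x * (\1_B x)%:E)%E.
Proof. by move=> t0; apply: mule_ge0 => //; exact: mass_ge0. Qed.

Lemma heat_indicE t A x : 0 < t -> measurable A -> (mu A < +oo)%E ->
  (heat mu p t \1_A x)%:E = mass t A x.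
Proof. by move=> t0 mA A_oo; rewrite heatE//; exact: indic_integrable. Qed.

Lemma integral_cst_indic (c : R) A : 0 <= c -> measurable A ->
  (\int[mu]_y (c * \1_A y)%:E = c%:E * mu A)%E.
Proof.
move=> c0 mA; under eq_integral do rewrite EFinM.
rewrite ge0_integralZl_EFin//.
  by rewrite integral_indic// setIT.
exact/measurable_EFinP/measurable_indic.
Qed.

Lemma measurable_kernel_indic t A : 0 < t -> measurable A ->
  measurable_fun setT (fun z : X * X => (p t z.1 z.2 * \1_A z.2)%:E).
Proof.
move=> t0 mA; apply/measurable_EFinP; apply: measurable_funM.
  exact: measurable_kernel.
exact: (measurableT_comp (@measurable_indic _ X R setT A mA) (@measurable_snd _ _ X X)).
Qed.

Lemma measurable_mass t A : 0 < t -> measurable A -> measurable_fun setT (mass t A).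
Proof.
move=> t0 mA.
apply: (measurable_fun_fubini_tonelli_F (fun z => (p t z.1 z.2 * \1_A z.2)%:E)).
  exact: measurable_kernel_indic.
by move=> z; rewrite lee_fin mulr_ge0// kernel_ge0.
Qed.

(** The symmetry of P_t tested on two indicators. *)
Lemma kernel_symmetric_sets t A B : 0 < t -> measurable A -> measurable B ->
  (mu A < +oo)%E -> (mu B < +oo)%E ->
  (\int[mu]_x (mass t A x * (\1_B x)%:E) = \int[mu]_x (mass t B x * (\1_A x)%:E))%E.
Proof.
move=> t0 mA mB A_oo B_oo.
have inner_mass (C D : set X) : measurable C -> measurable D ->
    (mu C < +oo)%E -> (mu D < +oo)%E ->
    (inner mu (P t \1_C) \1_D)%:E = (\int[mu]_x (mass t C x * (\1_D x)%:E))%E.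
  move=> mC mD C_oo D_oo.
  have aeE : (\int[mu]_x (P t \1_C x * \1_D x)%:E =
      \int[mu]_x (mass t C x * (\1_D x)%:E))%E.
    apply: ae_eq_integral => //.
    - apply/measurable_EFinP; apply: measurable_funM; last exact: measurable_indic.
      have := sgr_L2 hP t0 (indic_Lfun2 C mC C_oo).
      by rewrite inE => /andP[+ _]; rewrite inE.
    - apply: emeasurable_funM; first exact: measurable_mass.
      exact/measurable_EFinP/measurable_indic.
    - have := hp.2 t _ t0 (indic_Lfun2 C mC C_oo).
      apply: filterS => x /= -> _.
      by rewrite EFinM heat_indicE.
  rewrite -aeE /inner /Rintegral fineK// ge0_fin_numE aeE; last first.
    by apply: integral_ge0 => x _; rewrite mule_ge0 ?mass_ge0// lee_fin.
  pose k := (c3 * t `^ (- (dH / dW)))%:E.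
  apply: (@le_lt_trans _ _ (\int[mu]_x ((k * mu C) * (\1_D x)%:E))%E).
    apply: ge0_le_integralW => x _.
      exact: mass_indic_ge0.
    apply: lee_wpmul2r => //.
    have -> : mu C = (\int[mu]_y (\1_C y)%:E)%E by rewrite integral_indic// setIT.
    rewrite -ge0_integralZl_EFin//.
    - apply: ge0_le_integralW => y _; first by rewrite lee_fin mulr_ge0 ?kernel_ge0.
      by rewrite -EFinM lee_fin ler_wpM2r ?kernel_bounded.
    - exact/measurable_EFinP/measurable_indic.
    - by rewrite mulr_ge0 ?powR_ge0// ltW.
  have k0 : (0 <= k * mu C)%E by apply: mule_ge0 => //;
    rewrite lee_fin mulr_ge0 ?powR_ge0 ?(ltW c30).
  have kC : (k * mu C)%E \is a fin_num.
    by rewrite fin_numM// ge0_fin_numE.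
  rewrite -(fineK kC) ge0_integralZl_EFin//.
  - by rewrite integral_indic// setIT -ge0_fin_numE ?fin_numM// ?mule_ge0// ?fineK// ge0_fin_numE.
  - exact/measurable_EFinP/measurable_indic.
  - by rewrite fine_ge0.
rewrite -!inner_mass// (sgr_sym hP)//; try exact: indic_Lfun2.
by rewrite /inner; congr (_%:E); apply: eq_Rintegral => x _; rewrite mulrC.
Qed.

(** If p t y x < p t x y, continuity separates the two values uniformly on
    small balls around x and y; this contradicts the symmetry of P_t tested on
    the indicators of these balls. *)
Lemma kernel_sym t x y : 0 < t -> p t x y = p t y x.
Proof.
move=> t0; wlog : x y / p t y x < p t x y.
  move=> h; have [xy|xy|//] := ltgtP (p t x y) (p t y x); last exact: h.
  by rewrite (h y x).
move=> yx; exfalso.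
(* Two thresholds with p t y x < v < u < p t x y. *)
pose u := (2 * p t x y + p t y x) / 3; pose v := (p t x y + 2 * p t y x) / 3.
have p0 := kernel_ge0 t y x t0.
have vu : v < u by rewrite /u /v; lra.
have v0 : 0 <= v by rewrite /v; lra.
have c1 := cvgr_gt _ (kernel_continuous2 t t0 (x, y)) u
  ltac:(by rewrite /u /=; lra).
have c2 := cvgr_lt _ (kernel_continuous2 t t0 (y, x)) v
  ltac:(by rewrite /v /=; lra).
have [e e0 [h1 h2]] : exists2 e, 0 < e &
    (forall a b, ball x e a -> ball y e b -> u < p t a b) /\
    (forall a b, ball x e a -> ball y e b -> p t b a < v).
  move: c1 => [[U V] /= [/nbhs_ballP[e1 /= e10 U1] /nbhs_ballP[e2 /= e20 V2]] UV].
  move: c2 => [[U' V'] /= [/nbhs_ballP[e3 /= e30 U3] /nbhs_ballP[e4 /= e40 V4]] UV'].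
  exists (Num.min (Num.min e1 e2) (Num.min e3 e4)).
    by rewrite !lt_min e10 e20 e30.
  split=> a b; rewrite !ballEmdist/= !lt_min => /andP[/andP[a1 a2] /andP[a3 a4]]
    /andP[/andP[b1 b2] /andP[b3 b4]].
    by apply: (UV (a, b)); split => /=; [apply: U1|apply: V2]; rewrite ballEmdist.
  by apply: (UV' (b, a)); split => /=; [apply: U3|apply: V4]; rewrite ballEmdist.
have mB z := measurable_ballX hborel z e.
have B_oo z : (mu (ball z e) < +oo)%E by apply: (ball_measure_lty mu dH hA2); exact: ltW.
have B_gt0 z : (0 < mu (ball z e))%E by exact: (ball_measure_gt0 mu dH hA2).
have B_fin z : mu (ball z e) \is a fin_num by rewrite ge0_fin_numE.
have := kernel_symmetric_sets t (ball y e) (ball x e) t0 (mB _) (mB _) (B_oo _) (B_oo _).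
have u0 : 0 <= u by apply: le_trans v0 (ltW vu).
apply/eqP; rewrite gt_eqF//.
apply: (@le_lt_trans _ _ (v%:E * mu (ball x e) * mu (ball y e))%E).
  rewrite -{1}(fineK (B_fin x)) -EFinM -integral_cst_indic//; last first.
    by rewrite mulr_ge0// fine_ge0.
  apply: ge0_le_integralW => b _; first exact: mass_indic_ge0.
  rewrite indicE; case: (boolP (_ \in _)) => [/set_mem|_]; last by rewrite mule0 mulr0.
  rewrite mule1 mulr1 => yb.
  rewrite EFinM fineK// -integral_cst_indic//.
  apply: ge0_le_integralW => a _; first by rewrite lee_fin mulr_ge0 ?kernel_ge0.
  rewrite lee_fin indicE; case: (boolP (_ \in _)) => [/set_mem|_]; last by rewrite !mulr0.
  by rewrite !mulr1 => xa; rewrite ltW// h2.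
apply: (@lt_le_trans _ _ (u%:E * mu (ball y e) * mu (ball x e))%E).
  rewrite -!muleA [X in (_ * X < _)%E]muleC lte_pmul2r ?lte_fin// ?mule_gt0//.
  by rewrite fin_numM.
rewrite -{1}(fineK (B_fin y)) -EFinM -integral_cst_indic//; last first.
  by rewrite mulr_ge0// fine_ge0.
apply: ge0_le_integralW => a _; first by rewrite lee_fin mulr_ge0// mulr_ge0// fine_ge0.
rewrite indicE; case: (boolP (_ \in _)) => [/set_mem|_]; last by rewrite mule0 mulr0.
rewrite mule1 mulr1 => xa.
rewrite EFinM fineK// -integral_cst_indic//.
apply: ge0_le_integralW => b _; first by rewrite lee_fin mulr_ge0.
rewrite lee_fin indicE; case: (boolP (_ \in _)) => [/set_mem|_]; last by rewrite !mulr0.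
by rewrite !mulr1 => yb; rewrite ltW// h1.
Qed.

Lemma mass_le_setT t A x : 0 < t -> (mass t A x <= mass t setT x)%E.
Proof.
move=> t0; apply: ge0_le_integralW => y _.
  by rewrite lee_fin mulr_ge0 ?kernel_ge0.
by rewrite lee_fin ler_wpM2l ?kernel_ge0// indicT /cst indicE; case: (_ \in _).
Qed.

Lemma mass_setTE t x : mass t setT x = (\int[mu]_y (p t x y)%:E)%E.
Proof. by apply: eq_integral => y _; rewrite indicT mulr1. Qed.

Lemma mass_ball_cvg t x : 0 < t ->
  (mass t (ball x0 n%:R) x @[n --> \oo] --> mass t setT x)%E.
Proof.
move=> t0; rewrite mass_setTE; apply: (integral_balls_cvg mu hborel x0 (p t x)).
  exact: measurable_kernelr.
by move=> y; exact: kernel_ge0.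
Qed.

Let mBall r x : measurable (ball x r : set X) := measurable_ballX hborel x r.
Let ball_nat_lty n : (mu (ball x0 n%:R : set X) < +oo)%E.
Proof. exact: (ball_measure_lty mu dH hA2 x0 _ (ler0n _ n)). Qed.

Context (C : R).
Hypotheses (kappa0 : 0 < kappa) (kappa_dW : kappa < dW) (C0 : 0 < C).
Hypothesis hBE : forall (t : R) (g : X -> R), 0 < t -> g \in Lfun mu +oo%E ->
    forall x y : X,
      (`|heat mu p t g x - heat mu p t g y|%:E <=
       (C * (mdist x y `^ kappa / t `^ (kappa / dW)))%:E *
         'N[mu]_+oo[EFin \o g])%E.

Lemma heat_indic_holder t A x y : 0 < t -> measurable A ->
  `|heat mu p t \1_A x - heat mu p t \1_A y| <=
    C * t `^ (- (kappa / dW)) * mdist x y `^ kappa.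
Proof.
move=> t0 mA; rewrite -lee_fin.
apply: (le_trans (hBE t _ t0 (indic_Lfunoo A mA) x y)).
have -> : C * t `^ (- (kappa / dW)) * mdist x y `^ kappa =
    C * (mdist x y `^ kappa / t `^ (kappa / dW)) by rewrite powRN; ring.
rewrite -[leRHS]mule1; apply: lee_wpmul2l; last exact: indic_Loo_le1.
by rewrite lee_fin mulr_ge0 ?(ltW C0)// divr_ge0 ?powR_ge0.
Qed.

Lemma heat_indic_continuous t A : 0 < t -> measurable A ->
  continuous (heat mu p t \1_A).
Proof.
move=> t0 mA.
apply: (holder_continuous _ (C * t `^ (- (kappa / dW))) kappa kappa0).
by move=> x y; exact: heat_indic_holder.
Qed.

(** The Markov property applies to the indicators of balls, which are square
    integrable, and gives an almost everywhere bound. It extends to every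
    point since P_t 1_A is Hoelder continuous by the Bakry-Emery estimate, and
    to all sets by exhausting the space with balls. *)
Lemma mass_le1 t A x : 0 < t -> (mass t A x <= 1)%E.
Proof.
move=> t0; apply: (le_trans (mass_le_setT t A x t0)).
have cv := mass_ball_cvg t x t0; rewrite -(cvg_lim _ cv)//.
apply: lime_le; first by apply/cvg_ex; exists (mass t setT x).
apply: nearW => n; rewrite -heat_indicE// lee_fin.
apply: (continuous_ae_le mu dH hborel hA2 _ _ (heat_indic_continuous t _ t0 (mBall _ _))).
have fL := indic_Lfun2 _ (mBall n%:R x0) (ball_nat_lty n).
have h1 := hp.2 t _ t0 fL.
have h2 : \forall y \ae mu, 0 <= P t \1_(ball x0 n%:R) y <= 1.
  apply: (sgr_markov hP t0 fL); apply: nearW => y.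
  by rewrite indicE; case: (_ \in _); rewrite ?lexx ler01.
by apply: filterS2 h1 h2 => y -> /andP[].
Qed.

Lemma mass_fin_num t A x : 0 < t -> mass t A x \is a fin_num.
Proof.
move=> t0; rewrite ge0_fin_numE ?mass_ge0//.
by rewrite (le_lt_trans (mass_le1 _ _ _ t0))// ltry.
Qed.

Lemma measurable_heat_indic t A : 0 < t -> measurable A ->
  measurable_fun setT (heat mu p t \1_A).
Proof.
move=> t0 mA; apply: (continuous_measurableX hborel hA1 x0).
exact: heat_indic_continuous.
Qed.

Lemma mass_semigroup_fin s t A : 0 < s -> 0 < t -> measurable A -> (mu A < +oo)%E ->
  \forall x \ae mu,
    mass (s + t) A x = (\int[mu]_y ((p s x y)%:E * mass t A y))%E.
Proof.
move=> s0 t0 mA A_oo; have st0 : 0 < s + t by rewrite addr_gt0.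
have fL := indic_Lfun2 A mA A_oo; have gL := sgr_L2 hP t0 fL.
have h1 := hp.2 (s + t) _ st0 fL; have h2 := sgr_add hP s0 t0 fL.
have h3 := hp.2 s _ s0 gL; have h4 := hp.2 t _ t0 fL.
apply: filterS3 h1 h2 h3 => x e1 e2 e3.
rewrite -(heat_indicE (s + t))// -e1 e2 e3 /heat /Rintegral.
rewrite (_ : (\int[mu]_y _ = \int[mu]_y ((p s x y)%:E * mass t A y))%E).
  rewrite fineK// ge0_fin_numE.
    apply: (@le_lt_trans _ _ (mass s setT x)).
      rewrite mass_setTE; apply: ge0_le_integralW => y _.
        by rewrite mule_ge0 ?mass_ge0// lee_fin kernel_ge0.
      by rewrite -[leRHS]mule1; apply: lee_wpmul2l; [rewrite lee_fin kernel_ge0|exact: mass_le1].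
    by rewrite -ge0_fin_numE ?mass_fin_num ?mass_ge0.
  by apply: integral_ge0 => y _; rewrite mule_ge0 ?mass_ge0// lee_fin kernel_ge0.
apply: ae_eq_integral => //.
- apply/measurable_EFinP; apply: measurable_funM; first exact: measurable_kernelr.
  by move: gL; rewrite inE => /andP[+ _]; rewrite inE.
- apply: emeasurable_funM; last exact: measurable_mass.
  exact/measurable_EFinP/measurable_kernelr.
- by apply: filterS h4 => y /= -> _; rewrite EFinM heat_indicE.
Qed.

Lemma mass_semigroup s t : 0 < s -> 0 < t ->
  \forall x \ae mu,
    mass (s + t) setT x = (\int[mu]_y ((p s x y)%:E * mass t setT y))%E.
Proof.
move=> s0 t0; have st0 : 0 < s + t by rewrite addr_gt0.
have /ae_foralln : forall n : nat, \forall x \ae mu, mass (s + t) (ball x0 n%:R) x =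
    (\int[mu]_y ((p s x y)%:E * mass t (ball x0 n%:R) y))%E.
  by move=> n; exact: mass_semigroup_fin.
apply: filterS => x hx.
have c1 := mass_ball_cvg (s + t) x st0.
suff : (\int[mu]_y ((p s x y)%:E * mass t (ball x0 n%:R) y) @[n --> \oo] -->
    \int[mu]_y ((p s x y)%:E * mass t setT y))%E.
  by under eq_fun do rewrite -hx; move=> c2; exact: (cvg_unique _ c1 c2).
have -> : (\int[mu]_y ((p s x y)%:E * mass t setT y) =
   \int[mu]_y limn (fun n => (p s x y)%:E * mass t (ball x0 n%:R) y))%E.
  apply: eq_integral => y _; apply/esym/cvg_lim => //.
  by apply: cvgeZl => //; exact: mass_ball_cvg.
apply: cvg_monotone_convergence => //.
- move=> n; apply: emeasurable_funM; last exact: measurable_mass.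
  exact/measurable_EFinP/measurable_kernelr.
- by move=> n y _; rewrite mule_ge0 ?mass_ge0// lee_fin kernel_ge0.
- move=> y _ m n mn; apply: lee_wpmul2l; first by rewrite lee_fin kernel_ge0.
  apply: ge0_le_integralW => z _; first by rewrite lee_fin mulr_ge0 ?kernel_ge0.
  rewrite lee_fin ler_wpM2l ?kernel_ge0// !indicE ler_nat.
  case: (boolP (z \in (ball x0 m%:R : set X))) => // /set_mem zm.
  suff : ball x0 n%:R z by move=> /mem_set ->.
  by apply: le_ball zm; rewrite ler_nat.
Qed.

(** The ball of radius t^(1 / dW) alone receives a fixed amount of mass, by
    the lower heat kernel bound and the lower volume bound. *)
Lemma mass_lower_bound : exists2 c : R, 0 < c &
  forall t x, 0 < t -> (c%:E <= mass t setT x)%E.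
Proof.
have [dH0 [c1 [c2 [c10 c20 hV]]]] := hA2.
pose e := expR (- (c6 * (1 `^ dW) `^ (dW - 1)^-1)).
exists (c5 * e * c1); first by rewrite !mulr_gt0// expR_gt0.
move=> t x t0; have r0 : 0 < t `^ dW^-1 by rewrite powR_gt0.
have k0 : 0 <= c5 * t `^ (- (dH / dW)) * e.
  by rewrite !mulr_ge0 ?powR_ge0 ?expR_ge0 ?(ltW c50).
apply: (@le_trans _ _ (\int[mu]_y (c5 * t `^ (- (dH / dW)) * e *
    \1_(ball x (t `^ dW^-1)) y)%:E)%E); last first.
  apply: ge0_le_integralW => y _; first by rewrite lee_fin mulr_ge0.
  rewrite lee_fin indicT /cst mulr1 indicE.
  case: (boolP (_ \in _)) => [/set_mem|_]; last by rewrite mulr0 kernel_ge0.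
  rewrite ballEmdist mulr1 /= => xy.
  have /andP[h _] := kernel_bounds t x y t0; apply: le_trans h.
  apply: sub_gaussian_near_diagonal => //; [|exact: ltW|exact: ltW|exact: mdist_ge0|].
    by rewrite (lt_le_trans _ dW2)// ltr1n.
  by rewrite mul1r ltW.
rewrite integral_cst_indic//.
apply: (@le_trans _ _ ((c5 * t `^ (- (dH / dW)) * e)%:E *
    (c1 * (t `^ dW^-1) `^ dH)%:E)%E); last first.
  by apply: lee_wpmul2l; [rewrite lee_fin|have [] := hV x _ (ltW r0)].
rewrite -EFinM lee_fin -powRrM le_eqVlt; apply/orP; left; apply/eqP.
rewrite (mulrC dW^-1) powRN.
by field; rewrite gt_eqF// powR_gt0.
Qed.

Lemma mass_holder t x y : 0 < t ->
  `|fine (mass t setT x) - fine (mass t setT y)| <=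
    C * t `^ (- (kappa / dW)) * mdist x y `^ kappa.
Proof. by move=> t0; exact: (heat_indic_holder t setT x y t0 measurableT). Qed.

(** The functions u n = P_((n+1)s) 1 decrease in n and stay above a positive
    constant. Their Hoelder constants tend to 0 by the Bakry-Emery estimate,
    so their limit a is the same at all points, and passing to the limit in u
    (n+1) = P_s (u n) gives a = a P_s 1. *)
Lemma mass_eq1_ae s : 0 < s -> \forall x \ae mu, mass s setT x = 1%E.
Proof.
move=> s0; pose T n : R := n.+1%:R * s.
have T0 n : 0 < T n by rewrite mulr_gt0.
have TS n : s + T n = T n.+1 by rewrite /T -[in RHS]natr1; ring.
have /ae_foralln h1 n : \forall x \ae mu, mass (s + T n) setT x =
    (\int[mu]_y ((p s x y)%:E * mass (T n) setT y))%E by exact: mass_semigroup.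
have /ae_foralln h2 n : \forall x \ae mu, mass (T n + s) setT x =
    (\int[mu]_y ((p (T n) x y)%:E * mass s setT y))%E by exact: mass_semigroup.
apply: filterS2 h1 h2 => x {}h1 {}h2.
pose u n y := fine (mass (T n) setT y).
have uE n y : mass (T n) setT y = (u n y)%:E by rewrite /u fineK// mass_fin_num.
have u1 n y : u n y <= 1 by rewrite -lee_fin -uE mass_le1.
have [c c0 hc] := mass_lower_bound.
have uc n y : c <= u n y by rewrite -lee_fin -uE hc.
have ndec : nonincreasing_seq (u ^~ x).
  apply/nonincreasing_seqP => n; rewrite -lee_fin -!uE -TS addrC h2 mass_setTE.
  apply: ge0_le_integralW => y _.
    by rewrite mule_ge0 ?mass_ge0// lee_fin kernel_ge0.
  by rewrite -[leRHS]mule1; apply: lee_wpmul2l; [rewrite lee_fin kernel_ge0|exact: mass_le1].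
have cu : cvgn (u ^~ x).
  by apply: nonincreasing_is_cvgn => //; exists c => _ [n _ <-].
set a := limn (u ^~ x) in cu.
have ac : c <= a by apply: limr_ge => //; apply: nearW => n.
(* The limits at x and y agree because the Hoelder constant of u n decays as a
   power of n. *)
have cuy y : u n y @[n --> \oo] --> a.
  suff h : (u n y - u n x) @[n --> \oo] --> (0 : R).
    rewrite -[a]add0r (_ : (fun n => u n y) = (fun n => (u n y - u n x) + u n x)).
      exact: cvgD h cu.
    by apply/funext => n; rewrite subrK.
  have hb n : `|u n y - u n x| <= C * T n `^ (- (kappa / dW)) * mdist y x `^ kappa.
    exact: mass_holder.
  have Tc : C * T n `^ (- (kappa / dW)) * mdist y x `^ kappa @[n --> \oo] --> (0 : R).
    have hn := @harmonic_powR_cvg0 R (kappa / dW) ltac:(by rewrite divr_gt0 ?(lt_le_trans _ dW2)).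
    have -> : 0 = C * s `^ (- (kappa / dW)) * mdist y x `^ kappa * 0 :> R by rewrite mulr0.
    rewrite (_ : (fun n => _) = (fun n => C * s `^ (- (kappa / dW)) *
      mdist y x `^ kappa * n.+1%:R^-1 `^ (kappa / dW))).
      by apply: cvgM => //; exact: cvg_cst.
    apply/funext => n; rewrite /T powRM ?ler0n ?(ltW s0)//.
    rewrite (_ : n.+1%:R `^ (- (kappa / dW)) = n.+1%:R^-1 `^ (kappa / dW)); first by ring.
    by rewrite -(powR_inv1 (ler0n R n.+1)) -powRrM mulN1r.
  apply/norm_cvg0P; apply: (squeeze_cvgr _ (cvg_cst 0) Tc).
  by apply: nearW => n; rewrite hb normr_ge0.
have lim1 : (\int[mu]_y (p s x y * u n y)%:E @[n --> \oo] -->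
    \int[mu]_y (p s x y * a)%:E)%E.
  apply: (@dominated_cvg _ _ _ _ _ measurableT _ _ (fun y => (p s x y)%:E)) => //.
  - move=> n; apply/measurable_EFinP; apply: measurable_funM; first exact: measurable_kernelr.
    exact: measurable_heat_indic.
  - move=> y _; apply: cvg_EFin; first exact: nearW.
    by apply: cvgM => //; exact: cvg_cst.
  - apply/integrableP; split; first exact/measurable_EFinP/measurable_kernelr.
    under eq_integral do rewrite gee0_abs ?lee_fin ?kernel_ge0//.
    by rewrite -mass_setTE -ge0_fin_numE ?mass_ge0 ?mass_fin_num.
  - move=> n y _ /=; rewrite lee_fin normrM (ger0_norm (kernel_ge0 _ _ _ s0)).
    have u0 : 0 <= u n y by exact: le_trans (ltW c0) (uc n y).
    by rewrite ler_piMr ?kernel_ge0// ger0_norm.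
have lim2 : ((u n.+1 x)%:E @[n --> \oo] --> a%:E)%E.
  by apply: cvg_EFin; [exact: nearW|rewrite (cvg_shiftS (u ^~ x))].
have stepE m : (\int[mu]_y (p s x y * u m y)%:E = (u m.+1 x)%:E)%E.
  by rewrite -uE -TS h1; apply: eq_integral => y _; rewrite uE EFinM.
have lim3 : ((u n.+1 x)%:E @[n --> \oo] --> \int[mu]_y (p s x y * a)%:E)%E.
  by under eq_fun do rewrite -stepE.
have int_a : (\int[mu]_y (p s x y * a)%:E = (a * fine (mass s setT x))%:E)%E.
  rewrite EFinM fineK ?mass_fin_num// mass_setTE -ge0_integralZl_EFin//.
  - by apply: eq_integral => y _; rewrite -EFinM mulrC.
  - by move=> y _; rewrite lee_fin kernel_ge0.
  - exact/measurable_EFinP/measurable_kernelr.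
  - exact: le_trans (ltW c0) ac.
have e1 : a%:E = (a * fine (mass s setT x))%:E.
  by rewrite -int_a; exact: (cvg_unique _ lim2 lim3).
have am : a = a * fine (mass s setT x) by exact: (congr1 fine e1).
move/esym/eqP: am.
have a0 : a != 0 by rewrite gt_eqF// (lt_le_trans c0).
rewrite -subr_eq0 -{2}[a]mulr1 -mulrBr mulf_eq0 (negbTE a0)/= subr_eq0 => /eqP m1.
by rewrite -(fineK (mass_fin_num s setT x s0)) m1.
Qed.

Lemma mass_eq1 s x : 0 < s -> (\int[mu]_y (p s x y)%:E = 1)%E.
Proof.
move=> s0; rewrite -mass_setTE -(fineK (mass_fin_num s setT x s0)); congr (_%:E).
apply/eqP; rewrite eq_le -!lee_fin fineK ?mass_fin_num// mass_le1//=.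
have cg : continuous (fun y => - fine (mass s setT y)).
  move=> y; apply: cvgN; exact: (heat_indic_continuous s setT s0 measurableT).
rewrite -(fineK (mass_fin_num s setT x s0)) lee_fin -lerN2.
apply: (continuous_ae_le mu dH hborel hA2 _ _ cg).
by apply: filterS (mass_eq1_ae s s0) => y ->.
Qed.

End heat_kernel.

(** * Flux through a set along the semigroup *)

Section perimeter.
Context {d} {T : measurableType d} {R : realType}.
Context (mu : {sigma_finite_measure set T -> \bar R}).
Implicit Types (A : set T) (w : T * T -> R) (t s : R).

Lemma flux_compl w A : measurable A -> measurable_fun setT w ->
  (forall z, 0 <= w z) -> (forall x y, w (x, y) = w (y, x)) ->
  flux mu w (~` A) = flux mu w A.
Proof.
move=> mA mw w0 ws; rewrite /flux setCK.
rewrite -[RHS](integral_swap mu (fun z => (w z * \1_A z.1 * \1_(~` A) z.2)%:E)).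
- by apply: eq_integral => -[x y] _ /=; rewrite -ws; congr (_%:E); ring.
- apply/measurable_EFinP; apply: measurable_funM; first apply: measurable_funM => //.
    exact: (measurableT_comp (@measurable_indic _ T R setT A mA) measurable_fst).
  exact: (measurableT_comp (@measurable_indic _ T R setT _ (measurableC mA)) measurable_snd).
- by move=> z; rewrite lee_fin !mulr_ge0.
Qed.

Context (p : R -> T -> T -> R) (D : T * T -> R) (M g : R).
Hypotheses (mp : forall t, 0 < t -> measurable_fun setT (fun z : T * T => p t z.1 z.2)).
Hypotheses (p0 : forall t x y, 0 < t -> 0 <= p t x y).
Hypotheses (psym : forall t x y, 0 < t -> p t x y = p t y x).
Hypotheses (pmass : forall t x, 0 < t -> (\int[mu]_y (p t x y)%:E = 1)%E).
Hypotheses (mD : measurable_fun setT D) (D0 : forall z, 0 <= D z).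
Hypothesis Dsym : forall x y, D (x, y) = D (y, x).
Hypothesis M0 : 0 <= M.

(* v t A stands for P_t 1_A. *)
Context (v : R -> set T -> T -> R).
Hypothesis vE : forall t A x, 0 < t -> measurable A -> (mu A < +oo)%E ->
  (v t A x)%:E = (\int[mu]_y (p t x y * \1_A y)%:E)%E.
Hypothesis v_chapman : forall s t A, 0 < s -> 0 < t -> measurable A -> (mu A < +oo)%E ->
  \forall x \ae mu, (v (s + t) A x)%:E = (\int[mu]_y (p s x y * v t A y)%:E)%E.
Hypothesis v_holder : forall t A x y, 0 < t -> measurable A ->
  (mu A < +oo)%E -> v t A x <= v t A y + M * t `^ (- g) * D (x, y).

Let kernel t (z : T * T) := p t z.1 z.2.
Let wkernel t (z : T * T) := p t z.1 z.2 * D z.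

Section finite_set.
Context (A : set T) (mA : measurable A) (A_oo : (mu A < +oo)%E).

Let mA1 : measurable_fun setT (fun z : T * T => \1_A z.1 : R).
Proof. exact: (measurableT_comp (@measurable_indic _ T R setT A mA) measurable_fst). Qed.

Let mA2 : measurable_fun setT (fun z : T * T => \1_A z.2 : R).
Proof. exact: (measurableT_comp (@measurable_indic _ T R setT A mA) measurable_snd). Qed.

Let mC2 : measurable_fun setT (fun z : T * T => \1_(~` A) z.2 : R).
Proof.
exact: (measurableT_comp (@measurable_indic _ T R setT _ (measurableC mA)) measurable_snd).
Qed.

Let indicD (x : T) : \1_A x + \1_(~` A) x = 1 :> R.
Proof. by rewrite !indicE in_setC; case: (x \in A); rewrite ?addr0 ?add0r. Qed.

Lemma v_ge0 t x : 0 < t -> 0 <= v t A x.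
Proof.
move=> t0; rewrite -lee_fin vE//; apply: integral_ge0 => y _.
by rewrite lee_fin mulr_ge0 ?p0.
Qed.

Lemma measurable_v t : 0 < t -> measurable_fun setT (v t A).
Proof.
move=> t0; apply/measurable_EFinP.
rewrite (_ : _ \o _ = fun x => (\int[mu]_y (p t x y * \1_A y)%:E)%E); last first.
  by apply/funext => x /=; rewrite vE.
apply: (measurable_fun_fubini_tonelli_F (fun z => (p t z.1 z.2 * \1_A z.2)%:E)).
  by apply/measurable_EFinP; apply: measurable_funM => //; exact: mp.
by move=> z; rewrite lee_fin mulr_ge0// p0.
Qed.

Let stay t : \bar R := (\int[mu]_x (\1_A x * v t A x)%:E)%E.

Let stay_ge0 t : 0 < t -> (0 <= stay t)%E.
Proof. by move=> t0; apply: integral_ge0 => x _; rewrite lee_fin mulr_ge0 ?v_ge0. Qed.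

(** The kernel has mass one, so the measure of A splits into the heat that
    stays in A and the heat that leaves it. *)
Lemma stay_flux t : 0 < t -> (stay t + flux mu (kernel t) A = mu A)%E.
Proof.
move=> t0; have mk := mp t t0.
have stayE : stay t = (\int[mu \x mu]_z (p t z.1 z.2 * \1_A z.1 * \1_A z.2)%:E)%E.
  rewrite (fubini_tonelli1 (fun z => (p t z.1 z.2 * \1_A z.1 * \1_A z.2)%:E)); first last.
  - by move=> z; rewrite lee_fin !mulr_ge0 ?p0.
  - by apply/measurable_EFinP; do 2 apply: measurable_funM => //.
  apply: eq_integral => x _; rewrite EFinM vE// -ge0_integralZl_EFin//.
  - by apply: eq_integral => y _; rewrite -EFinM/=; congr (_%:E); ring.
  - by move=> y _; rewrite lee_fin mulr_ge0 ?p0.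
  - apply/measurable_EFinP; apply: measurable_funM; last exact: measurable_indic.
    exact: (measurableT_comp mk (measurable_pair1 x)).
rewrite stayE /flux -ge0_integralD//; first last.
- by apply/measurable_EFinP; do 2 apply: measurable_funM => //.
- by move=> z _; rewrite lee_fin !mulr_ge0 ?p0.
- by apply/measurable_EFinP; do 2 apply: measurable_funM => //.
- by move=> z _; rewrite lee_fin !mulr_ge0 ?p0.
under eq_integral do rewrite -EFinD -mulrDr indicD mulr1.
rewrite (fubini_tonelli1 (fun z => (p t z.1 z.2 * \1_A z.1)%:E)); first last.
- by move=> z; rewrite lee_fin !mulr_ge0 ?p0.
- by apply/measurable_EFinP; apply: measurable_funM => //.
have -> : mu A = (\int[mu]_x (\1_A x)%:E)%E by rewrite integral_indic// setIT.
apply: eq_integral => x _; rewrite /fubini_F/=.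
under eq_integral do rewrite mulrC EFinM.
rewrite ge0_integralZl_EFin// ?pmass ?mule1//.
- by move=> y _; rewrite lee_fin p0.
- exact/measurable_EFinP/(measurableT_comp mk (measurable_pair1 x)).
Qed.

(** Both amounts of heat are integrals of p_t(x,y) over x in A, against P_s
    1_A evaluated at x for the first and at y for the second. The pairs with y
    in A contribute equally by symmetry. On the pairs with y outside A the
    Hoelder estimate replaces the value at x by the value at y. *)
Lemma stay_step s t : 0 < s -> 0 < t ->
  (stay s <= stay (t + s)%R + (M * s `^ (- g))%:E * flux mu (wkernel t) A)%E.
Proof.
move=> s0 t0; have mk := mp t t0; have mv := measurable_v s s0.
have mv1 := measurableT_comp mv (@measurable_fst _ _ T T).
have mv2 := measurableT_comp mv (@measurable_snd _ _ T T).
have vpos x := v_ge0 s x s0.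
pose I (B : set T) (u : T * T -> R) : \bar R :=
  (\int[mu \x mu]_z (p t z.1 z.2 * \1_A z.1 * \1_B z.2 * u z)%:E)%E.
have split (u : T * T -> R) : measurable_fun setT u -> (forall z, 0 <= u z) ->
    (\int[mu]_x \int[mu]_y (p t x y * \1_A x * u (x, y))%:E = I A u + I (~` A) u)%E.
  move=> mu_ u0; rewrite /I -ge0_integralD//; first last.
  - by apply/measurable_EFinP; do 3 apply: measurable_funM => //.
  - by move=> z _; rewrite lee_fin !mulr_ge0 ?p0.
  - by apply/measurable_EFinP; do 3 apply: measurable_funM => //.
  - by move=> z _; rewrite lee_fin !mulr_ge0 ?p0.
  under [RHS]eq_integral do rewrite -EFinD -mulrDl -mulrDr indicD mulr1.
  rewrite (fubini_tonelli1 (fun z => (p t z.1 z.2 * \1_A z.1 * u z)%:E))//.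
  - by apply/measurable_EFinP; do 2 apply: measurable_funM => //.
  - by move=> z; rewrite lee_fin !mulr_ge0 ?p0.
have stay1 : stay s = (I A (fun z => v s A z.1) + I (~` A) (fun z => v s A z.1))%E.
  rewrite -split//; apply: eq_integral => x _ /=.
  under eq_integral do rewrite -mulrA mulrC EFinM.
  rewrite ge0_integralZl_EFin ?pmass ?mule1//.
  - by move=> y _; rewrite lee_fin p0.
  - exact/measurable_EFinP/(measurableT_comp mk (measurable_pair1 x)).
  - by rewrite mulr_ge0.
have stay2 : stay (t + s) = (I A (fun z => v s A z.2) + I (~` A) (fun z => v s A z.2))%E.
  rewrite -split//; apply: ae_eq_integral => //.
  - apply/measurable_EFinP; apply: measurable_funM; first exact: measurable_indic.
    by apply: measurable_v; rewrite addr_gt0.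
  - apply: (measurable_fun_fubini_tonelli_F
      (fun z => (p t z.1 z.2 * \1_A z.1 * v s A z.2)%:E)).
      by apply/measurable_EFinP; do 2 apply: measurable_funM => //.
    by move=> z; rewrite lee_fin !mulr_ge0 ?p0.
  - apply: filterS (v_chapman t s A t0 s0 mA A_oo) => x e _ /=.
    rewrite EFinM e -ge0_integralZl_EFin//.
    + by apply: eq_integral => y _; rewrite -EFinM; congr (_%:E); ring.
    + by move=> y _; rewrite lee_fin mulr_ge0 ?p0.
    + apply/measurable_EFinP; apply: measurable_funM => //.
      exact: (measurableT_comp mk (measurable_pair1 x)).
have diag : I A (fun z => v s A z.1) = I A (fun z => v s A z.2).
  rewrite /I -(integral_swap mu (fun z => (p t z.1 z.2 * \1_A z.1 * \1_A z.2 * v s A z.2)%:E)).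
  - by apply: eq_integral => -[x y] _ /=; rewrite (psym t y x t0); congr (_%:E); ring.
  - by apply/measurable_EFinP; do 3 apply: measurable_funM => //.
  - by move=> z; rewrite lee_fin !mulr_ge0 ?p0.
rewrite stay1 stay2 diag -[leRHS]addeA; apply: leeD2l.
have Ms0 : 0 <= M * s `^ (- g) by rewrite mulr_ge0 ?powR_ge0.
rewrite /flux -ge0_integralZl_EFin//; first last.
- by apply/measurable_EFinP; do 3 apply: measurable_funM => //.
- by move=> z _; rewrite lee_fin !mulr_ge0 ?p0.
rewrite -ge0_integralD//; first last.
- by apply/measurable_EFinP; apply: measurable_funM => //;
    do 3 apply: measurable_funM => //.
- by move=> z _; rewrite -EFinM lee_fin !mulr_ge0 ?p0 ?powR_ge0.
- by apply/measurable_EFinP; do 3 apply: measurable_funM => //.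
- by move=> z _; rewrite lee_fin !mulr_ge0 ?p0.
apply: ge0_le_integralW => -[x y] _ /=; first by rewrite lee_fin !mulr_ge0 ?p0.
rewrite -EFinM -EFinD lee_fin /wkernel/=.
have := v_holder s A x y s0 mA A_oo.
have c0 : 0 <= p t x y * \1_A x * \1_(~` A) y by rewrite !mulr_ge0 ?p0.
by move=> h; have := ler_wpM2l c0 h; lra.
Qed.

(** Telescoping [stay_step] along the multiples of t, and converting the heat
    that stays into flux; the subtraction is licit because mu A is finite. *)
Lemma flux_iterate n t : 0 < t ->
  (flux mu (kernel (n.+1%:R * t)%R) A <= flux mu (kernel t) A +
   (M * \sum_(k < n) (k.+1%:R * t) `^ (- g))%:E * flux mu (wkernel t) A)%E.
Proof.
move=> t0.
have stays : (stay t <= stay (n.+1%:R * t)%R +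
   (M * \sum_(k < n) (k.+1%:R * t) `^ (- g))%:E * flux mu (wkernel t) A)%E.
  elim: n => [|n ih]; first by rewrite big_ord0 mulr0 mul0e adde0 mul1r.
  rewrite (le_trans ih)// big_ord_recr/= mulrDr EFinD ge0_muleDl ?lee_fin; first last.
  - by rewrite mulr_ge0 ?powR_ge0.
  - by rewrite mulr_ge0// sumr_ge0// => k _; rewrite powR_ge0.
  rewrite [leRHS]addeCA [leLHS]addeC; apply: leeD2l.
  have -> : n.+2%:R * t = t + n.+1%:R * t by rewrite -[n.+2%:R]natr1; ring.
  by apply: stay_step => //; rewrite mulr_gt0.
have nt0 : 0 < n.+1%:R * t by rewrite mulr_gt0.
have E := stay_flux t t0; rewrite -(stay_flux _ nt0) in E.
have sfin : stay (n.+1%:R * t)%R \is a fin_num.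
  rewrite ge0_fin_numE ?stay_ge0//; apply: le_lt_trans A_oo.
  rewrite -(stay_flux _ nt0) leeDl//; apply: integral_ge0 => z _.
  by rewrite lee_fin !mulr_ge0 ?p0.
rewrite -(leeD2lE _ _ sfin) -E (addeC (flux mu (kernel t) A)) [leRHS]addeA; exact: leeD2r.
Qed.

End finite_set.
Definition energy (w : T * T -> R) (f : T -> R) : \bar R :=
  (\int[mu \x mu]_z (w z * `|f z.1 - f z.2|)%:E)%E.

Let mdiff (f : T -> R) : measurable_fun setT f ->
  measurable_fun setT (fun z : T * T => f z.1 - f z.2).
Proof.
move=> mf; apply: measurable_funB.
  exact: (measurableT_comp mf measurable_fst).
exact: (measurableT_comp mf measurable_snd).
Qed.

(** Exchanging the variables turns the negative part of f x - f y into the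
    positive one. *)
Lemma energyE w (f : T -> R) : measurable_fun setT w -> (forall z, 0 <= w z) ->
  (forall x y, w (x, y) = w (y, x)) -> measurable_fun setT f ->
  energy w f = (positive_energy mu w f + positive_energy mu w f)%E.
Proof.
move=> mw w0 ws mf; have md := mdiff f mf.
have mpos : measurable_fun setT (fun z : T * T => (w z * Num.max (f z.1 - f z.2) 0)%:E).
  apply/measurable_EFinP; apply: measurable_funM => //.
  exact: (measurable_funrpos md).
have pos0 z : (0 <= (w z * Num.max (f z.1 - f z.2) 0)%:E)%E.
  by rewrite lee_fin mulr_ge0// le_max lexx orbT.
rewrite /positive_energy -{2}(integral_swap mu _ mpos pos0) -ge0_integralD//; last first.
  exact: (measurableT_comp mpos (@measurable_swap _ _ T T)).
apply: eq_integral => -[x y] _ /=; rewrite -EFinD -ws -mulrDr; congr (_ * _)%:E.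
have -> : f y - f x = - (f x - f y) by ring.
have [h|h] := leP 0 (f x - f y).
  by rewrite ger0_norm// [in RHS]max_r ?addr0// oppr_le0.
by rewrite ltr0_norm// [in RHS]max_l ?add0r// oppr_ge0 ltW.
Qed.

(** The Chebyshev inequality. *)
Lemma level_set_finite (f : T -> R) (B : set T) (c : R) :
  mu.-integrable setT (EFin \o f) -> measurable B -> 0 < c ->
  (forall x, B x -> c <= `|f x|) -> (mu B < +oo)%E.
Proof.
move=> fi mB c0 Bf.
have : (c%:E * mu B < +oo)%E.
  have -> : mu B = (\int[mu]_x (\1_B x)%:E)%E by rewrite integral_indic// setIT.
  rewrite -ge0_integralZl_EFin ?(ltW c0)//; last exact/measurable_EFinP/measurable_indic.
  have /integrableP[_] := fi; apply: le_lt_trans; apply: ge0_le_integralW => x _.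
    by rewrite -EFinM lee_fin mulr_ge0// ltW.
  rewrite -EFinM lee_fin indicE; case: (boolP (_ \in _)) => [/set_mem Bx|_].
    by rewrite mulr1 Bf.
  by rewrite mulr0.
move=> h; rewrite ltey; apply/eqP => Boo; move: h.
by rewrite Boo gt0_muley ?lte_fin// ltxx.
Qed.

(** Integrates [flux_iterate] over the levels of f. A superlevel set at a
    negative level may have infinite measure, but its complement has finite
    measure and the same flux. *)
Lemma positive_energy_iterate (f : T -> R) n t : 0 < t ->
  mu.-integrable setT (EFin \o f) ->
  (positive_energy mu (kernel (n.+1%:R * t)%R) f <=
   positive_energy mu (kernel t) f +
   (M * \sum_(k < n) (k.+1%:R * t) `^ (- g))%:E * positive_energy mu (wkernel t) f)%E.
Proof.
move=> t0 fi; have nt0 : 0 < n.+1%:R * t by rewrite mulr_gt0.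
have mf : measurable_fun setT f by apply/measurable_EFinP; exact: measurable_int fi.
have kge0 s : 0 < s -> forall z, 0 <= kernel s z by move=> s0 z; exact: p0.
have ksym s : 0 < s -> forall x y, kernel s (x, y) = kernel s (y, x).
  by move=> s0 x y; exact: psym.
have mw : measurable_fun setT (wkernel t) by apply: measurable_funM => //; exact: mp.
have w0 z : 0 <= wkernel t z by rewrite mulr_ge0 ?p0.
have wsym x y : wkernel t (x, y) = wkernel t (y, x) by rewrite /wkernel/= Dsym psym.
have [m1 ->] := coarea mu (kernel (n.+1%:R * t)) f (mp _ nt0) (kge0 _ nt0) mf.
have [m2 ->] := coarea mu (kernel t) f (mp _ t0) (kge0 _ t0) mf.
have [m3 ->] := coarea mu (wkernel t) f mw w0 mf.
set S := M * _; have S0 : 0 <= S.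
  by rewrite mulr_ge0// sumr_ge0// => k _; rewrite powR_ge0.
have flux_ge0 w A : (forall z, 0 <= w z) -> (0 <= flux mu w A)%E.
  by move=> wpos; apply: integral_ge0 => z _; rewrite lee_fin !mulr_ge0.
rewrite -ge0_integralZl_EFin//; last by move=> u _; exact: flux_ge0.
rewrite -ge0_integralD//; first last.
- by apply: measurable_funeM.
- by move=> u _; rewrite mule_ge0 ?flux_ge0.
- by move=> u _; apply: flux_ge0; exact: kge0.
apply: ae_ge0_le_integral => //.
- by move=> u _; apply: flux_ge0; exact: kge0.
- move=> u _; rewrite adde_ge0 ?flux_ge0//; first exact: kge0.
  by rewrite mule_ge0 ?flux_ge0.
- by apply: emeasurable_funD => //; exact: measurable_funeM.
(* At level 0 both the superlevel set and its complement may have infinite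
   measure. *)
exists [set 0]; split => //; first exact: lebesgue_measure_set1.
apply: subsetCl => u /eqP u0 _.
pose A := [set x | u < f x].
have mA : measurable A.
  rewrite (_ : A = setT `&` f @^-1` `]u, +oo[%classic); first exact: mf.
  by apply/seteqP; split => x; rewrite /A/= in_itv/= andbT => // -[].
have [u_gt0|u_lt0|u_eq0] := ltgtP 0 u; last by rewrite u_eq0 eqxx in u0.
  apply: flux_iterate => //; apply: (level_set_finite f A u) => // x ux.
  by rewrite (le_trans (ltW ux)) ?ler_norm.
have cA_oo : (mu (~` A) < +oo)%E.
  apply: (level_set_finite f _ (- u)) => //; first exact: measurableC.
    by rewrite oppr_gt0.
  by move=> x /negP; rewrite -leNgt -normrN => fu; rewrite (le_trans _ (ler_norm _)) ?lerN2.
have := flux_iterate _ (measurableC mA) cA_oo n t t0.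
by rewrite !flux_compl//; [exact: mp|exact: kge0|exact: ksym|exact: mp|exact: kge0|exact: ksym].
Qed.

Lemma energy_iterate (f : T -> R) n t : 0 < t ->
  mu.-integrable setT (EFin \o f) ->
  (energy (kernel (n.+1%:R * t)%R) f <= energy (kernel t) f +
   (M * \sum_(k < n) (k.+1%:R * t) `^ (- g))%:E * energy (wkernel t) f)%E.
Proof.
move=> t0 fi; have nt0 : 0 < n.+1%:R * t by rewrite mulr_gt0.
have mf : measurable_fun setT f by apply/measurable_EFinP; exact: measurable_int fi.
have pe_ge0 w : (forall z, 0 <= w z) -> (0 <= positive_energy mu w f)%E.
  move=> w0; apply: integral_ge0 => z _.
  by rewrite lee_fin mulr_ge0// le_max lexx orbT.
have kge0 s : 0 < s -> forall z, 0 <= kernel s z by move=> s0 z; exact: p0.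
have w0 z : 0 <= wkernel t z by rewrite mulr_ge0 ?p0.
have key := positive_energy_iterate f n t t0 fi.
rewrite !energyE//.
- rewrite (@ge0_muleDr _ _ _ _ (pe_ge0 _ w0) (pe_ge0 _ w0)) [leRHS]addeACA.
  exact: (leeD key key).
- by apply: measurable_funM => //; exact: mp.
- by move=> x y; rewrite /wkernel/= Dsym psym.
- exact: mp.
- exact: kge0.
- by move=> x y; exact: psym.
- exact: mp.
- exact: kge0.
- by move=> x y; exact: psym.
Qed.

End perimeter.

(** * Moments of the stable subordinator *)

Section stable_subordinator.
Context {R : realType} (delta : R) (eta : R -> R -> R).
Hypotheses (delta01 : 0 < delta < 1) (heta : subordinator delta eta).
Implicit Types (t s b c l : R).

Let delta0 : 0 < delta. Proof. by case/andP: delta01. Qed.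

Let D : set R := `]0, +oo[%classic.

Let mD : measurable D. Proof. exact: measurable_itv. Qed.

Lemma subordinator_ge0 t s : 0 < t -> D s -> 0 <= eta t s.
Proof.
by move=> t0; rewrite /D/= in_itv/= andbT => s0; have [_ h _] := heta t t0; exact: h.
Qed.

Lemma measurable_subordinator t : 0 < t -> measurable_fun D (eta t).
Proof.
move=> t0; apply: open_continuous_measurable_fun; first exact: interval_open.
by have [h _ _] := heta t t0; move=> s /set_mem; exact: h.
Qed.

Definition average t (g : R -> R) : \bar R :=
  (\int[lebesgue_measure]_(s in D) (eta t s * g s)%:E)%E.

Lemma average_le t (g h : R -> R) : 0 < t ->
  (forall s, 0 < s -> 0 <= g s <= h s) -> (average t g <= average t h)%E.
Proof.
move=> t0 gh; apply: ge0_le_integralW => s Ds; have e0 := subordinator_ge0 t s t0 Ds;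
  have /andP[g0 gh'] : 0 <= g s <= h s by apply: gh; move: Ds; rewrite /D/= in_itv/= andbT.
  by rewrite lee_fin mulr_ge0.
by rewrite lee_fin ler_wpM2l.
Qed.

Let mM t (g : R -> R) : 0 < t -> measurable_fun setT g ->
  measurable_fun D (fun s => (eta t s * g s)%:E).
Proof.
move=> t0 mg; apply/measurable_EFinP; apply: measurable_funM.
  exact: measurable_subordinator.
exact: measurable_funTS.
Qed.

Lemma averageD t (g h : R -> R) : 0 < t ->
  measurable_fun setT g -> measurable_fun setT h ->
  (forall s, 0 < s -> 0 <= g s) -> (forall s, 0 < s -> 0 <= h s) ->
  average t (g \+ h) = (average t g + average t h)%E.
Proof.
move=> t0 mg mh g0 h0; rewrite /average -ge0_integralD//.
- by apply: eq_integral => s _; rewrite -EFinD mulrDr.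
- by move=> s Ds; rewrite lee_fin mulr_ge0 ?subordinator_ge0// g0//; move: Ds;
    rewrite /D/= in_itv/= andbT.
- exact: mM.
- by move=> s Ds; rewrite lee_fin mulr_ge0 ?subordinator_ge0// h0//; move: Ds;
    rewrite /D/= in_itv/= andbT.
- exact: mM.
Qed.

Lemma averageZ t c (g : R -> R) : 0 < t -> 0 <= c -> measurable_fun setT g ->
  (forall s, 0 < s -> 0 <= g s) ->
  average t (fun s => c * g s) = (c%:E * average t g)%E.
Proof.
move=> t0 c0 mg g0; rewrite /average -ge0_integralZl_EFin//.
- by apply: eq_integral => s _; rewrite -EFinM mulrCA.
- by move=> s Ds; rewrite lee_fin mulr_ge0 ?subordinator_ge0// g0//; move: Ds;
    rewrite /D/= in_itv/= andbT.
- exact: mM.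
Qed.

Let mexp c : measurable_fun setT (fun s => expR (- (s * c))).
Proof.
apply: measurableT_comp => //; apply: measurableT_comp => //.
exact: mulrr_measurable.
Qed.

Lemma average_exp t l : 0 < t -> 0 < l ->
  average t (fun s => expR (- (s * l))) = (expR (- (t * l `^ delta)))%:E.
Proof. by move=> t0 l0; have [_ _ h] := heta t t0; exact: h. Qed.

(** The Laplace transform at 1 / (n + 1), as n tends to infinity. *)
Lemma average1 t : 0 < t -> average t (cst 1) = 1%E.
Proof.
move=> t0; pose g (n : nat) s := (eta t s * expR (- (s * n.+1%:R^-1)))%:E.
have lim1 : (\int[lebesgue_measure]_(s in D) g n s @[n --> \oo] --> average t (cst 1%R))%E.
  have -> : average t (cst 1) = (\int[lebesgue_measure]_(s in D) limn (g ^~ s))%E.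
    apply: eq_integral => s /set_mem Ds; apply/esym/cvg_lim => //.
    apply: cvg_EFin; first exact: nearW.
    apply: cvgM; first exact: cvg_cst.
    have -> : cst 1 s = expR (- (s * 0)) by rewrite mulr0 oppr0 expR0.
    apply: continuous_cvg; first exact: continuous_expR.
    by apply: cvgN; apply: cvgM; [exact: cvg_cst|exact: cvg_harmonic].
  apply: cvg_monotone_convergence => //.
  - by move=> n; apply: mM.
  - by move=> n s Ds; rewrite lee_fin mulr_ge0 ?expR_ge0 ?subordinator_ge0.
  - move=> s Ds m n mn; rewrite lee_fin ler_wpM2l ?subordinator_ge0// ler_expR lerN2.
    have s0 : 0 < s by move: Ds; rewrite /D/= in_itv/= andbT.
    by rewrite ler_wpM2l ?(ltW s0)// lef_pV2 ?posrE// ler_nat.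
have lim2 : (\int[lebesgue_measure]_(s in D) g n s @[n --> \oo] --> 1)%E.
  rewrite (_ : (fun n => _) = (fun n => (expR (- (t * n.+1%:R^-1 `^ delta)))%:E)); last first.
    by apply/funext => n; rewrite -(average_exp t n.+1%:R^-1 t0)// invr_gt0.
  apply: cvg_EFin; first exact: nearW.
  rewrite [X in _ --> X](_ : _ = expR (- (t * 0))); last by rewrite mulr0 oppr0 expR0.
  apply: continuous_cvg; first exact: continuous_expR.
  by apply: cvgN; apply: cvgM; [exact: cvg_cst|exact: harmonic_powR_cvg0].
exact: (cvg_unique _ lim1 lim2).
Qed.

Lemma average_compl_exp t l : 0 < t -> 0 < l ->
  average t (fun s => 1 - expR (- (s * l))) = (1 - expR (- (t * l `^ delta)))%:E.
Proof.
move=> t0 l0.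
have e1 s : 0 < s -> expR (- (s * l)) <= 1.
  by move=> s0; rewrite -expR0 ler_expR oppr_le0 mulr_ge0 ?ltW.
have mc : measurable_fun setT (fun s => 1 - expR (- (s * l))).
  by apply: measurable_funB => //; exact: measurable_cst.
have := averageD t (fun s => 1 - expR (- (s * l))) (fun s => expR (- (s * l))) t0 mc
  (mexp l) ltac:(by move=> s /e1; rewrite subr_ge0) ltac:(by move=> s _; exact: expR_ge0).
rewrite (_ : _ \+ _ = cst 1); last by apply/funext => s; rewrite /= subrK.
rewrite average1// average_exp// EFinB => ->.
by rewrite addeK.
Qed.

Lemma average_compl_exp_le t l : 0 < t -> 0 < l ->
  (average t (fun s => 1 - expR (- (s * l)))%R <= (t * l `^ delta)%:E)%E.
Proof.
move=> t0 l0; rewrite average_compl_exp// lee_fin.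
by have := expR_ge1Dx (- (t * l `^ delta)) => ?; lra.
Qed.

Lemma expRN1_le_half : expR (- 1) <= 2^-1 :> R.
Proof. by rewrite expRN lef_pV2 ?posrE ?expR_gt0// (le_trans _ (expR_ge1Dx _))//; lra. Qed.

(** Put T = t^(1 / delta). For s > T the power s^b is at most a constant times
    T^b 2^(k b) (1 - exp (- s / (2^k T))) for the k with 2^k T <= s < 2^(k+1)
    T. By the Laplace transform the average of the k-th function is at most a
    constant times T^b 2^(k (b - delta)), and these numbers have a finite sum
    because b < delta. *)
Lemma average_powR b : 0 < b < delta -> exists2 c, 0 < c &
  forall t, 0 < t -> (average t (fun s => s `^ b)%R <= (c * t `^ (b / delta))%:E)%E.
Proof.
move=> /andP[b0 bd]; have b1 : b < 1 by case/andP: delta01 => _; exact: lt_trans.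
(* The ratio of the geometric series of the averages. *)
pose q : R := 2 `^ (b - delta).
have q0 : 0 < q by rewrite powR_gt0.
have q1 : q < 1.
  rewrite -[ltRHS](powRr0 (2 : R)) /q /powR gt_eqF// ltr_expR ltr_pM2r ?ln_gt0//; lra.
exists (1 + 4 / (1 - q)).
  by rewrite addr_gt0// divr_gt0// subr_gt0.
move=> t t0; pose T := t `^ delta^-1.
have T0 : 0 < T by rewrite powR_gt0.
have Td : T `^ delta = t by rewrite powRV_powR ?(ltW t0).
pose l k := (2 ^+ k * T)^-1.
have l0 k : 0 < l k by rewrite invr_gt0 mulr_gt0// exprn_gt0.
pose ck k := 4 * T `^ b * (2 ^+ k) `^ b.
have ck0 k : 0 <= ck k by rewrite !mulr_ge0 ?powR_ge0.
pose h k s := ck k * (1 - expR (- (s * l k))).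
have h0 k s : 0 < s -> 0 <= h k s.
  move=> s0; rewrite mulr_ge0// subr_ge0 -expR0 ler_expR oppr_le0.
  by rewrite mulr_ge0 ?(ltW s0)// ltW.
have mh k : measurable_fun setT (h k).
  apply: measurable_funM; first exact: measurable_cst.
  by apply: measurable_funB; [exact: measurable_cst|exact: mexp].
have Dpos s : D s -> 0 < s by rewrite /D/= in_itv/= andbT.
have pw s : 0 < s -> T < s -> exists k, s `^ b <= h k s.
  move=> s0 Ts; have u1 : 1 <= s / T by rewrite ler_pdivlMr// mul1r ltW.
  have [k /andP[k1 k2]] := dyadic_bracket _ u1; exists k.
  have sb : s `^ b <= 2 * (T `^ b * (2 ^+ k) `^ b).
    have -> : s = T * (s / T) by field; rewrite gt_eqF.
    rewrite powRM ?(ltW T0) ?(le_trans ler01 u1)// mulrCA ler_wpM2l ?powR_ge0//.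
    rewrite (le_trans (ler_powR2 b _ _ (ltW b0) (le_trans ler01 u1) (ltW k2)))//.
    by rewrite exprS powRM ?exprn_ge0// ler_wpM2r ?powR_ge0// ler1_powR ?(ltW b1)// ler1n.
  apply: (le_trans sb); rewrite /h /ck.
  have e : expR (- (s * l k)) <= 2^-1.
    apply: (le_trans _ expRN1_le_half); rewrite ler_expR lerN2.
    have k20 : 0 < 2 ^+ k :> R by rewrite exprn_gt0.
    rewrite /l ler_pdivlMr ?mulr_gt0// mul1r -ler_pdivlMr//.
  have z0 : 0 <= T `^ b * (2 ^+ k) `^ b by rewrite mulr_ge0 ?powR_ge0.
  by nra.
apply: (@le_trans _ _ (\int[lebesgue_measure]_(s in D) ((eta t s * T `^ b)%:E +
   \sum_(k <oo) (eta t s * h k s)%:E))%E).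
  apply: ge0_le_integralW => s Ds; have e0 := subordinator_ge0 t s t0 Ds.
    by rewrite lee_fin mulr_ge0 ?powR_ge0.
  have s0 := Dpos s Ds.
  have nn k : (0 <= (eta t s * h k s)%:E)%E by rewrite lee_fin mulr_ge0 ?h0.
  have [sT|Ts] := leP s T.
    rewrite -[leLHS]adde0 leeD//; last exact: nneseries_ge0.
    by rewrite lee_fin; apply: ler_wpM2l => //; exact: (ler_powR2 _ _ _ (ltW b0) (ltW s0) sT).
  have [k hk] := pw s s0 Ts.
  rewrite -[leLHS]add0e leeD//; first by rewrite lee_fin mulr_ge0 ?powR_ge0.
  apply: le_trans (nneseries_ge_term _ k nn).
  by rewrite lee_fin ler_wpM2l.
rewrite ge0_integralD//; first last.
- apply: ge0_emeasurable_sum => k.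
  + by move=> s Ds _; rewrite lee_fin mulr_ge0 ?subordinator_ge0// h0// Dpos.
  + by move=> _; exact: mM.
- by move=> s Ds; apply: nneseries_ge0 => k _ _;
    rewrite lee_fin mulr_ge0 ?subordinator_ge0// h0// Dpos.
- by apply: mM => //; exact: measurable_cst.
- by move=> s Ds; rewrite lee_fin mulr_ge0 ?powR_ge0 ?subordinator_ge0.
rewrite integral_nneseries//; first last.
- by move=> k s Ds; rewrite lee_fin mulr_ge0 ?subordinator_ge0// h0// Dpos.
- by move=> k; exact: mM.
rewrite mulrDl mul1r EFinD.
have Tb : T `^ b = t `^ (b / delta) by rewrite /T -powRrM mulrC.
apply: leeD.
  rewrite -/(average t (fun=> T `^ b)).
  have -> : (fun=> T `^ b) = (fun s => T `^ b * cst 1 s) by apply/funext => s; rewrite mulr1.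
  by rewrite averageZ ?powR_ge0// average1// mule1 Tb.
have q10 : 0 < 1 - q by rewrite subr_gt0.
have -> : 4 / (1 - q) * t `^ (b / delta) = 4 * T `^ b / (1 - q) by rewrite Tb; ring.
apply: le_trans (geometric_nneseries_le (4 * T `^ b) q _ (ltW q0) q1); last first.
  by rewrite mulr_ge0 ?powR_ge0.
apply: lee_nneseries => [k _ _|k _]; first by
  apply: integral_ge0 => s Ds; rewrite lee_fin mulr_ge0 ?subordinator_ge0// h0// Dpos.
rewrite -/(average t (h k)) averageZ//; first last.
- by move=> s s0; rewrite subr_ge0 -expR0 ler_expR oppr_le0 mulr_ge0 ?(ltW s0)// ltW.
- by apply: measurable_funB; [exact: measurable_cst|exact: mexp].
apply: (le_trans (lee_wpmul2l _ (average_compl_exp_le t (l k) t0 (l0 k)))).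
  by rewrite lee_fin.
have k20 : 0 < 2 ^+ k :> R by rewrite exprn_gt0.
rewrite -EFinM lee_fin /ck /l -powR_inv1 ?mulr_ge0 ?(ltW k20) ?(ltW T0)// -powRrM mulN1r.
rewrite powRM ?(ltW k20) ?(ltW T0)// [T `^ (- delta)]powRN Td.
have -> : q ^+ k = (2 ^+ k) `^ b * (2 ^+ k) `^ (- delta).
  rewrite -powRD; last by rewrite (gt_eqF k20) implybT.
  by rewrite -(@powR_mulrn R 2 k)// -powRrM mulrC powRrM powR_mulrn ?powR_ge0.
by rewrite le_eqVlt; apply/orP; left; apply/eqP; field; rewrite gt_eqF.
Qed.

(** With T = t^(1 / delta), the constant 1 is at most the indicator of the
    window plus exp (1 - s / (e T)) plus 2 (1 - exp (- s / (M T))), and the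
    averages of the last two functions are known from the Laplace
    transform. *)
Lemma average_window : exists e M, [/\ 0 < e, 0 < M & forall t, 0 < t ->
  ((2^-1)%:E <= average t (fun s =>
     (e * t `^ delta^-1 <= s <= M * t `^ delta^-1)%R%:R))%E].
Proof.
have half_bound (x : R) : x <= 2^-1 -> 1 <= 2 * (1 - x) by move=> ?; lra.
have sum_bound (x y : R) : x <= 4^-1 -> 1 - 8^-1 <= y -> 2^-1 + (x + 2 * (1 - y)) <= 1.
  by move=> ? ?; lra.
(* With these constants the two errors average to exp (1 - 4) and 2 (1 - exp
   (- 1 / 8)), both at most 1 / 4. *)
pose e := (4 : R) `^ (- delta^-1); pose M := (8 : R) `^ delta^-1.
have e0 : 0 < e by rewrite powR_gt0.
have M0 : 0 < M by rewrite powR_gt0.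
exists e, M; split => // t t0.
pose T := t `^ delta^-1.
have T0 : 0 < T by rewrite powR_gt0.
have Td : T `^ delta = t by rewrite powRV_powR ?(ltW t0).
pose w s : R := ((e * T <= s) && (s <= M * T))%:R.
have mw : measurable_fun setT w.
  rewrite (_ : w = \1_(`[e * T, M * T]%classic)); first exact: measurable_indic.
  by apply/funext => s; rewrite indicE mem_setE in_itv.
pose h1 s := expR 1 * expR (- (s * (e * T)^-1)).
pose h2 s := 2 * (1 - expR (- (s * (M * T)^-1))).
have mh1 : measurable_fun setT h1 by apply: measurable_funM; [exact: measurable_cst|exact: mexp].
have mh2 : measurable_fun setT h2.
  apply: measurable_funM; first exact: measurable_cst.
  by apply: measurable_funB; [exact: measurable_cst|exact: mexp].
have eT0 : 0 < (e * T)^-1 by rewrite invr_gt0 mulr_gt0.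
have MT0 : 0 < (M * T)^-1 by rewrite invr_gt0 mulr_gt0.
have h10 s : 0 < s -> 0 <= h1 s by move=> _; rewrite mulr_ge0 ?expR_ge0.
have h20 s : 0 < s -> 0 <= h2 s.
  move=> s0; rewrite mulr_ge0// subr_ge0 -expR0 ler_expR oppr_le0 mulr_ge0 ?ltW//.
have w0 s : 0 < s -> 0 <= w s by [].
have inv_powR : (e * T)^-1 `^ delta = 4 / t /\ (M * T)^-1 `^ delta = (8 * t)^-1.
  have iv a : 0 < a -> a^-1 `^ delta = (a `^ delta)^-1.
    by move=> a0; rewrite -(powR_inv1 (ltW a0)) -powRrM mulN1r powRN.
  have ed : e `^ delta = 4^-1.
    by rewrite /e -powRrM mulNr mulVf ?gt_eqF// powR_inv1.
  have Md : M `^ delta = 8 by rewrite /M powRV_powR.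
  by split; rewrite iv ?mulr_gt0// powRM ?ltW// Td ?ed ?Md// invfM invrK.
have : (1 <= average t w + (average t h1 + average t h2))%E.
  rewrite -(average1 t t0) -averageD// -averageD//; first last.
  - by move=> s s0; rewrite addr_ge0 ?h10 ?h20.
  - exact: measurable_funD.
  apply: average_le => // s s0; rewrite ler01/=.
  have := w0 s s0; have := h10 s s0; have := h20 s s0.
  have [se|es] := ltP s (e * T).
    suff le1 : 1 <= h1 s by move=> ? ? ?; rewrite /= ler_wpDl// ler_wpDr.
    rewrite /h1 -expRD -[leLHS]expR0 ler_expR subr_ge0.
    by rewrite ler_pdivrMr ?mulr_gt0// mul1r ltW.
  have [sM|Ms] := leP s (M * T).
    have -> : w s = 1 by rewrite /w es sM.
    by move=> ? ? _; rewrite /= lerDl addr_ge0.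
  suff le1 : expR (- (s * (M * T)^-1)) <= 2^-1.
    suff : 1 <= h2 s by move=> ? _ ? ?; rewrite /= ler_wpDl// ler_wpDl.
    exact: half_bound.
  apply: (le_trans _ expRN1_le_half); rewrite ler_expR lerN2.
  by rewrite ler_pdivlMr ?mulr_gt0// mul1r ltW.
rewrite averageZ//.
rewrite averageZ//; first last.
- by move=> s s0; have := h20 s s0; rewrite pmulr_rge0.
- by apply: measurable_funB; [exact: measurable_cst|exact: mexp].
rewrite average_exp// average_compl_exp//.
have [-> ->] := inv_powR.
have -> : t * (4 / t) = 4 by field; rewrite gt_eqF.
have -> : t * (8 * t)^-1 = 8^-1 by field; rewrite gt_eqF.
rewrite -!EFinM -EFinD => h.
set K := (expR 1 * expR (- 4) + _)%:E in h *.
have K_fin : K \is a fin_num by [].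
rewrite -(leeD2rE _ _ K_fin); apply: le_trans h; rewrite -EFinD lee_fin.
have := expR_ge1Dx (- 8^-1 : R).
have : expR 1 * expR (- 4) <= 4^-1 :> R.
  rewrite -expRD (_ : 1 - 4 = - 3) ?expRN; last by ring.
  by rewrite lef_pV2 ?posrE ?expR_gt0// (le_trans _ (expR_ge1Dx _))//; lra.
exact: sum_bound.
Qed.

End stable_subordinator.

(** * Korevaar-Schoen energies and heat energies *)

Lemma energy_ge0 {d} {T : measurableType d} {R : realType}
  (mu : {sigma_finite_measure set T -> \bar R}) (w : T * T -> R) (f : T -> R) :
  (forall z, 0 <= w z) -> (0 <= energy mu w f)%E.
Proof. by move=> w0; apply: integral_ge0 => z _; rewrite lee_fin mulr_ge0. Qed.

Lemma measurable_energy_integrand {d} {T : measurableType d} {R : realType}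
  (w : T * T -> R) (f : T -> R) :
  measurable_fun setT w -> measurable_fun setT f ->
  measurable_fun setT (fun z : T * T => (w z * `|f z.1 - f z.2|)%:E).
Proof.
move=> mw mf; apply/measurable_EFinP; apply: measurable_funM => //.
apply: (@measurableT_comp _ _ _ _ _ _ (@Num.Def.normr R R)) => //.
apply: measurable_funB.
  exact: (measurableT_comp mf measurable_fst).
exact: (measurableT_comp mf measurable_snd).
Qed.

Lemma energy_le {d} {T : measurableType d} {R : realType}
  (mu : {sigma_finite_measure set T -> \bar R}) (w w' : T * T -> R) (f : T -> R) :
  (forall z, 0 <= w z <= w' z) -> (energy mu w f <= energy mu w' f)%E.
Proof.
move=> ww'; apply: ge0_le_integralW => z _; have /andP[w0 w1] := ww' z.
  by rewrite lee_fin mulr_ge0.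
by rewrite lee_fin ler_wpM2r.
Qed.

Lemma energyZ {d} {T : measurableType d} {R : realType}
  (mu : {sigma_finite_measure set T -> \bar R}) c (w : T * T -> R) (f : T -> R) :
  0 <= c -> measurable_fun setT w -> (forall z, 0 <= w z) -> measurable_fun setT f ->
  energy mu (fun z => c * w z) f = (c%:E * energy mu w f)%E.
Proof.
move=> c0 mw w0 mf; rewrite /energy -ge0_integralZl_EFin//.
- by apply: eq_integral => z _; rewrite -EFinM mulrA.
- by move=> z _; rewrite lee_fin mulr_ge0.
- exact: measurable_energy_integrand.
Qed.

Lemma energyD {d} {T : measurableType d} {R : realType}
  (mu : {sigma_finite_measure set T -> \bar R}) (w w' : T * T -> R) (f : T -> R) :
  measurable_fun setT w -> (forall z, 0 <= w z) ->
  measurable_fun setT w' -> (forall z, 0 <= w' z) -> measurable_fun setT f ->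
  energy mu (fun z => w z + w' z) f = (energy mu w f + energy mu w' f)%E.
Proof.
move=> mw w0 mw' w0' mf; rewrite /energy -ge0_integralD//.
- by apply: eq_integral => z _; rewrite -EFinD mulrDl.
- by move=> z _; rewrite lee_fin mulr_ge0.
- exact: measurable_energy_integrand.
- by move=> z _; rewrite lee_fin mulr_ge0.
- exact: measurable_energy_integrand.
Qed.

Section scales.
Context {d : measure_display} {R : realType} {X : metricMeasurableType d R}.
Context (mu : {sigma_finite_measure set X -> \bar R}) (x0 : X).
Context (dH c1 c2 : R).
Hypotheses (hborel : is_borel X) (hA1 : proper_balls X).
Hypotheses (c10 : 0 < c1) (c20 : 0 < c2) (dH0 : 0 < dH).
Hypothesis hV : forall (x : X) (r : R), 0 <= r ->
    ((c1 * r `^ dH)%:E <= mu (ball x r))%E /\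
    (mu (ball x r) <= (c2 * r `^ dH)%:E)%E.
Implicit Types (f : X -> R) (r : R).

Definition near_diagonal r (z : X * X) : R := (mdist z.1 z.2 < r)%R%:R.

(** The Korevaar-Schoen energy without its normalisation. Ahlfors regularity
    makes the normalising factor comparable to r^(l + dH), uniformly in the
    centre. *)
Definition oscillation r f : \bar R := energy mu (near_diagonal r) f.

Lemma near_diagonal_ge0 r z : 0 <= near_diagonal r z.
Proof. by rewrite /near_diagonal. Qed.

Lemma measurable_near_diagonal r : measurable_fun setT (near_diagonal r).
Proof.
rewrite (_ : near_diagonal r = fun z => if mdist z.1 z.2 < r then 1 else 0).
  apply: measurable_fun_ifT => //.
  by apply: measurable_fun_ltr => //; exact: (measurable_mdist hborel hA1 x0).
by apply/funext => z; rewrite /near_diagonal; case: ifP.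
Qed.

Lemma fine_ball_bounds x r : 0 < r ->
  c1 * r `^ dH <= fine (mu (ball x r)) <= c2 * r `^ dH.
Proof.
move=> r0; have [h1 h2] := hV x r (ltW r0).
have fin : mu (ball x r) \is a fin_num.
  by rewrite ge0_fin_numE ?measure_ge0// (le_lt_trans h2)// ltry.
by rewrite -!lee_fin fineK// h1 h2.
Qed.

Lemma KS_energyE l f r : 0 < r -> KS_energy mu l 1 f r =
  (\int[mu]_x \int[mu]_y (near_diagonal r (x, y) * `|f x - f y| /
     (r `^ l * fine (mu (ball x r))))%:E)%E.
Proof.
move=> r0; apply: eq_integral => x _.
rewrite [LHS]integral_mkcond; apply: eq_integral => y _.
rewrite patchE /near_diagonal/= powRr1// mulr1.
case: (boolP (y \in (ball x r : set X))) => [/set_mem|/negP nxy].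
  by rewrite ballEmdist/= => ->; rewrite mul1r.
case: (ltP (mdist x y) r) => [xy|_]; last by rewrite !mul0r.
by exfalso; apply: nxy; apply/mem_set; rewrite ballEmdist.
Qed.

Lemma KS_energy_ge0 l f r : 0 < r -> (0 <= KS_energy mu l 1 f r)%E.
Proof.
move=> r0; rewrite KS_energyE//; apply: integral_ge0 => x _; apply: integral_ge0 => y _.
by rewrite lee_fin divr_ge0 ?mulr_ge0 ?near_diagonal_ge0 ?powR_ge0 ?fine_ge0.
Qed.

Let iterated_scale c f r : 0 <= c -> measurable_fun setT f ->
  (\int[mu]_x \int[mu]_y (c * (near_diagonal r (x, y) * `|f x - f y|))%:E =
   c%:E * oscillation r f)%E.
Proof.
move=> c0 mf; rewrite /oscillation -energyZ//; last exact: measurable_near_diagonal.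
rewrite /energy (fubini_tonelli1 (fun z => (c * near_diagonal r z * `|f z.1 - f z.2|)%:E)).
- by apply: eq_integral => x _; apply: eq_integral => y _; rewrite mulrA.
- apply: measurable_energy_integrand => //; apply: measurable_funM => //.
  exact: measurable_near_diagonal.
- by move=> z; rewrite lee_fin !mulr_ge0 ?near_diagonal_ge0.
Qed.

Lemma KS_energy_le_oscillation l f r : 0 < r -> measurable_fun setT f ->
  (KS_energy mu l 1 f r <= ((c1 * r `^ (l + dH))^-1)%:E * oscillation r f)%E.
Proof.
move=> r0 mf; have k0 : 0 < c1 * r `^ (l + dH) by rewrite mulr_gt0 ?powR_gt0.
rewrite KS_energyE// -iterated_scale ?invr_ge0 ?(ltW k0)//.
apply: ge0_le_integralW => x _.
  apply: integral_ge0 => y _.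
  by rewrite lee_fin divr_ge0 ?mulr_ge0 ?near_diagonal_ge0 ?powR_ge0 ?fine_ge0.
apply: ge0_le_integralW => y _.
  by rewrite lee_fin divr_ge0 ?mulr_ge0 ?near_diagonal_ge0 ?powR_ge0 ?fine_ge0.
have /andP[h _] := fine_ball_bounds x r r0.
have rl : 0 < r `^ l by rewrite powR_gt0.
have k1 : 0 < c1 * r `^ dH by rewrite mulr_gt0 ?powR_gt0.
rewrite lee_fin mulrC ler_wpM2r ?mulr_ge0 ?near_diagonal_ge0//.
rewrite lef_pV2 ?posrE ?mulr_gt0 ?(lt_le_trans k1 h)//; last exact: powR_gt0.
rewrite powRD; last by rewrite (gt_eqF r0) implybT.
by rewrite mulrCA ler_pM2l.
Qed.

Lemma oscillation_le_KS_energy l f r : 0 < r -> measurable_fun setT f ->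
  (oscillation r f <= (c2 * r `^ (l + dH))%:E * KS_energy mu l 1 f r)%E.
Proof.
move=> r0 mf; have k0 : 0 < c2 * r `^ (l + dH) by rewrite mulr_gt0 ?powR_gt0.
set k := c2 * _ in k0 *.
have -> : oscillation r f = (k%:E * (k^-1%:E * oscillation r f))%E.
  by rewrite muleA -EFinM divff ?mul1e// gt_eqF.
apply: lee_wpmul2l; first by rewrite lee_fin ltW.
rewrite KS_energyE// -iterated_scale ?invr_ge0 ?(ltW k0)// /k.
have pos x y : 0 <= near_diagonal r (x, y) * `|f x - f y|.
  by rewrite mulr_ge0 ?near_diagonal_ge0.
apply: ge0_le_integralW => x _.
  by apply: integral_ge0 => y _; rewrite lee_fin mulr_ge0// invr_ge0 ltW.
apply: ge0_le_integralW => y _; first by rewrite lee_fin mulr_ge0// invr_ge0 ltW.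
have /andP[h1 h2] := fine_ball_bounds x r r0.
have rl : 0 < r `^ l by rewrite powR_gt0.
have k1 : 0 < c1 * r `^ dH by rewrite mulr_gt0 ?powR_gt0.
rewrite lee_fin mulrC ler_wpM2l//.
rewrite lef_pV2 ?posrE ?mulr_gt0 ?(lt_le_trans k1 h1)//; last exact: powR_gt0.
rewrite powRD; last by rewrite (gt_eqF r0) implybT.
by rewrite [leRHS]mulrCA ler_pM2l.
Qed.

(** The triangle inequality and the upper volume bound; this settles the large
    scales. *)
Lemma oscillation_le_L1 f r : 0 < r -> mu.-integrable setT (EFin \o f) ->
  (oscillation r f <= (2 * c2 * r `^ dH)%:E * \int[mu]_x `|f x|%:E)%E.
Proof.
move=> r0 fi; have mf : measurable_fun setT f by apply/measurable_EFinP; exact: measurable_int fi.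
have mn := measurable_near_diagonal r.
have mnf (g : X * X -> X) : measurable_fun setT g ->
    measurable_fun setT (fun z => (near_diagonal r z * `|f (g z)|)%:E).
  move=> mg; apply/measurable_EFinP; apply: measurable_funM => //.
  apply: (@measurableT_comp _ _ _ _ _ _ (@Num.Def.normr R R)) => //;
    exact: (measurableT_comp mf mg).
have nn0 (g : X * X -> X) z : (0 <= (near_diagonal r z * `|f (g z)|)%:E)%E.
  by rewrite lee_fin mulr_ge0 ?near_diagonal_ge0.
pose I := (\int[mu \x mu]_z (near_diagonal r z * `|f z.1|)%:E)%E.
have I1 : (I <= (c2 * r `^ dH)%:E * \int[mu]_x `|f x|%:E)%E.
  rewrite /I (fubini_tonelli1 (fun z => (near_diagonal r z * `|f z.1|)%:E)); last 2 first.
  - by apply: mnf; exact: measurable_fst.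
  - exact: nn0.
  rewrite -ge0_integralZl_EFin//; last 2 first.
  - by apply/measurable_EFinP; exact: (@measurableT_comp _ _ _ _ _ _ (@Num.Def.normr R R)).
  - by rewrite mulr_ge0 ?powR_ge0// ltW.
  apply: ge0_le_integralW => x _; first by apply: integral_ge0 => y _; exact: (nn0 fst).
  rewrite /fubini_F/=.
  rewrite (_ : (\int[mu]_y _ = `|f x|%:E * mu (ball x r))%E).
    rewrite muleC; apply: lee_wpmul2r; first by rewrite lee_fin.
    by have [] := hV x r (ltW r0).
  rewrite -(@integral_cst_indic _ _ _ mu)//; last exact: measurable_ballX.
  apply: eq_integral => y _; rewrite mulrC; congr (_ * _)%:E.
  rewrite /near_diagonal indicE; congr (nat_of_bool _)%:R.
  by apply/idP/idP => [h|/set_mem]; [apply/mem_set|]; rewrite ballEmdist.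
have I2 : (\int[mu \x mu]_z (near_diagonal r z * `|f z.2|)%:E = I)%E.
  rewrite /I -[RHS](integral_swap mu (fun z => (near_diagonal r z * `|f z.1|)%:E)).
  - by apply: eq_integral => -[x y] _; rewrite /near_diagonal/= metric_sym.
  - by apply: mnf; exact: measurable_fst.
  - exact: nn0.
apply: (@le_trans _ _ (I + I)%E).
  rewrite -{2}I2 /I -ge0_integralD//; last 2 first.
  - by apply: mnf; exact: measurable_fst.
  - by apply: mnf; exact: measurable_snd.
  apply: ge0_le_integralW => z _; first by rewrite lee_fin mulr_ge0 ?near_diagonal_ge0.
  by rewrite -EFinD lee_fin -mulrDr ler_wpM2l ?near_diagonal_ge0// ler_normB.
apply: (le_trans (leeD I1 I1)); rewrite -mulrA (mulr_natl _ 2) mulr2n EFinD.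
have k0 : (0 <= (c2 * r `^ dH)%:E)%E by rewrite lee_fin mulr_ge0 ?powR_ge0// ltW.
by rewrite (@ge0_muleDl _ _ _ _ k0 k0).
Qed.

Context (p : R -> X -> X -> R) (dW kappa c3 c4 c5 c6 M : R).
Hypotheses (dW2 : 2 <= dW) (kappa0 : 0 < kappa) (kappa_dW : kappa < dW) (M0 : 0 <= M).
Hypotheses (c30 : 0 < c3) (c40 : 0 < c4) (c50 : 0 < c5) (c60 : 0 < c6).
Hypothesis kb : forall t x y, 0 < t ->
  sub_gaussian dH dW c5 c6 t (mdist x y) <= p t x y
    <= sub_gaussian dH dW c3 c4 t (mdist x y).
Hypothesis mp : forall t, 0 < t -> measurable_fun setT (fun z : X * X => p t z.1 z.2).
Implicit Types (t tau A : R) (x y : X).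

Let dW0 : 0 < dW. Proof. by rewrite (lt_le_trans _ dW2). Qed.
Let dW1 : 0 < dW - 1. Proof. by rewrite subr_gt0 (lt_le_trans _ dW2)// ltr1n. Qed.

Definition heat_energy t f : \bar R := energy mu (fun z => p t z.1 z.2) f.

Lemma kernel_pos t x y : 0 < t -> 0 <= p t x y.
Proof.
move=> t0; have /andP[h _] := kb t x y t0; apply: le_trans h.
by rewrite !mulr_ge0 ?powR_ge0 ?expR_ge0// ltW.
Qed.

Lemma heat_energy_ge0 t f : 0 < t -> (0 <= heat_energy t f)%E.
Proof. by move=> t0; apply: energy_ge0 => z; exact: kernel_pos. Qed.

(** At time r^dW the kernel is at least a multiple of r^(-dH) on pairs at
    distance less than r. *)
Lemma oscillation_le_heat_energy : exists2 C, 0 < C & forall f r, 0 < r ->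
  measurable_fun setT f -> (oscillation r f <= (C * r `^ dH)%:E * heat_energy (r `^ dW) f)%E.
Proof.
pose k := c5 * expR (- (c6 * (1 `^ dW) `^ (dW - 1)^-1)).
have k0 : 0 < k by rewrite mulr_gt0// expR_gt0.
exists k^-1; first by rewrite invr_gt0.
move=> f r r0 mf; have t0 : 0 < r `^ dW by rewrite powR_gt0.
have rd0 : 0 < r `^ dH by rewrite powR_gt0.
rewrite -energyZ//; first last.
- by move=> z; exact: kernel_pos.
- exact: mp.
- by rewrite mulr_ge0 ?(ltW rd0)// invr_ge0 ltW.
apply: energy_le => -[x y]; rewrite near_diagonal_ge0/= /near_diagonal/=.
case: (ltP (mdist x y) r) => [xy|_] /=; last first.
  by rewrite !mulr_ge0 ?kernel_pos ?(ltW rd0)// invr_ge0 ltW.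
have /andP[h _] := kb _ x y t0.
have h2 := sub_gaussian_near_diagonal dH dW c5 c6 (r `^ dW) (mdist x y) 1
  ltac:(by rewrite -subr_gt0) (ltW c50) (ltW c60) t0 (mdist_ge0 _ _) ler01
  ltac:(by rewrite mul1r powR_powRV ?(ltW r0)// ltW).
have h3 := le_trans h2 h.
have e : (r `^ dW) `^ (- (dH / dW)) = (r `^ dH)^-1.
  by rewrite -powRrM -powRN; congr (_ `^ _); field; rewrite gt_eqF.
rewrite e mulrAC -/k in h3.
have -> : true%:R = k^-1 * r `^ dH * (k * (r `^ dH)^-1) :> R.
  by rewrite [LHS]mulr1n; field; rewrite !gt_eqF.
by rewrite ler_wpM2l// mulr_ge0 ?(ltW rd0)// invr_ge0 ltW.
Qed.

(** Put u = (d^dW / tau)^(1 / (dW - 1)), so that d^kappa is tau^(kappa / dW)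
    times a power of u and u >= A. Half of the exponential decay exp (- c4 u)
    absorbs this power together with one more factor u, which yields the gain
    1 / A. The other half is the decay of the lower bound of the kernel at
    time m tau. *)
Lemma kernel_tail : exists m C, [/\ 0 < m, 0 < C & forall A tau x y, 1 <= A -> 0 < tau ->
   A * tau `^ dW^-1 <= mdist x y ->
   p tau x y * mdist x y `^ kappa <=
     C / A * tau `^ (kappa / dW) * p (m * tau) x y].
Proof.
(* For this m the lower bound at time m tau decays like exp (- (c4 / 2) u). *)
pose m := (2 * c6 / c4) `^ (dW - 1); pose a := (dW - 1) * (kappa / dW).
have c64 : 0 < 2 * c6 / c4 by rewrite divr_gt0 ?mulr_gt0.
have m0 : 0 < m by rewrite powR_gt0.
have a0 : 0 < a by rewrite mulr_gt0// divr_gt0.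
pose Ca := ((a + 1) / (c4 / 2)) `^ (a + 1).
have Ca0 : 0 < Ca by rewrite powR_gt0// !divr_gt0// addr_gt0.
have mH0 : 0 < m `^ (dH / dW) by rewrite powR_gt0.
exists m, (c3 * Ca * m `^ (dH / dW) / c5); split => //.
  by rewrite divr_gt0// !mulr_gt0.
move=> A tau x y A1 tau0 Ad; set dd := mdist x y in Ad *.
have A0 : 0 < A by rewrite (lt_le_trans ltr01).
have dd0 : 0 <= dd by exact: mdist_ge0.
pose q := dd `^ dW / tau; pose u := q `^ (dW - 1)^-1.
have q0 : 0 <= q by rewrite divr_ge0 ?powR_ge0// ltW.
have Aq : A `^ dW <= q.
  rewrite ler_pdivlMr//.
  have h := ler_powR2 dW (A * tau `^ dW^-1) dd (ltW dW0) ltac:(by rewrite mulr_ge0 ?powR_ge0 ?(ltW A0)) Ad.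
  by rewrite powRM ?powR_ge0 ?(ltW A0)// powRV_powR ?(ltW tau0) in h.
have Au : A <= u.
  have h := ler_powR2 (dW - 1)^-1 (A `^ dW) q ltac:(by rewrite invr_ge0 ltW) (powR_ge0 _ _) Aq.
  apply: le_trans h; rewrite -powRrM le1r_powR// ler_pdivlMr// mul1r.
  by rewrite lerBlDr lerDl.
have u0 : 0 < u by rewrite (lt_le_trans A0).
have ddk : dd `^ kappa = tau `^ (kappa / dW) * u `^ a.
  have -> : u `^ a = q `^ (kappa / dW).
    by rewrite /u -powRrM /a mulrA mulVf ?mul1r// gt_eqF.
  rewrite -powRM ?(ltW tau0)// /q mulrC divfK ?gt_eqF// -powRrM.
  by congr (_ `^ _); field; rewrite gt_eqF.
have ua : u `^ a <= Ca / A * expR (c4 / 2 * u).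
  have h := powR_le_expR (a + 1) (c4 / 2) u ltac:(by rewrite addr_gt0)
    ltac:(by rewrite divr_gt0) (ltW u0).
  have -> : u `^ a = u `^ (a + 1) / u.
    by rewrite powRD ?(gt_eqF u0) ?implybT// powRr1 ?(ltW u0)// mulfK// gt_eqF.
  rewrite ler_pdivrMr// (le_trans h)// -/Ca [leRHS]mulrAC; apply: ler_wpM2r.
    exact: expR_ge0.
  by rewrite mulrAC ler_pdivlMr// ler_wpM2l ?(ltW Ca0).
have /andP[_ up] := kb tau x y tau0.
have mt0 : 0 < m * tau by rewrite mulr_gt0.
have /andP[lo _] := kb (m * tau) x y mt0.
rewrite /sub_gaussian -/dd -/q -/u in up.
have lo' : c5 * (m * tau) `^ (- (dH / dW)) * expR (- (c4 / 2 * u)) <= p (m * tau) x y.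
  apply: le_trans lo; rewrite /sub_gaussian -/dd.
  have -> : dd `^ dW / (m * tau) = q * m^-1 by rewrite /q invfM; ring.
  rewrite [(q * m^-1) `^ _]powRM ?invr_ge0 ?(ltW m0)// -/u.
  have -> : m^-1 `^ (dW - 1)^-1 = (2 * c6 / c4)^-1.
    rewrite -(powR_inv1 (ltW m0)) -powRrM mulN1r powRN /m.
    by rewrite powR_powRV// ltW.
  have -> : c6 * (u * (2 * c6 / c4)^-1) = c4 / 2 * u by field; rewrite !gt_eqF.
  by [].
have tk0 : 0 < tau `^ (kappa / dW) by rewrite powR_gt0.
have tH0 : 0 < tau `^ (- (dH / dW)) by rewrite powR_gt0.
apply: (@le_trans _ _ (c3 * tau `^ (- (dH / dW)) * expR (- (c4 * u)) *
   (tau `^ (kappa / dW) * (Ca / A * expR (c4 / 2 * u))))).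
  rewrite ddk; apply: ler_pM => //; first exact: kernel_pos.
    by rewrite mulr_ge0 ?powR_ge0.
  by rewrite ler_wpM2l// ltW.
apply: (@le_trans _ _ (c3 * Ca * m `^ (dH / dW) / c5 / A * tau `^ (kappa / dW) *
   (c5 * (m * tau) `^ (- (dH / dW)) * expR (- (c4 / 2 * u))))); last first.
  by rewrite ler_wpM2l// mulr_ge0 ?(ltW tk0)// !mulr_ge0 ?invr_ge0 ?(ltW c30)
    ?(ltW Ca0) ?(ltW mH0) ?(ltW c50) ?(ltW A0).
have -> : expR (- (c4 * u)) = expR (- (c4 / 2 * u)) * expR (- (c4 / 2 * u)).
  by rewrite -expRD; congr expR; field.
have e1 : expR (- (c4 / 2 * u)) * expR (c4 / 2 * u) = 1 by rewrite -expRD addNr expR0.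
rewrite powRM ?(ltW m0) ?(ltW tau0)// [m `^ (- _)]powRN.
set E := expR (- (c4 / 2 * u)) in e1 *; set E' := expR (c4 / 2 * u) in e1 *.
rewrite le_eqVlt; apply/orP; left; apply/eqP.
have -> : E' = E^-1.
  by apply: (mulfI (lt0r_neq0 (expR_gt0 (- (c4 / 2 * u)))));
    rewrite e1 divff// lt0r_neq0// expR_gt0.
field.
by rewrite !gt_eqF ?expR_gt0.
Qed.

Hypothesis energy_iter : forall f n t, 0 < t -> mu.-integrable setT (EFin \o f) ->
  (heat_energy (n.+1%:R * t)%R f <= heat_energy t f +
    (M * \sum_(k < n) (k.+1%:R * t) `^ (- (kappa / dW)))%:E *
      energy mu (fun z => (p t z.1 z.2 * mdist z.1 z.2 `^ kappa)%R) f)%E.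

Let theta := 1 - kappa / dW.

Let theta0 : 0 < theta.
Proof. by rewrite subr_gt0 ltr_pdivrMr// mul1r. Qed.

Let kd01 : 0 < kappa / dW < 1.
Proof. by rewrite divr_gt0//= ltr_pdivrMr// mul1r. Qed.

Lemma sum_times_le (n : nat) tau : 0 < tau ->
  \sum_(k < n) (k.+1%:R * tau) `^ (- (kappa / dW)) * tau <=
    (n.+1%:R * tau) `^ theta / theta.
Proof.
move=> tau0; rewrite -mulr_suml.
have -> : \sum_(k < n) (k.+1%:R * tau) `^ (- (kappa / dW)) =
    tau `^ (- (kappa / dW)) * \sum_(k < n) k.+1%:R `^ (- (kappa / dW)).
  rewrite mulr_sumr; apply: eq_bigr => k _.
  by rewrite powRM ?ler0n ?(ltW tau0)// mulrC.
have h := sum_powRN_le (kappa / dW) n kd01.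
have e : tau `^ (- (kappa / dW)) * tau = tau `^ theta.
  rewrite -{2}(powRr1 (ltW tau0)) -powRD ?(gt_eqF tau0) ?implybT//.
  by congr (_ `^ _); rewrite /theta; ring.
rewrite mulrAC e powRM ?ler0n ?(ltW tau0)//.
rewrite [n.+1%:R `^ theta * _]mulrC -mulrA ler_wpM2l ?powR_ge0// (le_trans h)//.
rewrite ler_wpM2r ?invr_ge0 ?(ltW theta0)//.
by rewrite ler_powR2 ?(ltW theta0)// ler_nat.
Qed.

(** Below the distance A tau^(1 / dW) the kernel is bounded by its value on
    the diagonal and the pair counts in the oscillation at scale r; above it
    [kernel_tail] applies. *)
Lemma energy_weighted_le m C A tau r f : 0 < m -> 0 < C -> 1 <= A -> 0 < tau -> 0 < r ->
  (forall A tau x y, 1 <= A -> 0 < tau ->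
   A * tau `^ dW^-1 <= mdist x y ->
   p tau x y * mdist x y `^ kappa <=
     C / A * tau `^ (kappa / dW) * p (m * tau) x y) ->
  A * tau `^ dW^-1 <= r -> measurable_fun setT f ->
  (energy mu (fun z => (p tau z.1 z.2 * mdist z.1 z.2 `^ kappa)%R) f <=
   (c3 * tau `^ (- (dH / dW)) * (A * tau `^ dW^-1) `^ kappa)%:E * oscillation r f +
   (C / A * tau `^ (kappa / dW))%:E * heat_energy (m * tau)%R f)%E.
Proof.
move=> m0 C0 A1 tau0 r0 tail Ar mf.
have A0 : 0 < A by rewrite (lt_le_trans ltr01).
have mt0 : 0 < m * tau by rewrite mulr_gt0.
set a1 := c3 * _ * _; set a2 := C / A * _.
have a10 : 0 <= a1 by rewrite !mulr_ge0 ?powR_ge0// ltW.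
have a20 : 0 <= a2 by rewrite mulr_ge0 ?powR_ge0// divr_ge0 ?ltW.
have mk := mp _ mt0; have mn := measurable_near_diagonal r.
have k0 z : 0 <= p (m * tau) z.1 z.2 by exact: kernel_pos.
have n0 z := near_diagonal_ge0 r z.
rewrite /oscillation /heat_energy -(energyZ mu a1 _ f a10 mn n0 mf) -(energyZ mu a2 _ f a20 mk k0 mf).
rewrite -energyD//; first last.
- by move=> z; rewrite mulr_ge0.
- by apply: measurable_funM => //; exact: measurable_cst.
- by move=> z; rewrite mulr_ge0.
- by apply: measurable_funM => //; exact: measurable_cst.
apply: energy_le => -[x y] /=; rewrite mulr_ge0 ?kernel_pos ?powR_ge0//=.
have [xy|xy] := leP (A * tau `^ dW^-1) (mdist x y).
  rewrite (le_trans (tail A tau x y A1 tau0 xy))// lerDr mulr_ge0// near_diagonal_ge0.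
have -> : near_diagonal r (x, y) = 1 by rewrite /near_diagonal/= (lt_le_trans xy Ar).
rewrite mulr1; apply: (@le_trans _ _ a1); last by rewrite lerDl mulr_ge0 ?kernel_pos.
rewrite /a1; apply: ler_pM; [exact: kernel_pos|exact: powR_ge0| |].
  have /andP[_ h] := kb tau x y tau0; apply: (le_trans h).
  rewrite -[leRHS]mulr1 ler_wpM2l ?mulr_ge0 ?powR_ge0 ?(ltW c30)//.
  by rewrite -expR0 ler_expR oppr_le0 mulr_ge0 ?powR_ge0// ltW.
by rewrite ler_powR2 ?(ltW kappa0) ?mdist_ge0// ltW.
Qed.

(** [energy_iterate] is applied with the step tau = t / (n + 1) comparable to
    (r / A)^dW. The sum of the weights (k tau)^(- kappa / dW) is of order
    t^theta / tau, which compensates for the factor tau in both parts of the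
    weighted energy: the near part gives the Korevaar-Schoen energy at scale
    r, and the tail, estimated by K, is at most t^theta K / 2 once A is
    large. *)
Lemma absorption : exists A C, [/\ 0 < A, 0 < C & forall f K t r,
  mu.-integrable setT (EFin \o f) -> 0 <= K ->
  (forall s, 0 < s -> (heat_energy s f <= (K * s `^ theta)%:E)%E) ->
  0 < t -> 0 < r -> (r / A) `^ dW <= t ->
  (heat_energy t f <= (K * (r / A) `^ (dW * theta))%:E +
    (t `^ theta)%:E * (C%:E * KS_energy mu (dW - kappa) 1 f r + (K / 2)%:E))%E].
Proof.
have [m [C2 [m0 C20 tail]]] := kernel_tail.
pose B := M / theta; have B0 : 0 <= B by rewrite divr_ge0// ltW.
have mt0 : 0 < m `^ theta by rewrite powR_gt0.
(* Large enough for the tail, whose coefficient is B C2 m^theta / A, to cost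
   at most K / 2. *)
pose A := 1 + 2 * B * C2 * m `^ theta.
have A1 : 1 <= A by rewrite lerDl !mulr_ge0 ?invr_ge0 ?(ltW theta0) ?(ltW C20) ?(ltW mt0).
have A0 : 0 < A by rewrite (lt_le_trans ltr01).
pose e := (dW - kappa) + dH.
pose CA := c3 * c2 * A `^ kappa * A `^ e * 2 `^ (e / dW).
have CA0 : 0 < CA by rewrite !mulr_gt0 ?powR_gt0.
exists A, (B * CA + 1); split => //.
  by rewrite ltr_wpDl// mulr_ge0// ltW.
move=> f K t r fi K0 hK t0 r0 rt.
have mf : measurable_fun setT f by apply/measurable_EFinP; exact: measurable_int fi.
pose rho := (r / A) `^ dW.
have rA0 : 0 < r / A by rewrite divr_gt0.
have rho0 : 0 < rho by rewrite powR_gt0.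
have [n nt1 nt2] : exists2 n : nat, t / rho <= n.+1%:R & n.+1%:R <= 2 * (t / rho).
  have tr1 : 1 <= t / rho by rewrite ler_pdivlMr// mul1r.
  exists (Num.truncn (t / rho)).
    by rewrite ltW// truncnS_gt.
  rewrite -natr1 mulr_natl mulr2n lerD// truncn_le// (le_trans ler01 tr1).
  by [].
have N0 : 0 < n.+1%:R :> R by rewrite ltr0n.
pose tau := t / n.+1%:R.
have tau0 : 0 < tau by rewrite divr_gt0.
have Ntau : n.+1%:R * tau = t by rewrite mulrC divfK// gt_eqF.
have tau_rho : tau <= rho.
  by rewrite ler_pdivrMr// mulrC -ler_pdivrMr.
have rho_tau : rho <= 2 * tau.
  rewrite /tau mulrA ler_pdivlMr// mulrC -ler_pdivlMr//.
  by rewrite -mulrA.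
have rE : A * rho `^ dW^-1 = r.
  by rewrite /rho powR_powRV ?(ltW rA0)// mulrC divfK// gt_eqF.
have Ar : A * tau `^ dW^-1 <= r.
  by rewrite -rE ler_wpM2l ?(ltW A0)// ler_powR2 ?invr_ge0 ?(ltW dW0) ?(ltW tau0).
have KS0 := KS_energy_ge0 (dW - kappa) f r r0.
have := energy_iter f n tau tau0 fi; rewrite Ntau => /le_trans; apply.
have mtau0 : 0 < m * tau by rewrite mulr_gt0.
have E := energy_weighted_le m C2 A tau r f m0 C20 A1 tau0 r0 tail Ar mf.
set S := \sum_(k < n) _ in E *.
have S0 : 0 <= S by apply: sumr_ge0 => k _; rewrite powR_ge0.
have St : M * S * tau <= B * t `^ theta.
  have h := sum_times_le n tau tau0; rewrite -mulr_suml -/S Ntau in h.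
  have -> : B * t `^ theta = M * (t `^ theta / theta) by rewrite /B; ring.
  by rewrite -mulrA ler_wpM2l.
have rpow : r `^ e <= A `^ e * (2 `^ (e / dW) * tau `^ (e / dW)).
  have e0 : 0 <= e by rewrite addr_ge0 ?(ltW dH0)// subr_ge0 ltW.
  rewrite -rE powRM ?(ltW A0) ?powR_ge0// ler_wpM2l ?powR_ge0//.
  rewrite -powRrM mulrC -powRM ?(ltW tau0)//.
  by rewrite ler_powR2 ?divr_ge0 ?(ltW dW0) ?(ltW rho0).
have kd : tau `^ (- (dH / dW)) * tau `^ (kappa / dW) * tau `^ (e / dW) = tau.
  rewrite -!powRD ?(gt_eqF tau0) ?implybT// -[RHS](powRr1 (ltW tau0)).
  by congr (_ `^ _); rewrite /e; field; rewrite gt_eqF.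
have Atau : (A * tau `^ dW^-1) `^ kappa = A `^ kappa * tau `^ (kappa / dW).
  by rewrite powRM ?(ltW A0) ?powR_ge0// -powRrM (mulrC dW^-1).
have first_part : ((c3 * tau `^ (- (dH / dW)) * (A * tau `^ dW^-1) `^ kappa)%:E *
    oscillation r f <= (CA * tau)%:E * KS_energy mu (dW - kappa) 1 f r)%E.
  have h := oscillation_le_KS_energy (dW - kappa) f r r0 mf.
  apply: (le_trans (lee_wpmul2l _ h)); first by
    rewrite lee_fin !mulr_ge0 ?powR_ge0 ?(ltW c30).
  rewrite muleA -EFinM; apply: lee_wpmul2r => //; rewrite lee_fin -/e Atau.
  rewrite -[X in _ <= CA * X]kd /CA.
  set x1 := tau `^ _; set x2 := tau `^ _; set x3 := tau `^ _ in rpow *.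
  have -> : c3 * c2 * A `^ kappa * A `^ e * 2 `^ (e / dW) * (x1 * x2 * x3) =
    c3 * x1 * (A `^ kappa * x2) * (c2 * (A `^ e * (2 `^ (e / dW) * x3))) by ring.
  by rewrite ler_wpM2l ?ler_wpM2l// ?(ltW c20)// !mulr_ge0 ?powR_ge0 ?(ltW c30).
have second_part : ((C2 / A * tau `^ (kappa / dW))%:E * heat_energy (m * tau)%R f <=
    (C2 / A * m `^ theta * K * tau)%:E)%E.
  have a0 : 0 <= C2 / A * tau `^ (kappa / dW) by rewrite mulr_ge0 ?powR_ge0// divr_ge0 ?ltW.
  apply: (le_trans (lee_wpmul2l _ (hK _ mtau0))); first by rewrite lee_fin.
  rewrite -EFinM lee_fin [(m * tau) `^ _]powRM ?(ltW m0) ?(ltW tau0)//.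
  have e1 : tau `^ (kappa / dW) * tau `^ theta = tau.
    rewrite -powRD ?(gt_eqF tau0) ?implybT// -[RHS](powRr1 (ltW tau0)).
    by congr (_ `^ _); rewrite /theta; ring.
  rewrite le_eqVlt; apply/orP; left; apply/eqP.
  by rewrite -[in RHS]e1; ring.
apply: leeD.
  apply: (le_trans (hK tau tau0)); rewrite lee_fin ler_wpM2l//.
  by rewrite powRrM ler_powR2 ?(ltW theta0) ?(ltW tau0).
have MS0 : 0 <= M * S by rewrite mulr_ge0.
have z0 : 0 <= C2 / A * m `^ theta * K.
  by rewrite !mulr_ge0 ?(ltW mt0) ?invr_ge0 ?(ltW C20) ?(ltW A0).
have AK : B * C2 * m `^ theta / A <= 2^-1.
  by rewrite ler_pdivrMr// /A; lra.
apply: (@le_trans _ _ ((M * S)%:E * ((CA * tau)%:E * KS_energy mu (dW - kappa) 1 f r +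
   (C2 / A * m `^ theta * K * tau)%:E))%E).
  apply: lee_wpmul2l; first by rewrite lee_fin.
  by apply: (le_trans E); exact: (leeD first_part second_part).
rewrite ge0_muleDr//; last 2 first.
- by rewrite mule_ge0// lee_fin mulr_ge0 ?ltW.
- by rewrite lee_fin (mulr_ge0 z0 (ltW tau0)).
have p1 : (0 <= (B * CA + 1)%:E * KS_energy mu (dW - kappa) 1 f r)%E.
  by apply: mule_ge0 => //; rewrite lee_fin addr_ge0// (mulr_ge0 B0 (ltW CA0)).
have p2 : (0 <= (K / 2)%:E)%E by rewrite lee_fin divr_ge0.
rewrite (@ge0_muleDr _ _ _ _ p1 p2).
rewrite !muleA -!EFinM; apply: leeD.
  apply: lee_wpmul2r => //; rewrite lee_fin.
  have -> : M * S * (CA * tau) = M * S * tau * CA by ring.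
  apply: (@le_trans _ _ (B * t `^ theta * CA)); first by rewrite ler_wpM2r// ltW.
  rewrite mulrDr mulr1 ler_wpDr ?powR_ge0//.
  by rewrite le_eqVlt; apply/orP; left; apply/eqP; ring.
rewrite lee_fin.
have -> : M * S * (C2 / A * m `^ theta * K * tau) = M * S * tau * (C2 / A * m `^ theta * K).
  by ring.
apply: (@le_trans _ _ (B * t `^ theta * (C2 / A * m `^ theta * K))).
  by rewrite ler_wpM2r.
have -> : B * t `^ theta * (C2 / A * m `^ theta * K) =
  t `^ theta * (K * (B * C2 * m `^ theta / A)) by field; rewrite gt_eqF.
by rewrite ler_wpM2l ?powR_ge0// ler_wpM2l.
Qed.

(** A scale at which the energy is close to the lower limit can be chosen as
    small as needed. *)
Lemma near0_Var_lt f v (Q : R -> Prop) : (Var mu dW kappa f < v%:E)%E ->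
  (\forall r \near 0^'+, Q r) ->
  exists r, [/\ 0 < r, Q r & (KS_energy mu (dW - kappa) 1 f r < v%:E)%E].
Proof.
move=> Vv nQ; rewrite /Var limf_einfE in Vv.
have nV : \forall r \near 0^'+, 0 < r /\ Q r.
  near=> r; split; first by near: r; exact: nbhs_right_gt.
  by near: r.
pose S := [set r | 0 < r /\ Q r].
have : (ereal_inf (KS_energy mu (dW - kappa) 1 f @` S) < v%:E)%E.
  by apply: le_lt_trans Vv; apply: ereal_sup_ubound; exists S.
move=> /ereal_inf_lt[_ [r [r0 Qr] <-] h].
by exists r.
Unshelve. all: by end_near. Qed.

(** For v > Var f, letting r tend to 0 in [absorption] along scales of energy
    less than v improves a constant K into C v + K / 2. Iterating drives the
    constant to 2 C v, and then v tends to Var f. *)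
Lemma heat_energy_le_Var : exists2 C, 0 < C & forall f K,
  mu.-integrable setT (EFin \o f) -> 0 <= K ->
  (forall s, 0 < s -> (heat_energy s f <= (K * s `^ theta)%:E)%E) ->
  forall t, 0 < t -> (heat_energy t f <= (C * t `^ theta)%:E * Var mu dW kappa f)%E.
Proof.
have [A [C [A0 C0 absorb]]] := absorption.
exists (2 * C); first by rewrite mulr_gt0.
move=> f K fi K0 hK.
have improve v L : (Var mu dW kappa f < v%:E)%E -> 0 <= L ->
    (forall s, 0 < s -> (heat_energy s f <= (L * s `^ theta)%:E)%E) ->
    forall s, 0 < s -> (heat_energy s f <= ((C * v + L / 2) * s `^ theta)%:E)%E.
  move=> Vv L0 hL t t0; apply/lee_addgt0Pr => e e0.
  (* Below the scale A e' the first term of [absorption] is at most e. *)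
  pose e' := (e / (L + 1)) `^ (dW * theta)^-1.
  have dt0 : 0 < dW * theta by rewrite mulr_gt0.
  have e'0 : 0 < e' by rewrite powR_gt0// divr_gt0// ltr_wpDl.
  have nr : \forall r \near 0^'+, r < A * t `^ dW^-1 /\ r < A * e'.
    near=> r; split; near: r; apply: nbhs_right_lt; first by rewrite mulr_gt0 ?powR_gt0.
    by rewrite mulr_gt0.
  have [r [r0 [rt re] KSv]] := near0_Var_lt f v _ Vv nr.
  have rA0 : 0 <= r / A by rewrite divr_ge0 ?ltW.
  have h1 : (r / A) `^ dW <= t.
    rewrite -[leRHS](powRV_powR dW t (ltW t0) dW0) ler_powR2 ?(ltW dW0)//.
    by rewrite ler_pdivrMr// mulrC ltW.
  have h2 : L * (r / A) `^ (dW * theta) <= e.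
    have h : (r / A) `^ (dW * theta) <= e / (L + 1).
      have eL : 0 <= e / (L + 1) by rewrite divr_ge0 ?addr_ge0 ?(ltW e0).
      rewrite -[leRHS](powRV_powR (dW * theta) _ eL dt0).
      by rewrite ler_powR2 ?(ltW dt0)// ler_pdivrMr// mulrC ltW.
    apply: (le_trans (ler_wpM2l L0 h)); rewrite mulrA ler_pdivrMr ?ltr_wpDl//.
    by rewrite mulrDr mulr1 mulrC lerDl ltW.
  apply: (le_trans (absorb f L t r fi L0 hL t0 r0 h1)).
  rewrite addeC; apply: leeD; last by rewrite lee_fin.
  rewrite [X in (_ <= X%:E)%E]mulrC [X in (_ <= X)%E]EFinM; apply: lee_wpmul2l;
    first by rewrite lee_fin powR_ge0.
  rewrite EFinD; apply: leeD => //; rewrite [X in (_ <= X)%E]EFinM; apply: lee_wpmul2l;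
    first by rewrite lee_fin ltW.
  exact: ltW.
have Vfin v : (Var mu dW kappa f < v%:E)%E -> 0 <= v.
  move=> Vv; have [r [r0 _ KSv]] := near0_Var_lt f v (fun=> True) Vv ltac:(by apply: nearW).
  by rewrite -lee_fin (le_trans (KS_energy_ge0 (dW - kappa) f r r0))// ltW.
have bound v : (Var mu dW kappa f < v%:E)%E -> forall t, 0 < t ->
    (heat_energy t f <= (2 * C * v * t `^ theta)%:E)%E.
  move=> Vv t t0; have v0 := Vfin v Vv.
  have iterK n : forall s, 0 < s -> (heat_energy s f <= ((2 * C * v + K / 2 ^+ n) * s `^ theta)%:E)%E.
    elim: n => [|n ih] s s0.
      apply: (le_trans (hK s s0)); rewrite lee_fin ler_wpM2r ?powR_ge0// expr0 divr1.
      by rewrite lerDr !mulr_ge0// ltW.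
    have K'0 : 0 <= 2 * C * v + K / 2 ^+ n.
      by rewrite addr_ge0 ?divr_ge0 ?exprn_ge0// !mulr_ge0// ltW.
    have := improve v _ Vv K'0 ih s s0.
    congr ((_ <= _)%E); congr ((_ * _)%:E).
    by rewrite exprS; field; rewrite expf_neq0.
  apply/lee_addgt0Pr => e e0.
  pose Kt := K * t `^ theta.
  have Kt0 : 0 <= Kt by rewrite mulr_ge0 ?powR_ge0.
  have [n hn] : exists n : nat, Kt / 2 ^+ n <= e.
    exists (Num.bound (Kt / e)).
    rewrite ler_pdivrMr ?exprn_gt0// mulrC -ler_pdivrMr//.
    rewrite (le_trans (ltW (archi_boundP _)))// ?divr_ge0 ?(ltW e0)//.
    by rewrite -natrX ler_nat ltnW// ltn_expl.
  apply: (le_trans (iterK n t t0)); rewrite -EFinD lee_fin mulrDl lerD2l.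
  by rewrite mulrAC -/Kt.
move=> t t0; have tt0 : 0 < t `^ theta by rewrite powR_gt0.
have Ct0 : 0 < 2 * C * t `^ theta by rewrite !mulr_gt0.
case: (Var mu dW kappa f) bound Vfin => [v||] bound Vfin; last first.
- by have := Vfin (- 1) (ltNyr _); rewrite lerNr oppr0 ler10.
- by rewrite gt0_muley ?lte_fin// leey.
rewrite -EFinM; apply/lee_addgt0Pr => e e0.
have ve : (v%:E < (v + e / (2 * C * t `^ theta))%:E)%E by rewrite lte_fin ltrDl divr_gt0.
apply: (le_trans (bound _ ve t t0)); rewrite -EFinD lee_fin le_eqVlt; apply/orP; left.
by apply/eqP; field; rewrite !gt_eqF.
Unshelve. all: by end_near. Qed.

(** The exponential decay beats every power of the distance, hence the
    arbitrary N; k is the dyadic annulus that contains the pair. *)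
Lemma kernel_le_dyadic N : 0 < N -> exists2 C, 0 < C &
  forall t x y, 0 < t -> exists k : nat,
    p t x y <= C * t `^ (- (dH / dW)) * (2 ^+ k) `^ (- N) *
      near_diagonal (2 ^+ k * t `^ dW^-1) (x, y).
Proof.
move=> N0; pose b := (dW - 1)^-1; have b0 : 0 < b by rewrite invr_gt0.
pose C1 := (N / c4) `^ N.
have C10 : 0 < C1 by rewrite powR_gt0// divr_gt0.
have two0 : 0 < (2 : R) `^ N by rewrite powR_gt0.
exists (c3 * (2 `^ N * C1 + 1)).
  by rewrite mulr_gt0// ltr_wpDl// mulr_ge0 ?ltW.
move=> t x y t0; have /andP[_ up] := kb t x y t0.
set dd := mdist x y in up *; have dd0 : 0 <= dd by exact: mdist_ge0.
pose T := t `^ dW^-1; have T0 : 0 < T by rewrite powR_gt0.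
have tH0 : 0 < t `^ (- (dH / dW)) by rewrite powR_gt0.
have [dT|dT] := ltP dd T.
  exists 0%N; rewrite expr0 mul1r powR1 mulr1.
  have -> : near_diagonal T (x, y) = 1 by rewrite /near_diagonal/= -/dd dT.
  rewrite mulr1 (le_trans up)// /sub_gaussian.
  rewrite -[leRHS]mulr1 ler_pM ?expR_ge0 ?mulr_ge0 ?powR_ge0 ?(ltW c30)//.
    by rewrite ler_wpM2r ?(ltW tH0)// ler_peMr ?(ltW c30)// lerDr mulr_ge0 ?ltW.
  by rewrite -expR0 ler_expR oppr_le0 mulr_ge0 ?powR_ge0 ?(ltW c40).
have u1 : 1 <= dd / T by rewrite ler_pdivlMr// mul1r.
have [k /andP[k1 k2]] := dyadic_bracket _ u1.
exists k.+1.
have -> : near_diagonal (2 ^+ k.+1 * T) (x, y) = 1.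
  by rewrite /near_diagonal/= -/dd -ltr_pdivrMr// k2.
rewrite mulr1 (le_trans up)// /sub_gaussian.
pose u := (dd `^ dW / t) `^ b.
have uE : u = (dd / T) `^ (dW * b).
  rewrite /u powRrM; congr (_ `^ _).
  have -> : dd `^ dW = (dd / T * T) `^ dW by rewrite divfK// gt_eqF.
  rewrite powRM ?divr_ge0 ?(ltW T0)// (powRV_powR dW t (ltW t0) dW0).
  by rewrite mulfK// gt_eqF.
have u2 : 2 ^+ k <= u.
  apply: (le_trans k1); rewrite uE le1r_powR// /b ler_pdivlMr// mul1r.
  by rewrite lerBlDr lerDl.
have z0 : 0 < (2 : R) ^+ k by rewrite exprn_gt0.
have zN0 : 0 < (2 ^+ k : R) `^ N by rewrite powR_gt0.
have E : expR (- (c4 * u)) <= 2 `^ N * C1 * (2 ^+ k.+1) `^ (- N).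
  apply: (@le_trans _ _ (expR (- (c4 * 2 ^+ k)))).
    by rewrite ler_expR lerN2 ler_pM2l.
  have -> : 2 `^ N * C1 * (2 ^+ k.+1) `^ (- N) = C1 / (2 ^+ k) `^ N.
    rewrite exprS powRM ?(ltW z0)// !powRN; field; by rewrite !gt_eqF.
  rewrite ler_pdivlMr// expRN mulrC ler_pdivrMr ?expR_gt0//.
  exact: (powR_le_expR N c4 _ N0 c40 (ltW z0)).
rewrite -!mulrA ler_wpM2l ?(ltW c30)//.
rewrite [leRHS]mulrCA ler_wpM2l ?(ltW tH0)// (le_trans E)//.
by rewrite ler_wpM2r ?powR_ge0// lerDl.
Qed.

(** By [kernel_le_dyadic] the heat energy is a sum over k of oscillations at
    the scales 2^k t^(1 / dW); taking N = dH + b + 1 leaves a geometric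
    series. *)
Lemma heat_energy_le_oscillation b : 0 < b -> exists2 C, 0 < C & forall f K,
  measurable_fun setT f -> 0 <= K ->
  (forall r, 0 < r -> (oscillation r f <= (K * r `^ (dH + b))%:E)%E) ->
  forall t, 0 < t -> (heat_energy t f <= (C * K * t `^ (b / dW))%:E)%E.
Proof.
move=> b0; pose N := dH + b + 1; have N0 : 0 < N by rewrite !addr_gt0.
have [C C0 dyadic] := kernel_le_dyadic N N0.
exists (C * 2); first by rewrite mulr_gt0.
move=> f K mf K0 hK t t0; pose T := t `^ dW^-1; have T0 : 0 < T by rewrite powR_gt0.
have tH0 : 0 < t `^ (- (dH / dW)) by rewrite powR_gt0.
pose a (k : nat) := C * t `^ (- (dH / dW)) * (2 ^+ k) `^ (- N).
have a0 k : 0 <= a k by rewrite !mulr_ge0 ?powR_ge0// ltW.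
pose w k z := a k * near_diagonal (2 ^+ k * T) z.
have w0 k z : 0 <= w k z by rewrite mulr_ge0 ?near_diagonal_ge0.
have mw k : measurable_fun setT (w k).
  by apply: measurable_funM => //; exact: measurable_near_diagonal.
have wf0 k z : (0 <= (w k z * `|f z.1 - f z.2|)%:E)%E by rewrite lee_fin mulr_ge0.
have step : (heat_energy t f <= \sum_(k <oo) energy mu (w k) f)%E.
  rewrite /energy -integral_nneseries//; last first.
    by move=> k; apply: measurable_energy_integrand.
  apply: ge0_le_integralW => -[x y] _ /=; first by rewrite lee_fin mulr_ge0// kernel_pos.
  have [k hk] := dyadic t x y t0.
  have := @nneseries_ge_term R (fun k => (w k (x, y) * `|f x - f y|)%:E) k.
  move=> /(_ (fun k => wf0 k (x, y))); apply: le_trans.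
  by rewrite lee_fin ler_wpM2r.
apply: (le_trans step).
have -> : (C * 2 * K * t `^ (b / dW))%:E = ((C * K * t `^ (b / dW)) * 2)%:E.
  by congr (_%:E); ring.
apply: (@le_trans _ _ (\sum_(k <oo) (C * K * t `^ (b / dW) * 2^-1 ^+ k)%:E)%E); last first.
  apply: (le_trans (geometric_nneseries_le _ _ _ _ _)).
  - by rewrite !mulr_ge0 ?powR_ge0 ?(ltW C0).
  - by [].
  - by rewrite invf_lt1 ?ltr1n.
  - have -> : 1 - 2^-1 = 2^-1 :> R by field.
    by rewrite invrK.
apply: lee_nneseries => [k _ _|k _]; first by apply: energy_ge0.
have z0 : 0 < (2 ^+ k : R) by rewrite exprn_gt0.
rewrite /w energyZ//; last exact: measurable_near_diagonal.
have zT : 0 < 2 ^+ k * T by rewrite mulr_gt0.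
apply: (le_trans (lee_wpmul2l _ (hK _ zT))); first by rewrite lee_fin.
rewrite -EFinM lee_fin /a powRM ?(ltW z0) ?(ltW T0)//.
have e1 : (2 ^+ k : R) `^ (- N) * (2 ^+ k) `^ (dH + b) = 2^-1 ^+ k.
  rewrite -powRD ?(gt_eqF z0) ?implybT// exprVn -(powR_inv1 (ltW z0)).
  by congr (_ `^ _); rewrite /N; ring.
have e2 : t `^ (- (dH / dW)) * T `^ (dH + b) = t `^ (b / dW).
  rewrite /T -powRrM -powRD ?(gt_eqF t0) ?implybT//.
  by congr (_ `^ _); field; rewrite gt_eqF.
rewrite -e1 -e2 le_eqVlt; apply/orP; left; apply/eqP; ring.
Qed.

End scales.

(** * The subordinated semigroup *)

Section subordination.
Context {d : measure_display} {R : realType} {X : metricMeasurableType d R}.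
Context (mu : {sigma_finite_measure set X -> \bar R}).
Context (p : R -> X -> X -> R) (delta : R) (eta : R -> R -> R).
Hypotheses (delta01 : 0 < delta < 1) (heta : subordinator delta eta).
Hypothesis mp : measurable_fun [set q : R * X * X | 0 < q.1.1]
  (fun q : R * X * X => p q.1.1 q.1.2 q.2).
Hypothesis p0 : forall s x y, 0 < s -> 0 <= p s x y.
Implicit Types (s t : R) (f : X -> R).

Let D : set R := `]0, +oo[%classic.

Let mD : measurable D. Proof. exact: measurable_itv. Qed.

Let DE s : D s = (0 < s) :> Prop.
Proof. by rewrite /D/= in_itv/= andbT. Qed.

Let D3 : set (X * X * R) := [set q | 0 < q.2].

Let mD3 : measurable D3.
Proof.
rewrite (_ : D3 = setT `&` snd @^-1` D); last first.
  by apply/seteqP; split => q /=; rewrite -/(D _) DE// => -[].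
by apply: measurable_snd.
Qed.

Lemma measurable_kernel_comp {d'} {T : measurableType d'} (E : set T)
    (a : T -> R) (b c : T -> X) :
  measurable_fun setT a -> measurable_fun setT b -> measurable_fun setT c ->
  (forall z, E z -> 0 < a z) -> measurable_fun E (fun z => p (a z) (b z) (c z)).
Proof.
move=> ma mb mc a0; pose g (z : T) : R * X * X := (a z, b z, c z).
apply: (@measurable_comp _ _ _ _ _ _ [set q : R * X * X | 0 < q.1.1]
  (fun q => p q.1.1 q.1.2 q.2) _ g _ _ mp).
- rewrite (_ : mkset _ = setT `&` (fun q : R * X * X => q.1.1) @^-1` D); last first.
    by apply/seteqP; split => q /=; rewrite -/(D _) DE// => -[].
  by apply: (measurableT_comp measurable_fst measurable_fst).
- by move=> _ [z Ez <-]; exact: a0.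
- by apply: measurable_funTS; do 2!apply: measurable_fun_pair => //.
Qed.

(** The integrand of the energy for the subordinated kernel, before any
    integration. It is 0 at nonpositive times, where neither eta nor p is
    constrained. *)
Definition subordinated t f (q : X * X * R) : \bar R :=
  ((fun q => (eta t q.2 * (p q.2 q.1.1 q.1.2 * `|f q.1.1 - f q.1.2|))%:E) \_ D3) q.

Let subordinatedE t f z s : 0 < s ->
  subordinated t f (z, s) = (eta t s * (p s z.1 z.2 * `|f z.1 - f z.2|))%:E.
Proof. by move=> s0; rewrite /subordinated patchE mem_set. Qed.

Lemma subordinated_ge0 t f q : 0 < t -> (0 <= subordinated t f q)%E.
Proof.
move=> t0; rewrite /subordinated patchE; case: ifP => // /set_mem q0.
by rewrite lee_fin !mulr_ge0 ?p0// (subordinator_ge0 delta eta heta)// -/(D _) DE.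
Qed.

Lemma measurable_subordinated t f : 0 < t -> measurable_fun setT f ->
  measurable_fun setT (subordinated t f).
Proof.
move=> t0 mf.
have mx : measurable_fun setT (fun q : X * X * R => q.1.1).
  exact: (measurableT_comp measurable_fst measurable_fst).
have my : measurable_fun setT (fun q : X * X * R => q.1.2).
  exact: (measurableT_comp measurable_snd measurable_fst).
have ms : measurable_fun setT (fun q : X * X * R => q.2) by exact: measurable_snd.
apply/(measurable_restrictT _ mD3)/measurable_EFinP.
apply: measurable_funM; last apply: measurable_funM.
- apply: (measurable_comp mD _ (measurable_subordinator delta eta heta t t0)).
    by move=> _ [q q0 <-]; rewrite DE.
  exact: measurable_funTS.
- by apply: measurable_kernel_comp.
- apply: measurable_funTS.
  apply: (@measurableT_comp _ _ _ _ _ _ (@Num.Def.normr R R)) => //.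
  by apply: measurable_funB; apply: measurableT_comp.
Qed.

Definition sub_energy t f : \bar R :=
  (\int[lebesgue_measure]_(s in D) ((eta t s)%:E * heat_energy mu p s f))%E.

Let integral_subordinated t f z : 0 < t ->
  (\int[@lebesgue_measure R]_s subordinated t f (z, s) =
   `|f z.1 - f z.2|%:E * sub_kernel p eta t z.1 z.2)%E.
Proof.
move=> t0; rewrite /sub_kernel -ge0_integralZl_EFin//; first last.
- apply/measurable_EFinP; apply: measurable_funM.
    exact: (measurable_subordinator delta eta heta).
  by apply: measurable_kernel_comp => // s; rewrite -/(D s) DE.
- move=> s; rewrite -/(D _) => Ds; rewrite lee_fin mulr_ge0//.
    exact: (subordinator_ge0 delta eta heta).
  by rewrite p0// -DE.
rewrite [RHS]integral_mkcond; apply: eq_integral => s _.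
rewrite patchE; case: ifPn => [/set_mem|/negP] Ds.
  have s0 : 0 < s by rewrite -DE.
  by rewrite subordinatedE// -EFinM; congr (_%:E); ring.
rewrite /subordinated patchE; case: ifPn => // /set_mem s0.
by exfalso; apply: Ds; apply/mem_set; rewrite -/(D _) DE.
Qed.

Lemma sub_energyE t f : 0 < t -> measurable_fun setT f ->
  sub_energy t f =
  (\int[mu \x mu]_z \int[@lebesgue_measure R]_s subordinated t f (z, s))%E.
Proof.
move=> t0 mf.
rewrite (tonelli_parameter mu (@lebesgue_measure R) (subordinated t f)); last 2 first.
- exact: measurable_subordinated.
- by move=> q; exact: subordinated_ge0.
rewrite /sub_energy integral_mkcond; apply: eq_integral => s _.
rewrite patchE; case: ifPn => [/set_mem|/negP] Ds; last first.
  rewrite integral0_eq// => z _; rewrite /subordinated patchE; case: ifPn => // /set_mem s0.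
  by exfalso; apply: Ds; apply/mem_set; rewrite DE.
have s0 : 0 < s by rewrite -DE.
rewrite /heat_energy /energy -ge0_integralZl_EFin//.
- by apply: eq_integral => z _; rewrite subordinatedE// -EFinM.
- by move=> z _; rewrite lee_fin mulr_ge0// p0.
- apply: measurable_energy_integrand => //.
  exact: measurable_kernel_comp.
- exact: (subordinator_ge0 delta eta heta).
Qed.

Let measurable_integral_subordinated t f : 0 < t -> measurable_fun setT f ->
  measurable_fun setT (fun z => \int[@lebesgue_measure R]_s subordinated t f (z, s))%E.
Proof.
move=> t0 mf;
  apply: (@measurable_fun_fubini_tonelli_F _ _ _ _ _ (@lebesgue_measure R) (subordinated t f)).
  exact: measurable_subordinated.
by move=> q; exact: subordinated_ge0.
Qed.

Let integral_subordinated_ge0 t f z : 0 < t ->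
  (0 <= \int[@lebesgue_measure R]_s subordinated t f (z, s))%E.
Proof. by move=> t0; apply: integral_ge0 => s _; exact: subordinated_ge0. Qed.

Lemma sub_energy_ge0 t f : 0 < t -> measurable_fun setT f -> (0 <= sub_energy t f)%E.
Proof. by move=> t0 mf; rewrite sub_energyE//; apply: integral_ge0 => z _;
  exact: integral_subordinated_ge0. Qed.

Lemma besov_seminormE a f : measurable_fun setT f ->
  besov_seminorm mu p eta 1 a f =
  ereal_sup [set ((t `^ (- a))%:E * sub_energy t f)%E | t in [set t : R | 0 < t]].
Proof.
move=> mf; congr ereal_sup; apply: eq_imagel => t /= t0; congr (_ * _)%E.
rewrite sub_energyE// (fubini_tonelli2 (fun z => \int[@lebesgue_measure R]_s subordinated t f (z, s))%E); last 2 first.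
- exact: measurable_integral_subordinated.
- by move=> z; exact: integral_subordinated_ge0.
rewrite invr1 poweRe1; last first.
  apply: integral_ge0 => y _; apply: integral_ge0 => x _; apply: mule_ge0 => //.
  apply: integral_ge0 => s Ds; rewrite lee_fin mulr_ge0//.
    exact: (subordinator_ge0 delta eta heta).
  by rewrite p0// -DE.
apply: eq_integral => y _; apply: eq_integral => x _.
by rewrite powRr1// integral_subordinated.
Qed.

Lemma heat_energy_le_sub_energy C s t f : 0 <= C -> 0 < s -> 0 < t -> measurable_fun setT f ->
  (forall x y, ((p s x y)%:E <= C%:E * sub_kernel p eta t x y)%E) ->
  (heat_energy mu p s f <= C%:E * sub_energy t f)%E.
Proof.
move=> C0 s0 t0 mf pC; rewrite sub_energyE// -ge0_integralZl_EFin//; first last.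
- exact: measurable_integral_subordinated.
- by move=> z _; exact: integral_subordinated_ge0.
apply: ge0_le_integralW => -[x y] _ /=; first by rewrite lee_fin mulr_ge0// p0.
rewrite integral_subordinated//= muleCA EFinM [leRHS]muleC.
by rewrite [leRHS]muleC muleC; apply: lee_wpmul2l.
Qed.

Hypothesis pmass : forall s x, 0 < s -> (\int[mu]_y (p s x y)%:E = 1)%E.
Hypothesis heat_int : forall s x f, 0 < s -> mu.-integrable setT (EFin \o f) ->
  mu.-integrable setT (fun y => (p s x y * f y)%:E).

Let mpr s x : 0 < s -> measurable_fun setT (p s x).
Proof. by move=> s0; apply: measurable_kernel_comp. Qed.

Let p_int s x : 0 < s -> mu.-integrable setT (fun y => (p s x y)%:E).
Proof.
move=> s0; apply/integrableP; split; first by apply/measurable_EFinP; exact: mpr.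
under eq_integral do rewrite gee0_abs ?lee_fin ?p0//.
by rewrite pmass// ltry.
Qed.

Let heat_diffE s x f : 0 < s -> mu.-integrable setT (EFin \o f) ->
  (heat mu p s f x - f x)%:E = (\int[mu]_y (p s x y * (f y - f x))%:E)%E.
Proof.
move=> s0 fi; have pf := heat_int s x f s0 fi.
have pc : mu.-integrable setT (EFin \o (fun y => f x * p s x y)).
  exact: (integrableZl _ (f x) (p_int s x s0)).
transitivity (\int[mu]_y ((p s x y * f y)%:E - (f x * p s x y)%:E))%E; last first.
  by apply: eq_integral => y _; rewrite -EFinB mulrBr (mulrC (f x)).
rewrite (integralB_EFin _ pf pc)// EFinB; congr (_ - _)%E.
  rewrite /heat /Rintegral fineK//; exact: integrable_fin_num.
under eq_integral do rewrite EFinM.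
rewrite integralZl//; last exact: p_int.
by rewrite pmass// mule1.
Qed.

Let heat_diff_le s x f : 0 < s -> mu.-integrable setT (EFin \o f) ->
  (`|heat mu p s f x - f x|%:E <= \int[mu]_y (p s x y * `|f x - f y|)%:E)%E.
Proof.
move=> s0 fi; have mf : measurable_fun setT f by apply/measurable_EFinP; exact: measurable_int fi.
rewrite -abse_EFin heat_diffE//; apply: (le_trans (le_abse_integral _ _ _)) => //.
  apply/measurable_EFinP; apply: measurable_funM; first exact: mpr.
  by apply: measurable_funB => //; exact: measurable_cst.
apply: ge0_le_integralW => y _ //.
by rewrite abse_EFin lee_fin normrM ger0_norm ?p0// distrC.
Qed.

(** The positive and the negative part of the integrand are integrated
    separately, as Tonelli requires. *)
Let measurable_heat_time x f : mu.-integrable setT (EFin \o f) ->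
  measurable_fun D (fun s => heat mu p s f x).
Proof.
move=> fi; have mf : measurable_fun setT f by apply/measurable_EFinP; exact: measurable_int fi.
pose D2 : set (R * X) := [set q | 0 < q.1].
have mD2 : measurable D2.
  rewrite (_ : D2 = setT `&` fst @^-1` D); last first.
    by apply/seteqP; split => q /=; rewrite -/(D _) DE// => -[].
  by apply: measurable_fst.
pose g (q : R * X) : \bar R := ((fun q => (p q.1 x q.2 * f q.2)%:E) \_ D2) q.
have mg : measurable_fun setT g.
  apply/(measurable_restrictT _ mD2)/measurable_EFinP; apply: measurable_funM.
    exact: measurable_kernel_comp.
  by apply: measurable_funTS; apply: measurableT_comp.
pose G s := (\int[mu]_y (g^\+ (s, y)) - \int[mu]_y (g^\- (s, y)))%E.
have mG : measurable_fun setT G.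
  apply: emeasurable_funB.
    apply: (@measurable_fun_fubini_tonelli_F _ _ _ _ _ mu g^\+%E) => //;
      exact: measurable_funepos.
  apply: (@measurable_fun_fubini_tonelli_F _ _ _ _ _ mu g^\-%E) => //; exact: measurable_funeneg.
apply: (@eq_measurable_fun _ _ _ _ _ (fun s => fine (G s))).
  move=> s /set_mem; rewrite DE => s0; rewrite /heat /Rintegral integralE; congr (fine (_ - _)).
    by apply: eq_integral => y _; rewrite !funeposE /g patchE mem_set.
  by apply: eq_integral => y _; rewrite !funenegE /g patchE mem_set.
by apply: measurable_funTS; apply: measurableT_comp.
Qed.

Let integral_subordinatedC t f x : 0 < t -> measurable_fun setT f ->
  (\int[lebesgue_measure]_(s in D) ((eta t s)%:E * \int[mu]_y (p s x y * `|f x - f y|)%:E) =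
   \int[mu]_y \int[@lebesgue_measure R]_s subordinated t f (x, y, s))%E.
Proof.
move=> t0 mf; pose H (q : X * R) := subordinated t f (x, q.1, q.2).
have mH : measurable_fun setT H.
  apply: (measurableT_comp (measurable_subordinated t f t0 mf)).
  by do 2!apply: measurable_fun_pair => //.
have H0 q : (0 <= H q)%E by exact: subordinated_ge0.
transitivity (\int[@lebesgue_measure R]_s \int[mu]_y H (y, s))%E; last first.
  by rewrite (@fubini_tonelli _ _ _ _ _ mu (@lebesgue_measure R) H).
rewrite integral_mkcond; apply: eq_integral => s _.
rewrite patchE; case: ifPn => [/set_mem|/negP] Ds; last first.
  rewrite integral0_eq// => z _; rewrite /H /subordinated patchE; case: ifPn => // /set_mem s0.
  by exfalso; apply: Ds; apply/mem_set; rewrite DE.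
have s0 : 0 < s by rewrite -DE.
rewrite -ge0_integralZl_EFin//.
- by apply: eq_integral => y _; rewrite /H subordinatedE// -EFinM.
- by move=> y _; rewrite lee_fin mulr_ge0// p0.
- apply/measurable_EFinP; apply: measurable_funM; first exact: mpr.
  apply: (@measurableT_comp _ _ _ _ _ _ (@Num.Def.normr R R)) => //.
  by apply: measurable_funB => //; exact: measurable_cst.
- exact: (subordinator_ge0 delta eta heta).
Qed.

(** The kernel and the subordinator have mass one, so the difference is the
    average over s of the integral of p_s(x,y) (f y - f x). If the right-hand
    side is finite it dominates this average, which makes the integral in time
    additive. *)
Lemma sub_semigroup_diff_le t f x : 0 < t -> mu.-integrable setT (EFin \o f) ->
  (`|sub_semigroup mu p eta t f x - f x|%:E <=
   \int[mu]_y \int[@lebesgue_measure R]_s subordinated t f (x, y, s))%E.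
Proof.
move=> t0 fi; have mf : measurable_fun setT f by apply/measurable_EFinP; exact: measurable_int fi.
have e0 s : D s -> 0 <= eta t s by exact: (subordinator_ge0 delta eta heta).
set I := (leRHS)%E; have [Ioo|Ioo] := eqVneq I +oo%E; first by rewrite Ioo leey.
have mE := measurable_subordinator delta eta heta t t0.
have mdiff : measurable_fun D (fun s => eta t s * (heat mu p s f x - f x)).
  apply: measurable_funM => //; apply: measurable_funB; last exact: measurable_cst.
  exact: measurable_heat_time.
have bound : (\int[lebesgue_measure]_(s in D) `|(eta t s * (heat mu p s f x - f x))%:E| <= I)%E.
  rewrite /I -integral_subordinatedC//; apply: ge0_le_integralW => s Ds //.
  rewrite abse_EFin normrM ger0_norm ?e0// EFinM; apply: lee_wpmul2l; first by rewrite lee_fin e0.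
  by apply: heat_diff_le => //; rewrite -DE.
have di : lebesgue_measure.-integrable D (EFin \o (fun s => eta t s * (heat mu p s f x - f x))).
  apply/integrableP; split; first exact/measurable_EFinP.
  by rewrite (le_lt_trans bound)// ltey.
have a1 : (\int[lebesgue_measure]_(s in D) (eta t s)%:E = 1)%E.
  rewrite -[RHS](average1 delta eta delta01 heta t t0); apply: eq_integral => s _.
  by rewrite mulr1.
have ei : lebesgue_measure.-integrable D (EFin \o eta t).
  apply/integrableP; split; first exact/measurable_EFinP.
  rewrite (_ : integral _ _ _ = 1%E) ?ltry// -[RHS]a1; apply: eq_integral => s /set_mem Ds.
  by rewrite /= ger0_norm// e0.
have ci : lebesgue_measure.-integrable D (EFin \o (fun s => f x * eta t s)).
  exact: (integrableZl _ (f x) ei).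
have -> : sub_semigroup mu p eta t f x - f x =
    \int[lebesgue_measure]_(s in D) (eta t s * (heat mu p s f x - f x)).
  have -> : sub_semigroup mu p eta t f x =
    \int[lebesgue_measure]_(s in D) (eta t s * (heat mu p s f x - f x) + f x * eta t s).
    by apply: eq_Rintegral => s _; ring.
  rewrite RintegralD// RintegralZl// /Rintegral a1 mulr1; ring.
rewrite -abse_EFin /Rintegral fineK; last exact: integrable_fin_num.
apply: (le_trans _ bound); apply: le_abse_integral => //.
exact/measurable_EFinP.
Qed.

(** By Tonelli, integrating [sub_semigroup_diff_le] over x gives the average
    of the heat energies. *)
Lemma sub_semigroup_L1_le t f : 0 < t -> mu.-integrable setT (EFin \o f) ->
  ('N[mu]_1[EFin \o (fun x => (sub_semigroup mu p eta t f x - f x)%R)] <= sub_energy t f)%E.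
Proof.
move=> t0 fi; have mf : measurable_fun setT f by apply/measurable_EFinP; exact: measurable_int fi.
rewrite Lnorm1 sub_energyE//.
rewrite (fubini_tonelli1 (fun z => \int[@lebesgue_measure R]_s subordinated t f (z, s))%E);
  last 2 first.
- exact: measurable_integral_subordinated.
- by move=> z; exact: integral_subordinated_ge0.
apply: ge0_le_integralW => x _ //; exact: sub_semigroup_diff_le.
Qed.

End subordination.

(** * The critical exponent *)

Section critical_exponents.
Context {d : measure_display} {R : realType} {X : metricMeasurableType d R}.
Context (mu : {sigma_finite_measure set X -> \bar R}) (x0 : X).
Context (dH c1 c2 : R).
Hypotheses (hborel : is_borel X) (hA1 : proper_balls X).
Hypotheses (c10 : 0 < c1) (c20 : 0 < c2) (dH0 : 0 < dH).
Hypothesis hV : forall (x : X) (r : R), 0 <= r ->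
    ((c1 * r `^ dH)%:E <= mu (ball x r))%E /\
    (mu (ball x r) <= (c2 * r `^ dH)%:E)%E.
Context (p : R -> X -> X -> R) (dW kappa c3 c4 c5 c6 : R).
Hypotheses (dW2 : 2 <= dW) (kappa_dW : kappa < dW).
Hypotheses (c30 : 0 < c3) (c40 : 0 < c4) (c50 : 0 < c5) (c60 : 0 < c6).
Hypothesis kb : forall t x y, 0 < t ->
  sub_gaussian dH dW c5 c6 t (mdist x y) <= p t x y
    <= sub_gaussian dH dW c3 c4 t (mdist x y).
Hypothesis mp : measurable_fun [set q : R * X * X | 0 < q.1.1]
  (fun q : R * X * X => p q.1.1 q.1.2 q.2).
Context (delta : R) (eta : R -> R -> R).
Hypotheses (delta01 : 0 < delta < 1) (heta : subordinator delta eta).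
Implicit Types (t r s : R) (x y : X) (f : X -> R).

Let delta0 : 0 < delta. Proof. by case/andP: delta01. Qed.
Let dW0 : 0 < dW. Proof. by rewrite (lt_le_trans _ dW2). Qed.
Let dW1 : 0 < dW - 1. Proof. by rewrite subr_gt0 (lt_le_trans _ dW2)// ltr1n. Qed.

Let p0 s x y : 0 < s -> 0 <= p s x y := kernel_pos dH p dW c3 c4 c5 c6 c50 kb s x y.

Let mps t : 0 < t -> measurable_fun setT (fun z : X * X => p t z.1 z.2).
Proof. by move=> t0; apply: (measurable_kernel_comp p mp). Qed.

(** At subordinated time (b t)^delta at least half of the mass of eta sits at
    times s comparable to t, by [average_window]. There p_s >= k p_t, provided
    that s is large enough for the lower bound at time s to decay more slowly
    than the upper bound at time t; this determines b. *)
Lemma kernel_le_sub_kernel : exists C b, [/\ 0 < C, 0 < b & forall t x y, 0 < t ->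
  ((p t x y)%:E <= C%:E * sub_kernel p eta ((b * t) `^ delta) x y)%E].
Proof.
have [e [M [e0 M0 window]]] := average_window delta eta delta01 heta.
(* From time m t on, the rate of the lower bound is at most c4 / t^(1 / (dW -
   1)). *)
pose m := (c6 / c4) `^ (dW - 1).
have m0 : 0 < m by rewrite powR_gt0// divr_gt0.
pose b := m / e; have b0 : 0 < b by rewrite divr_gt0.
pose k := c5 / c3 * (M * b) `^ (- (dH / dW)).
have Mb0 : 0 < M * b by rewrite mulr_gt0.
have k0 : 0 < k by rewrite mulr_gt0 ?powR_gt0// divr_gt0.
exists (2 / k), b; split => //; first by rewrite divr_gt0.
move=> t x y t0; have bt0 : 0 < b * t by rewrite mulr_gt0.
set T := (b * t) `^ delta; have T0 : 0 < T by rewrite powR_gt0.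
have TE : T `^ delta^-1 = b * t by rewrite /T powR_powRV ?(ltW bt0).
have p0t := p0 t x y t0.
have lower s : e * (b * t) <= s <= M * (b * t) -> k * p t x y <= p s x y.
  move=> /andP[s1 s2]; set dd := mdist x y.
  have mts : m * t <= s by apply: le_trans s1; rewrite /b mulrA [e * _]mulrC divfK ?gt_eqF.
  have s0 : 0 < s by rewrite (lt_le_trans _ mts)// mulr_gt0.
  have /andP[_ up] := kb t x y t0; have /andP[low _] := kb s x y s0.
  rewrite -/dd in up low; apply: le_trans low; apply: (le_trans (ler_wpM2l (ltW k0) up)).
  rewrite /sub_gaussian /k.
  have h1 : (M * b) `^ (- (dH / dW)) * t `^ (- (dH / dW)) <= s `^ (- (dH / dW)).
    rewrite -powRM ?(ltW Mb0) ?(ltW t0)// !powRN.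
    have Mbt0 : 0 < M * b * t by rewrite (mulr_gt0 Mb0 t0).
    rewrite lef_pV2 ?posrE ?(powR_gt0 _ Mbt0) ?(powR_gt0 _ s0)//.
    by rewrite ler_powR2 ?(ltW s0) ?divr_ge0 ?(ltW dH0) ?(ltW dW0)// -mulrA.
  have -> : c5 / c3 * (M * b) `^ (- (dH / dW)) *
      (c3 * t `^ (- (dH / dW)) * expR (- (c4 * (dd `^ dW / t) `^ (dW - 1)^-1))) =
      c5 * ((M * b) `^ (- (dH / dW)) * t `^ (- (dH / dW))) *
        expR (- (c4 * (dd `^ dW / t) `^ (dW - 1)^-1)).
    by field; rewrite gt_eqF.
  apply: ler_pM; rewrite ?expR_ge0//.
  - by rewrite !mulr_ge0 ?powR_ge0 ?(ltW c50).
  - by rewrite ler_wpM2l ?(ltW c50).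
  rewrite ler_expR lerN2.
  have iv0 : 0 <= (dW - 1)^-1 by rewrite invr_ge0 ltW.
  have c64 : 0 < c6 / c4 by rewrite divr_gt0.
  have h2 : (dd `^ dW / s) `^ (dW - 1)^-1 <= (dd `^ dW / t / m) `^ (dW - 1)^-1.
    apply: ler_powR2 => //; first by rewrite divr_ge0 ?powR_ge0 ?(ltW s0).
    rewrite -mulrA -invfM ler_wpM2l ?powR_ge0// lef_pV2 ?posrE ?mulr_gt0//.
    by rewrite mulrC.
  apply: (le_trans (ler_wpM2l (ltW c60) h2)).
  rewrite [(_ / m) `^ _]powRM ?divr_ge0 ?invr_ge0 ?powR_ge0 ?(ltW t0) ?(ltW m0)//.
  have -> : m^-1 `^ (dW - 1)^-1 = c4 / c6.
    have e1 : m `^ (dW - 1)^-1 = c6 / c4 by exact: (powR_powRV _ _ (ltW c64) dW1).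
    by rewrite -(powR_inv1 (ltW m0)) -powRrM mulN1r powRN e1 invf_div.
  by rewrite le_eqVlt; apply/orP; left; apply/eqP; field; rewrite !gt_eqF.
have := window T T0; rewrite TE => w.
have -> : (p t x y)%:E = ((2 / k)%:E * ((k * p t x y)%:E * (2^-1)%:E))%E.
  by rewrite -!EFinM; congr (_%:E); field; rewrite gt_eqF.
apply: lee_wpmul2l; first by rewrite lee_fin divr_ge0// ltW.
have kp0 : 0 <= k * p t x y by rewrite mulr_ge0// ltW.
apply: (le_trans (lee_wpmul2l _ w)); first by rewrite lee_fin.
rewrite -(averageZ delta eta heta)//; last first.
  rewrite (_ : (fun _ => _) = \1_`[e * (b * t), M * (b * t)] :> (R -> R)).
    exact: measurable_indic.
  by apply/funext => s; rewrite indicE mem_setE in_itv/=.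
apply: ge0_le_integralW => s Ds; have es := subordinator_ge0 delta eta heta T s T0 Ds.
  by rewrite lee_fin (mulr_ge0 es)// (mulr_ge0 kp0).
have s0 : 0 < s by move: Ds; rewrite /= in_itv/= andbT.
rewrite lee_fin ler_wpM2l//; case: (boolP (_ <= _ <= _)) => hs; last by rewrite mulr0 p0.
by rewrite mulr1 lower.
Qed.

(** The Besov bound at time (b t)^delta controls the heat energy at time t, by
    [kernel_le_sub_kernel]. *)
Lemma besov_energy_growth a f : measurable_fun setT f ->
  (besov_seminorm mu p eta 1 a f < +oo)%E ->
  exists2 K, 0 <= K & forall t, 0 < t -> (heat_energy mu p t f <= (K * t `^ (delta * a))%:E)%E.
Proof.
move=> mf; rewrite (besov_seminormE mu p delta eta heta mp p0)// => Soo.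
have [C [b [C0 b0 pC]]] := kernel_le_sub_kernel.
set S := ereal_sup _ in Soo.
have Sub t : 0 < t -> ((t `^ (- a))%:E * sub_energy mu p eta t f <= S)%E.
  by move=> t0; apply: ereal_sup_ubound; exists t.
have sub0 t : 0 < t -> (0 <= sub_energy mu p eta t f)%E.
  by move=> t0; apply: (sub_energy_ge0 mu p delta eta heta mp p0).
have S0 : (0 <= S)%E.
  by apply: le_trans (Sub 1 ltr01); apply: mule_ge0; rewrite ?sub0// lee_fin powR_ge0.
have Sfin : S \is a fin_num by rewrite ge0_fin_numE.
have k0 : 0 <= fine S by exact: fine_ge0.
exists (C * (fine S * b `^ (delta * a))).
  by rewrite !mulr_ge0 ?powR_ge0// ltW.
move=> t t0; have bt0 : 0 < b * t by rewrite mulr_gt0.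
set T := (b * t) `^ delta; have T0 : 0 < T by rewrite powR_gt0.
have := heat_energy_le_sub_energy mu p delta eta heta mp p0 C t T f (ltW C0) t0 T0 mf
  (fun x y => pC t x y t0).
move=> /le_trans; apply; rewrite -mulrA EFinM; apply: lee_wpmul2l; first by rewrite lee_fin ltW.
have Ta0 : 0 < T `^ a by rewrite powR_gt0.
have -> : sub_energy mu p eta T f = ((T `^ a)%:E * ((T `^ (- a))%:E * sub_energy mu p eta T f))%E.
  by rewrite muleA -EFinM powRN divff ?mul1e// gt_eqF.
apply: (le_trans (lee_wpmul2l _ (Sub T T0))); first by rewrite lee_fin ltW.
rewrite -(fineK Sfin) -EFinM lee_fin mulrC -[leRHS]mulrA ler_wpM2l//.
by rewrite /T -powRrM powRM ?(ltW b0) ?(ltW t0).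
Qed.

Lemma sub_energy_le b : 0 < b < delta -> exists2 c, 0 < c &
  forall f K, 0 <= K -> (forall s, 0 < s -> (heat_energy mu p s f <= (K * s `^ b)%:E)%E) ->
  forall t, 0 < t -> (sub_energy mu p eta t f <= (c * K * t `^ (b / delta))%:E)%E.
Proof.
move=> bd; have [c c0 mom] := average_powR delta eta delta01 heta b bd.
exists c => // f K K0 hK t t0.
have mb : measurable_fun setT ((@powR R)^~ b) by exact: measurable_powR.
apply: (@le_trans _ _ (average eta t (fun s => K * s `^ b))).
  apply: ge0_le_integralW => s Ds; have es := subordinator_ge0 delta eta heta t s t0 Ds;
    have s0 : 0 < s by move: Ds; rewrite /= in_itv/= andbT.
    by apply: mule_ge0; [rewrite lee_fin|exact: (heat_energy_ge0 mu dH p dW c3 c4 c5 c6 c50 kb)].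
  by rewrite EFinM; apply: lee_wpmul2l; [rewrite lee_fin|exact: hK].
rewrite (averageZ delta eta heta)//; last by move=> s s0; exact: powR_ge0.
apply: (le_trans (lee_wpmul2l _ (mom t t0))); first by rewrite lee_fin.
by rewrite -EFinM lee_fin mulrA [K * c]mulrC.
Qed.

Lemma energy_growth_besov b f K : 0 < b < delta -> mu.-integrable setT (EFin \o f) ->
  0 <= K -> (forall s, 0 < s -> (heat_energy mu p s f <= (K * s `^ b)%:E)%E) ->
  besov mu p eta 1 (b / delta) f.
Proof.
move=> bd fi K0 hK; have [c c0 hc] := sub_energy_le b bd.
have mf : measurable_fun setT f by apply/measurable_EFinP; exact: measurable_int fi.
split; first by exact/Lfun1_integrable.
rewrite (besov_seminormE mu p delta eta heta mp p0)//.
apply: (@le_lt_trans _ _ (c * K)%:E); last exact: ltry.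
apply: ge_ereal_sup => _ [t /= t0 <-].
have tp0 : 0 < t `^ (b / delta) by rewrite powR_gt0.
apply: (le_trans (lee_wpmul2l _ (hc f K K0 hK t t0))); first by rewrite lee_fin powR_ge0.
rewrite -EFinM lee_fin powRN mulrCA mulVf ?mulr1// gt_eqF//.
Qed.

(** The Korevaar-Schoen energy controls the oscillation at small scales and
    the L1 norm controls it at large ones, where r^dH is at most a constant
    times r^(dH + b). *)
Lemma KS_energy_growth l b f : 0 < b -> b <= l -> KS mu l 1 f ->
  exists2 K, 0 <= K & forall t, 0 < t -> (heat_energy mu p t f <= (K * t `^ (b / dW))%:E)%E.
Proof.
move=> b0 bl [fL KSf]; have fi : mu.-integrable setT (EFin \o f) by exact/Lfun1_integrable.
have mf : measurable_fun setT f by apply/measurable_EFinP; exact: measurable_int fi.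
have [C C0 hC] := heat_energy_le_oscillation mu x0 dH hborel hA1 dH0 p dW c3 c4 c5 c6 dW2 c30 c40 c50 kb b b0.
suff [K K0 hK] : exists2 K, 0 <= K &
    forall r, 0 < r -> (oscillation mu r f <= (K * r `^ (dH + b))%:E)%E.
  exists (C * K); first by rewrite mulr_ge0// ltW.
  by move=> t t0; exact: hC.
move: KSf; rewrite limf_esupE => /ereal_inf_lt[_ [V V0 <-] SV].
have [r1 r10 hr1] : exists2 r1, 0 < r1 & forall r, 0 < r -> r < r1 -> V r.
  have /nbhs_right0P/nbhs_ballP[e /= e0 eV] : \forall r \near 0^'+, V r by [].
  exists e => // r r0 re; rewrite -[r]add0r; apply: eV => //.
  by rewrite -ball_normE/= sub0r normrN gtr0_norm.
(* The minimum with 1 allows r^l <= r^b for b <= l at the scales below r2. *)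
pose r2 := Num.min r1 1; have r20 : 0 < r2 by rewrite lt_min r10 ltr01.
set S := ereal_sup _ in SV.
pose v := fine S.
have KSv r : 0 < r -> r < r2 -> (KS_energy mu l 1 f r <= v%:E)%E.
  move=> r0; rewrite lt_min => /andP[rr1 _].
  have h : (KS_energy mu l 1 f r <= S)%E.
    by apply: ereal_sup_ubound; exists r => //; exact: hr1.
  rewrite /v fineK// ge0_fin_numE// (le_trans _ h)//.
  exact: KS_energy_ge0.
have v0 : 0 <= v.
  have r3 : 0 < r2 / 2 by rewrite divr_gt0.
  rewrite -lee_fin (le_trans _ (KSv (r2 / 2) r3 _))//.
    exact: KS_energy_ge0.
  by rewrite ltr_pdivrMr// mulr_natr mulr2n ltrDl.
pose N := fine (\int[mu]_x `|f x|%:E)%E.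
have NE : (\int[mu]_x `|f x|%:E = N%:E)%E.
  rewrite /N fineK// ge0_fin_numE ?integral_ge0//.
  by case/integrableP: fi.
have N0 : 0 <= N by apply: fine_ge0; apply: integral_ge0.
exists (c2 * v + 2 * c2 * N / r2 `^ b).
  by rewrite addr_ge0 ?divr_ge0 ?mulr_ge0 ?powR_ge0 ?(ltW c20).
have r2b : 0 < r2 `^ b by rewrite powR_gt0.
move=> r r0; have rH : 0 < r `^ dH by rewrite powR_gt0.
have rb : 0 < r `^ b by rewrite powR_gt0.
have rHb : r `^ (dH + b) = r `^ dH * r `^ b by rewrite powRD// (gt_eqF r0) implybT.
have [rr|rr] := ltP r r2.
  have h := oscillation_le_KS_energy mu x0 dH c1 c2 hborel hA1 c10 c20 hV l f r r0 mf.
  apply: (le_trans h); apply: (le_trans (lee_wpmul2l _ (KSv r r0 rr))).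
    by rewrite lee_fin mulr_ge0 ?powR_ge0// ltW.
  rewrite -EFinM lee_fin mulrDl; apply: ler_wpDr.
    by rewrite mulr_ge0 ?powR_ge0// divr_ge0 ?powR_ge0// !mulr_ge0 ?(ltW c20).
  rewrite mulrAC ler_wpM2l ?mulr_ge0 ?(ltW c20)//.
  have r1' : r <= 1 by move: rr; rewrite lt_min => /andP[_ /ltW].
  by apply: ger_powR; [rewrite r0 r1'|rewrite addrC lerD2r].
have h := oscillation_le_L1 mu x0 dH c1 c2 hborel hA1 c20 hV f r r0 fi.
apply: (le_trans h); rewrite NE -EFinM lee_fin [leRHS]mulrDl; apply: ler_wpDl.
  by rewrite mulr_ge0 ?powR_ge0// mulr_ge0// ltW.
rewrite rHb.
have -> : 2 * c2 * N / r2 `^ b * (r `^ dH * r `^ b) =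
  2 * c2 * r `^ dH * N * (r `^ b / r2 `^ b) by field; rewrite gt_eqF.
rewrite ler_peMr//; first by rewrite !mulr_ge0 ?(ltW c20) ?(ltW rH).
by rewrite ler_pdivlMr// mul1r ler_powR2 ?(ltW b0) ?(ltW r20).
Qed.

Lemma energy_growth_KS l f K : mu.-integrable setT (EFin \o f) -> 0 <= K ->
  (forall t, 0 < t -> (heat_energy mu p t f <= (K * t `^ (l / dW))%:E)%E) -> KS mu l 1 f.
Proof.
move=> fi K0 hK.
have mf : measurable_fun setT f by apply/measurable_EFinP; exact: measurable_int fi.
split; first by exact/Lfun1_integrable.
have [C C0 hC] := oscillation_le_heat_energy mu dH p dW c3 c4 c5 c6 dW2 c50 c60 kb mps.
rewrite limf_esupE; apply: (@le_lt_trans _ _ (C * K / c1)%:E); last exact: ltry.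
pose V := [set r : R | 0 < r].
apply: (@le_trans _ _ (ereal_sup (KS_energy mu l 1 f @` V))).
  by apply: ereal_inf_lbound; exists V => //; exact: nbhs_right_gt.
apply: ge_ereal_sup => _ [r /= r0 <-].
have rW0 : 0 < r `^ dW by rewrite powR_gt0.
have rlH : 0 < r `^ (l + dH) by rewrite powR_gt0.
apply: (le_trans (KS_energy_le_oscillation mu x0 dH c1 c2 hborel hA1 c10 hV l f r r0 mf)).
have i0 : (0 <= ((c1 * r `^ (l + dH))^-1)%:E)%E by rewrite lee_fin invr_ge0 mulr_ge0 ?ltW.
apply: (le_trans (lee_wpmul2l i0 (hC f r r0 mf))).
have j0 : (0 <= (C * r `^ dH)%:E)%E by rewrite lee_fin mulr_ge0 ?powR_ge0// ltW.
apply: (le_trans (lee_wpmul2l i0 (lee_wpmul2l j0 (hK _ rW0)))).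
rewrite -!EFinM lee_fin -powRrM.
have -> : dW * (l / dW) = l by field; rewrite gt_eqF.
have e : r `^ (l + dH) = r `^ l * r `^ dH by rewrite powRD// (gt_eqF r0) implybT.
have rl : 0 < r `^ l by rewrite powR_gt0.
have rH : 0 < r `^ dH by rewrite powR_gt0.
by rewrite e le_eqVlt; apply/orP; left; apply/eqP; field; rewrite !gt_eqF.
Qed.

Let theta := 1 - kappa / dW.

Let theta0 : 0 < theta.
Proof. by rewrite subr_gt0 ltr_pdivrMr// mul1r. Qed.

(** Growth of order t^c of the heat energies gives the Besov exponent c /
    delta when c < delta, and the Korevaar-Schoen exponent dW c. Applied to
    functions of the Korevaar-Schoen spaces, the first implication shows that
    alpha1 is at least min(theta, delta) / delta; since alpha1 < 1, this
    forces theta < delta and alpha1 >= theta / delta. The second, applied to a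
    nonconstant Besov function, bounds its exponent by theta / delta. *)
Lemma critical_exponent : KS_critical mu = (dW - kappa)%:E -> (alpha1 mu p eta < 1)%E ->
  theta < delta /\ alpha1 mu p eta = (theta / delta)%:E.
Proof.
move=> KSc a1.
have lower c : 0 < c -> c < Num.min theta delta -> ((c / delta)%:E <= alpha1 mu p eta)%E.
  move=> c0; rewrite lt_min => /andP[ct cd].
  have : ((dW * c)%:E < KS_critical mu)%E.
    by rewrite KSc lte_fin -ltr_pdivlMl// mulrC mulrBl divff ?gt_eqF.
  move=> /ereal_sup_gt[_ [l [l0 [f KSf ncf]] <-]]; rewrite lte_fin => cl.
  have [K K0 hK] := KS_energy_growth l (dW * c) f ltac:(by rewrite mulr_gt0) (ltW cl) KSf.
  apply: ereal_sup_ubound; exists (c / delta) => //; split; first by rewrite divr_gt0.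
  exists f => //; apply: (energy_growth_besov c f K) => //; first by rewrite c0 cd.
    by case: KSf => fL _; exact/Lfun1_integrable.
  move=> s s0; have := hK s s0; by rewrite mulrAC divff ?mul1r// gt_eqF.
have min0 : 0 < Num.min theta delta by rewrite lt_min theta0.
have lower' : ((Num.min theta delta / delta)%:E <= alpha1 mu p eta)%E.
  apply: ereal_ge_of_lt; first by rewrite divr_gt0.
  move=> c /andP[c0 cm]; have := lower (c * delta); rewrite mulfK ?gt_eqF//.
  by apply; [rewrite mulr_gt0|rewrite -ltr_pdivlMr].
have td : theta < delta.
  rewrite ltNge; apply/negP => dt; move: lower'; rewrite (min_idPr dt) divff ?gt_eqF//.
  by rewrite leNgt a1.
split => //; apply/eqP; rewrite eq_le; apply/andP; split; last first.
  by move: lower'; rewrite (min_idPl (ltW td)).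
apply: ge_ereal_sup => _ [a [a0 [f [fL bf] ncf]] <-].
have fi : mu.-integrable setT (EFin \o f) by exact/Lfun1_integrable.
have mf : measurable_fun setT f by apply/measurable_EFinP; exact: measurable_int fi.
have [K K0 hK] := besov_energy_growth a f mf bf.
have KSf : KS mu (dW * (delta * a)) 1 f.
  apply: (energy_growth_KS _ f K) => // t t0.
  by rewrite mulrAC divff ?mul1r ?hK// gt_eqF.
have : ((dW * (delta * a))%:E <= KS_critical mu)%E.
  apply: ereal_sup_ubound; exists (dW * (delta * a)) => //; split; last by exists f.
  by rewrite !mulr_gt0.
rewrite KSc !lee_fin => h; rewrite ler_pdivlMr// /theta.
rewrite -(ler_pM2l dW0) mulrBr mulr1 [dW * (kappa / dW)]mulrC divfK ?gt_eqF//.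
by rewrite [a * delta]mulrC.
Qed.

End critical_exponents.

(** * The displacement estimate *)

Section sigma_finite_copy.
Context {d : measure_display} {T : measurableType d} {R : realType}.
Context (mu : {measure set T -> \bar R}).

(** The measure mu again, as the carrier of the sigma-finiteness that Ahlfors
    regularity provides. *)
Definition sfcopy & sigma_finite setT mu : set T -> \bar R := mu.

Context (sf : sigma_finite setT mu).
HB.instance Definition _ := Measure.copy (sfcopy sf) mu.
HB.instance Definition _ := Measure_isSigmaFinite.Build _ _ _ (sfcopy sf) sf.

Lemma sigma_finite_copy : exists nu : {sigma_finite_measure set T -> \bar R},
  (nu : {measure set T -> \bar R}) = mu.
Proof. by exists (sfcopy sf); apply: eq_measure. Qed.

End sigma_finite_copy.

Lemma ahlfors_sigma_finite {d : measure_display} {R : realType} {X : metricMeasurableType d R}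
    (mu : {measure set X -> \bar R}) (dH : R) (x0 : X) :
  is_borel X -> ahlfors_regular mu dH -> sigma_finite setT mu.
Proof.
move=> hborel hA2; exists (fun n => ball x0 n%:R); first exact: ball_cover.
move=> n; split; first exact: measurable_ballX.
have [_ [c1 [c2 [_ _ /(_ x0 n%:R (ler0n _ n))[_ h]]]]] := hA2.
by rewrite (le_lt_trans h)// ltry.
Qed.

(** On an empty space every function is constant, and the supremum of the
    empty set is not finite. *)
Lemma KS_critical_inhabited {d : measure_display} {R : realType} {X : metricMeasurableType d R}
    (mu : {measure set X -> \bar R}) (l : R) : KS_critical mu = l%:E -> exists x : X, True.
Proof.
move=> KSl; apply: contrapT => nox.
have : ((l - 1)%:E < KS_critical mu)%E by rewrite KSl lte_fin; lra.
move=> /ereal_sup_gt[_ [k [_ [f _ ncf]] _] _]; apply: ncf.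
by exists 0; apply: nearW => x; exfalso; apply: nox; exists x.
Qed.

Section displacement.
Context {d : measure_display} {R : realType} {X : metricMeasurableType d R}.
Context (mu : {sigma_finite_measure set X -> \bar R}) (x0 : X).
Context (P : R -> (X -> R) -> (X -> R)) (p : R -> X -> X -> R).
Context (dH dW kappa delta : R) (eta : R -> R -> R).
Hypotheses (hborel : is_borel X) (hA1 : proper_balls X).
Hypotheses (hA2 : ahlfors_regular mu dH) (hP : symmetric_markov_semigroup mu P).
Hypotheses (hp : continuous_heat_kernel mu p P) (hHK : heat_kernel_estimates mu p dH dW).
Hypotheses (hBE : bakry_emery mu p dW kappa) (delta01 : 0 < delta < 1).
Hypotheses (heta : subordinator delta eta) (halpha : (alpha1 mu p eta < 1)%E).

Lemma sub_semigroup_displacement : exists2 C : R, 0 < C &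
    forall f : X -> R, besov mu p eta 1 (fine (alpha1 mu p eta)) f ->
    forall t : R, 0 < t ->
      ('N[mu]_1[EFin \o (fun x => (sub_semigroup mu p eta t f x - f x)%R)] <=
       (C * t `^ fine (alpha1 mu p eta))%:E * Var mu dW kappa f)%E.
Proof.
have [dW2 [c3 [c4 [c5 [c6 [[c30 c40 c50 c60] HK]]]]]] := hHK.
have [kappa0 kappa_dW KSc [M M0 BE]] := hBE.
have [dH0 [c1 [c2 [c10 c20 hV]]]] := hA2.
have dW0 : 0 < dW by rewrite (lt_trans kappa0).
have delta0 : 0 < delta by case/andP: delta01.
have kb := kernel_bounds mu P p dH dW hborel hA2 hp dW2 c3 c4 c5 c6 HK.
have p0 s x y : 0 < s -> 0 <= p s x y by exact: (kernel_pos dH p dW c3 c4 c5 c6 c50 kb).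
have mpt := measurable_kernel mu x0 P p hborel hA1 hp.
have mp : measurable_fun [set q : R * X * X | 0 < q.1.1] (fun q : R * X * X => p q.1.1 q.1.2 q.2).
  apply: (continuous_measurableRXX hborel hA1 x0 [set t : R | 0 < t]); first exact: open_gt.
  exact: hp.1.
have psym := kernel_sym mu x0 P p dH dW hborel hA1 hA2 hP hp dW2 c3 c4 c5 c6 c30 c40 c50 HK.
have pmass := mass_eq1 mu x0 P p dH dW kappa hborel hA1 hA2 hP hp dW2 c3 c4 c5 c6 c30 c40 c50 c60
  HK M kappa0 M0 BE.
have vE t (A : set X) x : 0 < t -> measurable A -> (mu A < +oo)%E ->
    (heat mu p t \1_A x)%:E = (\int[mu]_y (p t x y * \1_A y)%:E)%E.
  exact: (heat_indicE mu x0 P p dH dW hborel hA1 hA2 hp dW2 c3 c4 c5 c6 c30 c40 c50 HK).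
have v_chapman s t (A : set X) : 0 < s -> 0 < t -> measurable A -> (mu A < +oo)%E ->
    \forall x \ae mu, (heat mu p (s + t) \1_A x)%:E =
      (\int[mu]_y (p s x y * heat mu p t \1_A y)%:E)%E.
  move=> s0 t0 mA Aoo.
  have := mass_semigroup_fin mu x0 P p dH dW kappa hborel hA1 hA2 hP hp dW2 c3 c4 c5 c6
    c30 c40 c50 HK M kappa0 M0 BE s t A s0 t0 mA Aoo.
  apply: filterS => x massE; rewrite vE ?addr_gt0//; apply: (etrans massE).
  by apply: eq_integral => y _; rewrite EFinM vE.
have v_holder t (A : set X) x y : 0 < t -> measurable A -> (mu A < +oo)%E ->
    heat mu p t \1_A x <= heat mu p t \1_A y +
      M * t `^ (- (kappa / dW)) * mdist (x, y).1 (x, y).2 `^ kappa.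
  move=> t0 mA _; have h := heat_indic_holder mu p dW kappa M M0 BE t A x y t0 mA.
  by rewrite -lerBlDl (le_trans (ler_norm _)).
have mD : measurable_fun setT (fun z : X * X => mdist z.1 z.2 `^ kappa).
  apply: (@measurableT_comp _ _ _ _ _ _ ((@powR R)^~ kappa)); first exact: measurable_powR.
  exact: (measurable_mdist hborel hA1 x0).
have energy_iter := energy_iterate mu p (fun z => mdist z.1 z.2 `^ kappa) M (kappa / dW) mpt p0 psym pmass
  mD (fun z => powR_ge0 _ _) (fun x y => congr1 (fun r => r `^ kappa) (metric_sym x y))
  (ltW M0) (fun t A => heat mu p t \1_A) vE v_chapman v_holder.
have [C1 C10 enV] := heat_energy_le_Var mu x0 dH c1 c2 hborel hA1 c10 c20 dH0 hV p dW kappa c3 c4 c5 c6 M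
  dW2 kappa0 kappa_dW (ltW M0) c30 c40 c50 c60 kb mpt energy_iter.
have [theta_delta alE] := critical_exponent mu x0 dH c1 c2 hborel hA1 c10 c20 dH0 hV p dW kappa
  c3 c4 c5 c6 dW2 kappa_dW c30 c40 c50 c60 kb mp delta eta delta01 heta KSc halpha.
set theta := 1 - kappa / dW in enV theta_delta alE.
have theta0 : 0 < theta by rewrite subr_gt0 ltr_pdivrMr// mul1r.
have [c c0 subE] := sub_energy_le mu dH p dW c3 c4 c5 c6 c50 kb delta eta delta01 heta theta
  ltac:(by rewrite theta0).
exists (c * C1); first by rewrite mulr_gt0.
rewrite alE => f [fL bf] t t0 /=.
have fi : mu.-integrable setT (EFin \o f) by exact/Lfun1_integrable.
have mf : measurable_fun setT f by apply/measurable_EFinP; exact: measurable_int fi.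
have heat_int s x g : 0 < s -> mu.-integrable setT (EFin \o g) ->
    mu.-integrable setT (fun y => (p s x y * g y)%:E).
  exact: (heat_integrable mu x0 P p dH dW hborel hA1 hA2 hp dW2 c3 c4 c5 c6 c30 c40 c50 HK).
have growth := besov_energy_growth mu dH dH0 p dW c3 c4 c5 c6 dW2 c30 c40 c50 c60 kb mp delta eta delta01 heta.
have [K K0 hK] := growth (theta / delta) f mf bf.
have dt : delta * (theta / delta) = theta by rewrite mulrC divfK// gt_eqF.
rewrite dt in hK; have {}enV := enV f K fi K0 hK.
apply: (le_trans (sub_semigroup_L1_le mu p delta eta delta01 heta mp p0 pmass heat_int t f t0 fi)).
have tp0 : 0 < t `^ (theta / delta) by rewrite powR_gt0.
have V0 : (0 <= Var mu dW kappa f)%E.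
  have := le_trans (heat_energy_ge0 mu dH p dW c3 c4 c5 c6 c50 kb 1 f ltr01) (enV 1 ltr01).
  by rewrite pmule_rge0// lte_fin mulr_gt0 ?powR_gt0.
case: (Var mu dW kappa f) V0 enV => [v||] // V0 enV; last first.
  by rewrite gt0_muley ?leey// lte_fin !mulr_gt0.
rewrite lee_fin in V0.
have h := subE f (C1 * v) ltac:(by rewrite mulr_ge0// ltW) _ t t0.
apply: (le_trans (h _)) => [s s0|].
  by apply: (le_trans (enV s s0)); rewrite -EFinM lee_fin mulrAC.
by rewrite -EFinM lee_fin le_eqVlt; apply/orP; left; apply/eqP; ring.
Qed.

End displacement.

Theorem theorem4p8 (d : measure_display) (R : realType)
  (X : metricMeasurableType d R) (mu : {measure set X -> \bar R})
  (F : set (X -> R)) (E : (X -> R) -> (X -> R) -> R)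
  (P : R -> (X -> R) -> (X -> R)) (p : R -> X -> X -> R)
  (dH dW kappa delta : R) (eta : R -> R -> R)
  (hborel : is_borel X) (hlc : locally_compact [set: X])
  (hradon : radon_measure mu) (hsupp : full_support mu)
  (hform : dirichlet_form mu F E) (hP : heat_semigroup mu P F E)
  (hA1 : proper_balls X)
  (hA2 : ahlfors_regular mu dH)
  (hA3 : regular_form mu F E /\ strongly_local_form mu F E)
  (hp : continuous_heat_kernel mu p P)
  (hHK : heat_kernel_estimates mu p dH dW)
  (hBE : bakry_emery mu p dW kappa)
  (hdelta : 0 < delta < 1) (heta : subordinator delta eta)
  (halpha : (alpha1 mu p eta < 1)%E) :
  exists2 C : R, 0 < C &
    forall f : X -> R, besov mu p eta 1 (fine (alpha1 mu p eta)) f ->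
    forall t : R, 0 < t ->
      ('N[mu]_1[EFin \o (fun x => (sub_semigroup mu p eta t f x - f x)%R)] <=
       (C * t `^ fine (alpha1 mu p eta))%:E * Var mu dW kappa f)%E.
Proof.
have [x0 _] : exists x : X, True.
  by have [_ _ KSc _] := hBE; exact: (KS_critical_inhabited mu _ KSc).
have [nu nuE] := sigma_finite_copy mu (ahlfors_sigma_finite mu dH x0 hborel hA2).
case: hP => hmarkov _; clear hform hA3 hradon hsupp.
subst mu.
exact: (sub_semigroup_displacement nu x0 P p dH dW kappa delta eta).
Qed.
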